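(* Fix $0<\varepsilon<1/4$, $K>0$, and positive integers $n,m$ with $u=n/m$ (so $n$ and $u$ are fixed). Consider prime powers $q$, nonempty index sets $\mathcal I\subset\{0,1,\dots,n-1\}$ and $\alpha_i\in\mathbb F_q$ ($i\in\mathcal I$) such that $m\le n/100$, $\#\mathcal I<n/24$, $(2+\varepsilon)\log_q n\le m\le n$ and $\sqrt{n\log n}\le Km$. If $0\notin\mathcal I$ and $q\to\infty$, then $$\#(\mathcal S(n,m)\cap\mathcal J)\sim q^{-\#\mathcal I}\,\Psi(n,m).$$
   Context: $\mathbb F_q$ is the finite field with $q$ elements. $\mathcal M(n)$ is the set of monic polynomials of degree $n$ in $\mathbb F_q[t]$. A polynomial is $m$-smooth if all its irreducible factors have degree at most $m$; $\mathcal S(n,m)$ is the set of $m$-smooth $f\in\mathcal M(n)$ and $\Psi(n,m)=\#\mathcal S(n,m)$. The set of monic polynomials with prescribed coefficients is $$\mathcal J=\Big\{t^n+\sum_{i=0}^{n-1}c_it^i\in\mathcal M(n): c_i=\alpha_i \text{ for all } i\in\mathcal I\Big\}.$$ $\log$ is the natural logarithm and $\log_q$ the logarithm in base $q$. $A\sim B$ means $A/B\to1$ as $q\to\infty$; $\mathcal I$ and the $\alpha_i$ may vary with $q$. *)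

(* Defs.v *)
From HB Require Import structures.
From mathcomp Require Import all_boot all_order all_algebra.
From mathcomp Require Import finmap.
From mathcomp Require Import boolp classical_sets functions cardinality.
From mathcomp Require Import reals topology normedtype sequences exp.

Set Implicit Arguments.
Unset Strict Implicit.
Unset Printing Implicit Defensive.

Import Order.TTheory GRing.Theory Num.Theory.
Import numFieldNormedType.Exports.

Local Open Scope classical_set_scope.
Local Open Scope ring_scope.

Definition logb {R : realType} (b x : R) : R := ln x / ln b.

Section SmoothPolynomials.
Variable F : finFieldType.

(* [size f] is one more than the degree of a nonzero [f]. *)
Definition monics (n : nat) : set {poly F} :=
  [set f | f \is monic /\ size f = n.+1].

Definition smooth (m : nat) (f : {poly F}) : Prop :=
  forall p : {poly F}, irreducible_poly p -> p %| f -> (size p <= m.+1)%N.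

Definition smooths (n m : nat) : set {poly F} :=
  [set f | monics n f /\ smooth m f].

(* Only the values of [alpha] on [I] matter. *)
Definition prescribed (n : nat) (I : {set 'I_n}) (alpha : 'I_n -> F) :
    set {poly F} :=
  [set f | monics n f /\ (forall i : 'I_n, i \in I -> f`_i = alpha i)].

(* Needed for cardinalities to be meaningful: [fset_set] returns the empty set
   on infinite sets. *)
Lemma finite_monics (n : nat) : finite_set (monics n).
Proof.
pose g (c : {ffun 'I_n.+1 -> F}) : {poly F} := \poly_(i < n.+1) c (inord i).
apply: (@sub_finite_set _ _ (g @` setT)); last first.
  exact/finite_image/finite_finset.
move=> f [_ szf]; exists [ffun i : 'I_n.+1 => f`_i] => //.
apply/polyP=> i; rewrite coef_poly; case: ltnP => [lt_in | le_ni].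
  by rewrite ffunE inordK.
by rewrite nth_default ?szf.
Qed.

Lemma finite_smooths (n m : nat) : finite_set (smooths n m).
Proof. by apply: sub_finite_set (finite_monics n) => f []. Qed.

Lemma finite_smooths_prescribed (n m : nat) (I : {set 'I_n})
    (alpha : 'I_n -> F) : finite_set (smooths n m `&` prescribed I alpha).
Proof. by apply: finite_setIl; apply: finite_smooths. Qed.

Definition Psi (n m : nat) : nat := #|` fset_set (smooths n m)|.

End SmoothPolynomials.

Arguments monics F n : clear implicits.
Arguments smooths F n m : clear implicits.
Arguments Psi F n m : clear implicits.

(* Main.v *)
(** Idea.  Since [n] is fixed, it suffices to compare the two sides up to a factor
    [1 + O(q^(-1/2))].  Up to a negligible set, the indicator of smooth polynomials
    is a combination of convolutions counting factorisations into irreducibles of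
    prescribed degrees; each of them factors as [f = f1 f2], with bounded weights,
    where the degree of [f1] can be chosen up to an error [2m].

    Expand the condition [f \in J] in additive characters [psi (<c, f>)], where [c]
    is a vector supported on [I], and let [K] be about [n / 12].
    - If the first [K] rows of the Hankel matrix [(c_(i+j))] are independent, the
      bilinear (Cauchy-Schwarz) bound saves [q^(K/2)], which beats the number
      [q^#|I|] of all [c] because [2 #|I| < K].
    - Otherwise the middle part of [c] satisfies a linear recurrence of some minimal
      order [s < K].  For [s > 0], fix the bottom and top coefficients of [f1] and [f2]
      and use the bilinear bound in the middle ones: this saves [q^(s/2)].
      A recurrent sequence is determined by a window of length [2s], and since [I]
      is sparse some window meets [I] in fewer than [s/2] places, so there are fewer
      than [q^(s/2)] such middle parts.
    - For [s = 0], [c] lives on the bottom and top coefficients, where one needs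
      equidistribution of smooth polynomials modulo a power of [t] and at infinity.
      No Weil bound is needed: smooth polynomials are invariant under the translations
      [t -> t + b], which move the place [0] to [q] independent places, so Cauchy-Schwarz
      gains a factor [q^(1/2)].  The top coefficients follow by reversal. *)

Require Import Defs.
From HB Require Import structures.
From mathcomp Require Import all_boot all_order all_algebra.
From mathcomp Require Import all_fingroup all_field all_character zify ring.
From mathcomp Require Import finmap.
From mathcomp Require Import boolp classical_sets functions cardinality.
From mathcomp Require Import reals topology normedtype sequences exp.

Set Implicit Arguments.
Unset Strict Implicit.
Unset Printing Implicit Defensive.

Import Order.TTheory GRing.Theory Num.Theory.
Import numFieldNormedType.Exports.

Local Open Scope classical_set_scope.
Local Open Scope ring_scope.

(** Every comparison is multiplied by [q ^ #|I|], so a set that is negligible among all monic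
    polynomials need not be negligible inside [J]. This shapes the proof. The edge conditions are
    kept as exact counting conditions inside the bilinear argument, and the error caused by
    non-squarefree polynomials is itself shown to be equidistributed before it is discarded.

    Reversal requires a nonzero constant coefficient.

    Constants: [#|I| < n / 24] makes [K = n %/ 12 + 1] exceed [2 * #|I|]. Item degrees are at most
    [M = 2 * m <= n / 50], and the splittings need [6 * K + 4 * M + 3 <= n], of which [6 * K] uses
    about half.

    The errors are [O(q^(n - 1/2))] in absolute terms; they become relative because products of [n]
    distinct linear factors already give [Psi] of order [q^n]. Character sums live in [algC], edge
    estimates in [int], and the last estimate is squared into [nat], from where it passes to the
    real field. *)

Lemma additive_character_exists (F : finFieldType) :
  {psi : F -> algC | [/\ forall x y, psi (x + y) = psi x * psi y,
    forall x, `|psi x| = 1 & exists x, psi x != 1]}.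
Proof.
apply: cid.
have abF : abelian [set: F]%G by apply: FinRing.zmod_abelian.
(* An abelian group has as many irreducible characters as elements, all of them linear, so some
   index differs from that of the trivial character. *)
have Nirr_gt1 : (1 < Nirr [set: F]%G)%N.
  move: abF; rewrite card_classes_abelian => /eqP; rewrite NirrE => ->.
  by rewrite cardsT; exact: card_finNzRing_gt1.
pose i : Iirr [set: F]%G := Ordinal Nirr_gt1.
have lin_i : 'chi_i \is a linear_char by apply/char_abelianP.
exists (fun x => 'chi_i x); split.
- by move=> x y; rewrite -(lin_charM lin_i) ?inE.
- by move=> x; apply: normC_lin_char; rewrite ?inE.
- apply/not_existsP => chi1.
  suff: i = 0 by [].
  apply: irr_inj; rewrite irr0; apply/cfun_inP => x _.
  by rewrite cfun1E inE; apply/eqP/negPn/negP/chi1.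
Qed.

(** * Sums over duplicate-free sequences *)

Lemma big_reindex_seq (T : eqType) (V : nmodType) (s : seq T) (h : T -> T)
    (G : T -> V) :
  uniq s -> {in s, forall x, h x \in s} -> {in s &, injective h} ->
  \sum_(x <- s) G (h x) = \sum_(x <- s) G x.
Proof.
move=> us hs hi; rewrite -(big_map h xpredT G); apply: perm_big.
have uh : uniq (map h s) by rewrite map_inj_in_uniq.
apply: uniq_perm => //.
have sub : {subset map h s <= s} by move=> _ /mapP[x xs ->]; apply: hs.
by have [] := uniq_min_size uh sub; rewrite ?size_map.
Qed.

Lemma natr_size_filter (T : eqType) (V : pzSemiRingType) (s : seq T) (P : pred T) :
  \sum_(x <- s) (P x)%:R = (size (seq.filter P s))%:R :> V.
Proof.
elim: s => [|x s IH]; first by rewrite big_nil.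
by rewrite big_cons IH /=; case: (P x) => /=; rewrite ?nat1r ?add0r.
Qed.

Lemma sumr_seq_const (T : eqType) (V : pzSemiRingType) (s : seq T) (a : V) :
  \sum_(x <- s) a = (size s)%:R * a.
Proof. by rewrite big_const_seq count_predT iter_addr_0 mulr_natl. Qed.

(** Cauchy-Schwarz against the constant 1, from the nonnegativity of the sum of [(a x - a y) ^+ 2]
    over all pairs. It serves both [algC] and [int]. *)
Lemma sqr_sum_le (T : eqType) (V : numDomainType) (s : seq T) (a : T -> V) :
  (forall x, 0 <= a x) ->
  (\sum_(x <- s) a x) ^+ 2 <= (size s)%:R * \sum_(x <- s) a x ^+ 2.
Proof.
move=> a0.
have : 0 <= \sum_(x <- s) \sum_(y <- s) (a x - a y) ^+ 2.
  apply: sumr_ge0 => x _; apply: sumr_ge0 => y _.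
  by rewrite real_exprn_even_ge0 // rpredB // ger0_real.
rewrite (eq_bigr (fun x => (size s)%:R * a x ^+ 2 +
   (\sum_(y <- s) a y ^+ 2 - (a x * \sum_(y <- s) a y) *+ 2))); last first.
  move=> x _; rewrite mulr_sumr -sumrMnl -sumr_seq_const -!sumrB -big_split /=.
  by apply: eq_bigr => y _; rewrite sqrrB addrAC -addrA.
rewrite big_split /= -mulr_sumr sumrB sumr_seq_const sumrMnl -mulr_suml -expr2.
by rewrite addrA -mulr2n -mulrnBl pmulrn_lge0 // subr_ge0.
Qed.

(** * Additive characters and polynomials of bounded degree *)
Section Polynomials.
Variable F : finFieldType.
Implicit Types (f g p u w z : {poly F}) (d : nat).

(** Finite families of polynomials are duplicate-free sequences, because [{poly F}] is not a finite
    type. The index of [Pol] bounds the size, that of [Mon] is the degree. *)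
Definition Pol d : seq {poly F} := [seq rVpoly x | x : 'rV[F]_d].
Definition Mon d : seq {poly F} := [seq 'X^d + f | f <- Pol d].

Lemma mem_Pol d f : (f \in Pol d) = (size f <= d)%N.
Proof.
apply/idP/idP => [/mapP[x _ ->]|fd]; first exact: size_poly.
by apply/mapP; exists (poly_rV f); rewrite ?mem_enum ?poly_rV_K.
Qed.

Lemma uniq_Pol d : uniq (Pol d).
Proof. by rewrite map_inj_uniq ?enum_uniq //; exact: can_inj (@rVpolyK _ _). Qed.

Lemma size_Pol d : size (Pol d) = (#|F| ^ d)%N.
Proof. by rewrite size_map -cardE card_mx mul1n. Qed.

Lemma mem_Mon d f : (f \in Mon d) = (f \is monic) && (size f == d.+1).
Proof.
apply/mapP/andP => [[g]|[fm /eqP sf]].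
  rewrite mem_Pol => gd ->.
  have sg : (size g < size ('X^d : {poly F}))%N by rewrite size_polyXn.
  by rewrite monicE lead_coefDl // lead_coefXn size_polyDl // size_polyXn.
exists (f - 'X^d); last by rewrite addrC subrK.
rewrite mem_Pol; apply/leq_sizeP => j dj; rewrite coefB coefXn.
move: dj; rewrite leq_eqVlt => /predU1P[<-|dj].
  by rewrite eqxx -[d]/(d.+1.-1) -sf -lead_coefE (monicP fm) subrr.
by rewrite nth_default ?sf // gtn_eqF // subrr.
Qed.

Lemma uniq_Mon d : uniq (Mon d).
Proof. by rewrite map_inj_uniq ?uniq_Pol //; exact: addrI. Qed.

Lemma size_Mon d : size (Mon d) = (#|F| ^ d)%N.
Proof. by rewrite size_map size_Pol. Qed.

Lemma MonM d e f g : f \in Mon d -> g \in Mon e -> f * g \in Mon (d + e).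
Proof.
rewrite !mem_Mon => /andP[fm /eqP sf] /andP[gm /eqP sg].
by rewrite monicMr // fm size_Mmonic ?monic_neq0 // sf sg addnS /= addSn eqxx.
Qed.

Lemma MonX d k f : f \in Mon d -> f ^+ k \in Mon (d * k).
Proof.
move=> fd; elim: k => [|k IH]; first by rewrite muln0 mem_Mon monic1 size_poly1.
by rewrite exprS mulnS; apply: MonM.
Qed.

Lemma MonD d f g : f \in Mon d -> (size g <= d)%N -> f + g \in Mon d.
Proof.
rewrite !mem_Mon => /andP[fm /eqP sf] sg.
have sgf : (size g < size f)%N by rewrite sf.
by rewrite monicE lead_coefDl // size_polyDl // sf eqxx andbT.
Qed.

Lemma sum_Pol_shift (V : nmodType) d (y : {poly F}) (G : {poly F} -> V) : (size y <= d)%N ->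
  \sum_(x <- Pol d) G (x + y) = \sum_(x <- Pol d) G x.
Proof.
move=> yd; apply: big_reindex_seq => [|x|x x' _ _]; first exact: uniq_Pol.
  by rewrite !mem_Pol => xd; rewrite (leq_trans (size_polyD _ _)) // geq_max xd.
exact: addIr.
Qed.

Lemma sum_Mon_shift (V : nmodType) d (y : {poly F}) (G : {poly F} -> V) : (size y <= d)%N ->
  \sum_(x <- Mon d) G (x + y) = \sum_(x <- Mon d) G x.
Proof.
move=> yd; apply: big_reindex_seq => [|x|x x' _ _]; first exact: uniq_Mon.
  by move=> xd; apply: MonD.
exact: addIr.
Qed.

(** Each shift by [Y z] permutes [Mon d]. Averaging over [z] replaces a sum over all of [Mon d] by
    sums over families [x + Y z] chosen to suit the summand. *)
Lemma sum_Mon_avg (V : nmodType) d L (Y : {poly F} -> {poly F}) (G : {poly F} -> V) :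
  (forall z, z \in Pol L -> (size (Y z) <= d)%N) ->
  \sum_(x <- Mon d) \sum_(z <- Pol L) G (x + Y z) =
  (\sum_(x <- Mon d) G x) *+ (#|F| ^ L).
Proof.
move=> HY; rewrite exchange_big /=.
rewrite (eq_big_seq (fun _ => \sum_(x <- Mon d) G x)).
  by rewrite big_const_seq count_predT iter_addr_0 size_Pol.
by move=> z zL; rewrite sum_Mon_shift // HY.
Qed.

Definition psi : F -> algC := sval (additive_character_exists F).

Lemma psiD x y : psi (x + y) = psi x * psi y.
Proof. by rewrite /psi; case: (additive_character_exists F) => p []. Qed.

Lemma norm_psi x : `|psi x| = 1.
Proof. by rewrite /psi; case: (additive_character_exists F) => p []. Qed.

Lemma psi_neq1 : exists x, psi x != 1.
Proof. by rewrite /psi; case: (additive_character_exists F) => p []. Qed.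

Lemma psi0 : psi 0 = 1.
Proof.
have /(congr1 (fun t : algC => t / psi 0)) := psiD 0 0.
have p0 : psi 0 != 0 by rewrite -normr_eq0 norm_psi oner_eq0.
by rewrite addr0 mulfK // divff.
Qed.

Lemma psiN x : psi (- x) = (psi x)^*.
Proof.
have p0 : psi x != 0 by rewrite -normr_eq0 norm_psi oner_eq0.
apply: (mulfI p0); rewrite -psiD subrr psi0.
by rewrite -normCK norm_psi expr1n.
Qed.

Lemma psi_scale_neq1 (a : F) : a != 0 -> exists t : F, psi (t * a) != 1.
Proof. by have [x px] := psi_neq1; exists (x / a); rewrite mulfVK. Qed.

(** Orthogonality: if [phi] is nonzero at [z0], a multiple [t *: z0] has [psi (phi _) != 1], and the
    shift by it multiplies the sum by that value. *)
Lemma sum_psi_Pol d (phi : {poly F} -> F) :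
  (forall x y, phi (x + y) = phi x + phi y) ->
  (forall t x, phi (t *: x) = t * phi x) ->
  \sum_(z <- Pol d) psi (phi z) =
  (all (fun z => phi z == 0) (Pol d))%:R * (#|F| ^ d)%:R.
Proof.
move=> phiD phiZ; case: (boolP (all _ _)) => [/allP all0|].
  rewrite (eq_big_seq (fun=> 1)) => [|z zd]; last by rewrite (eqP (all0 z zd)) psi0.
  by rewrite sumr_seq_const size_Pol mulr1 mul1r.
case/allPn=> z0 z0d /psi_scale_neq1[t pt]; rewrite mul0r.
have tz : (size (t *: z0) <= d)%N.
  by rewrite (leq_trans (size_scale_leq _ _)) // -mem_Pol.
have := sum_Pol_shift (fun z => psi (phi z)) tz.
rewrite (eq_bigr (fun z => psi (phi z) * psi (t * phi z0))); last first.
  by move=> z _; rewrite phiD phiZ psiD.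
rewrite -mulr_suml => /eqP; rewrite -subr_eq0 -{2}[\sum_(_ <- _) _]mulr1 -mulrBr.
by rewrite mulf_eq0 subr_eq0 (negbTE pt) orbF => /eqP.
Qed.

Section Coefficients.
Variable N : nat.
Implicit Types (c : {ffun 'I_N -> F}) (I : {set 'I_N}).

Definition pairing c f : F := \sum_(i < N) c i * f`_i.
Definition supp_in I := [pred c : {ffun 'I_N -> F} | [forall i, (i \notin I) ==> (c i == 0)]].

Lemma supp_inP I c : reflect (forall i, i \notin I -> c i = 0) (supp_in I c).
Proof.
apply: (iffP forallP) => H i; first by move=> iI; apply/eqP/(implyP (H i)).
by apply/implyP => iI; rewrite H.
Qed.

Lemma pairingD c f g : pairing c (f + g) = pairing c f + pairing c g.
Proof. by rewrite -big_split; apply: eq_bigr => i _; rewrite coefD mulrDr. Qed.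

Lemma pairingZ c t f : pairing c (t *: f) = t * pairing c f.
Proof.
by rewrite mulr_sumr; apply: eq_bigr => i _; rewrite coefZ mulrCA.
Qed.

Lemma pairing_sum c (T : Type) (s : seq T) (G : T -> {poly F}) :
  pairing c (\sum_(x <- s) G x) = \sum_(x <- s) pairing c (G x).
Proof.
elim: s => [|x s IH]; last by rewrite !big_cons pairingD IH.
by rewrite !big_nil /pairing big1 // => i _; rewrite coef0 mulr0.
Qed.

Lemma pairingDl c c' f : pairing (c + c') f = pairing c f + pairing c' f.
Proof. by rewrite -big_split; apply: eq_bigr => i _; rewrite !ffunE mulrDl. Qed.

Lemma pairingNl c f : pairing (- c) f = - pairing c f.
Proof. by rewrite -sumrN; apply: eq_bigr => i _; rewrite !ffunE mulNr. Qed.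

Lemma card_supp_in I : #|supp_in I| = (#|F| ^ #|I|)%N.
Proof.
rewrite -[#|F|]cardsT -(card_pffun_on 0 I [set: F]%SET); apply: eq_card => c.
apply/supp_inP/pffun_onP => [H|[H _] i iI]; last first.
  by apply/eqP; rewrite -[_ == 0]negbK; apply: contra iI; apply: (fintype.subsetP H).
split; last by move=> x _; rewrite inE.
apply/fintype.subsetP => i; rewrite unfold_in; apply: contraR => iI.
by rewrite H.
Qed.

(** Fourier inversion on the prescribed coordinates; it turns the conditions on coefficients into
    character sums. *)
Lemma sum_psi_supp_in I (x : 'I_N -> F) :
  \sum_(c | supp_in I c) psi (\sum_i c i * x i) =
  [forall (i | i \in I), x i == 0]%:R * (#|F| ^ #|I|)%:R.
Proof.
case: (boolP [forall (i | i \in I), x i == 0]) => [/forall_inP H|].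
  rewrite (eq_bigr (fun=> 1)); last first.
    move=> c /supp_inP cI; rewrite big1 ?psi0 // => i _.
    have [iI|iI] := boolP (i \in I); first by rewrite (eqP (H _ iI)) mulr0.
    by rewrite cI // mul0r.
  by rewrite sumr_const card_supp_in mul1r.
rewrite negb_forall => /existsP[i]; rewrite negb_imply => /andP[iI xi].
have [t pt] := psi_scale_neq1 xi; rewrite mul0r.
pose c0 : {ffun 'I_N -> F} := [ffun j => if j == i then t else 0].
have dc0 c : supp_in I (c + c0) = supp_in I c.
  apply/supp_inP/supp_inP => H j jI; have := H j jI; rewrite !ffunE;
  by case: eqP => [ji|_]; rewrite ?addr0 //; rewrite ji iI in jI.
set S := \sum_(c | _) _.
have: S = S * psi (t * x i).
  rewrite {1}/S (reindex_inj (addIr c0)) /= (eq_bigl _ _ dc0) mulr_suml.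
  apply: eq_bigr => c _; rewrite -psiD; congr psi.
  rewrite (eq_bigr (fun j => c j * x j + (if j == i then t * x i else 0))).
    by rewrite big_split /= -big_mkcond big_pred1_eq.
  by move=> j _; rewrite !ffunE mulrDl; case: eqP => [->|_] //; rewrite mul0r.
move/eqP; rewrite -subr_eq0 -{1}[S]mulr1 -mulrBr mulf_eq0 subr_eq0 [1 == _]eq_sym.
by rewrite (negbTE pt) orbF => /eqP.
Qed.

(** Linear forms that are independent on [Pol d] take every tuple of values equally often: after
    Fourier expansion only [c = 0] survives. *)
Lemma count_independent I d (phi : 'I_N -> {poly F} -> F) (a : 'I_N -> F) :
  (forall i x y, phi i (x + y) = phi i x + phi i y) ->
  (forall i t x, phi i (t *: x) = t * phi i x) ->
  (forall c, supp_in I c -> c != 0 ->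
     exists2 z : {poly F}, (size z <= d)%N & \sum_i c i * phi i z != 0) ->
  (#|F| ^ #|I| * size [seq z <- Pol d | [forall (i | i \in I), phi i z == a i]] =
   #|F| ^ d)%N.
Proof.
move=> phiD phiZ indep; apply/eqP; rewrite -(eqr_nat algC); apply/eqP.
rewrite natrM -natr_size_filter mulrC mulr_suml.
rewrite (eq_bigr (fun z => \sum_(c | supp_in I c)
  psi (\sum_i c i * phi i z) * psi (- \sum_i c i * a i))); last first.
  move=> z _; have := sum_psi_supp_in I (fun i => phi i z - a i).
  have -> : [forall (i | i \in I), phi i z - a i == 0] =
     [forall (i | i \in I), phi i z == a i].
    by apply: eq_forallb => i; rewrite subr_eq0.
  move=> <-; apply: eq_bigr => c _; rewrite -psiD; congr psi.
  by rewrite -sumrB; apply: eq_bigr => i _; rewrite mulrBr.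
rewrite exchange_big /= (bigD1 (0 : {ffun 'I_N -> F})) /=; last first.
  by apply/supp_inP => i _; rewrite ffunE.
rewrite [X in X + _](eq_bigr (fun=> 1)); last first.
  move=> z _; rewrite !big1 ?oppr0 ?psi0 ?mul1r // => i _; by rewrite ffunE mul0r.
rewrite sumr_seq_const size_Pol mulr1 big1 ?addr0 // => c /andP[cI cn0].
rewrite -mulr_suml sum_psi_Pol.
- have [z zd zn0] := indep c cI cn0.
  suff /negbTE-> : ~~ all (fun z => \sum_i c i * phi i z == 0) (Pol d) by rewrite !mul0r.
  by apply/allPn; exists z; rewrite ?mem_Pol.
- move=> x y; rewrite -big_split; apply: eq_bigr => i _.
  by rewrite phiD mulrDr.
- by move=> t x; rewrite mulr_sumr; apply: eq_bigr => i _; rewrite phiZ mulrCA.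
Qed.

End Coefficients.

(** Dropping the [s] lowest coefficients is injective on [P], since a difference lost by it would be
    a nonzero element of [P] of size at most [s]. *)
Lemma card_kernel_le (d s : nat) (P : pred {poly F}) : (s <= d)%N ->
  (forall x y, P x -> P y -> P (x - y)) ->
  (forall u, u != 0 -> (size u <= s)%N -> ~~ P u) ->
  (size (seq.filter P (Pol d)) <= #|F| ^ (d - s))%N.
Proof.
move=> sd PB Ps.
have := @uniq_leq_size _ (map (drop_poly s) (seq.filter P (Pol d))) (Pol (d - s)).
rewrite size_map size_Pol; apply.
  rewrite map_inj_in_uniq ?filter_uniq ?uniq_Pol // => x y.
  rewrite !mem_filter => /andP[Px _] /andP[Py _] exy.
  apply/eqP; rewrite -subr_eq0; apply/negPn/negP => xy.
  suff sxy : (size (x - y)%R <= s)%N by move: (Ps _ xy sxy); rewrite PB.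
  have -> : x - y = take_poly s (x - y).
    by rewrite -{1}(poly_take_drop s (x - y)) [drop_poly _ _]linearB /= exy subrr mul0r addr0.
  exact: size_take_poly.
move=> w /mapP[x]; rewrite mem_filter !mem_Pol => /andP[_ xd] ->.
by rewrite size_drop_poly leq_sub2r.
Qed.

(** Cauchy-Schwarz in [x] removes [u]. In the expanded square the sum over [x] is 0 or [q ^ d1],
    hence nonnegative, so [v] can be bounded pointwise; what remains counts the left kernel of
    [beta]. Nondegeneracy on polynomials of size at most [s] is enough to save [q ^ s] in the
    square. *)
Lemma bilinear_bound (d1 d2 s : nat) (u v : {poly F} -> algC)
    (beta : {poly F} -> {poly F} -> F) (B1 B2 : algC) :
  (s <= d1)%N -> 0 <= B1 -> 0 <= B2 ->
  (forall x, `|u x| <= B1) -> (forall y, `|v y| <= B2) ->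
  (forall x x' y, beta (x + x') y = beta x y + beta x' y) ->
  (forall x y y', beta x (y + y') = beta x y + beta x y') ->
  (forall t x y, beta (t *: x) y = t * beta x y) ->
  (forall t x y, beta x (t *: y) = t * beta x y) ->
  (forall w, w != 0 -> (size w <= s)%N ->
     exists2 y : {poly F}, (size y <= d2)%N & beta w y != 0) ->
  `|\sum_(x <- Pol d1) \sum_(y <- Pol d2) u x * v y * psi (beta x y)| ^+ 2
   <= (B1 * B2) ^+ 2 * (#|F| ^ (2 * d1 + 2 * d2 - s))%:R.
Proof.
move=> sd1 B10 B20 uB vB betaDl betaDr betaZl betaZr nondeg.
pose V x := \sum_(y <- Pol d2) v y * psi (beta x y).
have betaN x y : beta x (- y) = - beta x y by rewrite -scaleN1r betaZr mulN1r.
have betaNl x y : beta (- x) y = - beta x y by rewrite -scaleN1r betaZl mulN1r.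
have step1 : `|\sum_(x <- Pol d1) \sum_(y <- Pol d2) u x * v y * psi (beta x y)| ^+ 2
    <= B1 ^+ 2 * ((#|F| ^ d1)%:R * \sum_(x <- Pol d1) `|V x| ^+ 2).
  rewrite -(size_Pol d1).
  apply: (@le_trans _ _ (B1 ^+ 2 * (\sum_(x <- Pol d1) `|V x|) ^+ 2)); last first.
    by apply: ler_wpM2l; [exact: exprn_ge0 | apply: sqr_sum_le => x].
  rewrite -exprMn ler_pXn2r ?nnegrE ?normr_ge0 ?mulr_ge0 ?sumr_ge0 //.
  rewrite mulr_sumr; apply: (le_trans (ler_norm_sum _ _ _)); apply: ler_sum => x _.
  rewrite (eq_bigr (fun y => u x * (v y * psi (beta x y)))); last first.
    by move=> y _; rewrite mulrA.
  by rewrite -mulr_sumr normrM ler_wpM2r.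
have step2 : \sum_(x <- Pol d1) `|V x| ^+ 2 <= B2 ^+ 2 *
    ((#|F| ^ d2)%:R * \sum_(x <- Pol d1) \sum_(y <- Pol d2) psi (beta x y)).
  rewrite (eq_bigr (fun x => \sum_(y <- Pol d2) \sum_(y' <- Pol d2)
     (v y * (v y')^* ) * psi (beta x (y - y')))); last first.
    move=> x _; rewrite normCK /V rmorph_sum /= mulr_suml; apply: eq_bigr => y _.
    rewrite mulr_sumr; apply: eq_bigr => y' _.
    by rewrite rmorphM /= -psiN mulrACA -psiD betaDr betaN.
  rewrite exchange_big /= (eq_bigr (fun y => \sum_(y' <- Pol d2) (v y * (v y')^* ) *
     \sum_(x <- Pol d1) psi (beta x (y - y')))); last first.
    move=> y _; rewrite exchange_big /=; apply: eq_bigr => y' _.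
    by rewrite mulr_sumr.
  rewrite [X in _ <= _ * (_ * X)]exchange_big /=.
  rewrite -(size_Pol d2) -sumr_seq_const mulr_sumr.
  rewrite exchange_big /=.
  have S0 y : 0 <= \sum_(x <- Pol d1) psi (beta x y).
    by rewrite sum_psi_Pol // mulr_ge0 // ler0n.
  (* The order of [algC] is partial, so the triangle inequality needs the double sum under a norm.
     Introducing it is harmless: the double sum is again the sum of the [|V x| ^+ 2]. *)
  rewrite -[X in X <= _]ger0_norm; last first.
    have -> : \sum_(j <- Pol d2) \sum_(i <- Pol d2)
      v i * (v j)^* * \sum_(x <- Pol d1) psi (beta x (i - j)) =
      \sum_(x <- Pol d1) `|V x| ^+ 2; last by apply: sumr_ge0 => x _; exact: exprn_ge0.
    rewrite exchange_big /=; under eq_bigr => y _ do under eq_bigr => y' _ do rewrite mulr_sumr.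
    under eq_bigr => y _ do rewrite exchange_big /=.
    rewrite exchange_big /=; apply: eq_bigr => x _.
    rewrite normCK /V rmorph_sum /= mulr_suml; apply: eq_bigr => y _.
    rewrite mulr_sumr; apply: eq_bigr => y' _.
    by rewrite rmorphM /= -psiN mulrACA -psiD betaDr betaN.
  apply: (le_trans (ler_norm_sum _ _ _)); rewrite big_seq [X in _ <= X]big_seq.
  apply: ler_sum => y' y'd.
  rewrite -(@sum_Pol_shift _ d2 y') -?mem_Pol // mulr_sumr.
  apply: (le_trans (ler_norm_sum _ _ _)); apply: ler_sum => y _.
  rewrite addrK normrM (ger0_norm (S0 _)) ler_wpM2r // normrM norm_conjC expr2.
  by apply: ler_pM.
pose ker x := all (fun y => beta x y == 0) (Pol d2).
have step3 : \sum_(x <- Pol d1) \sum_(y <- Pol d2) psi (beta x y) <=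
    (#|F| ^ (d1 - s))%:R * (#|F| ^ d2)%:R :> algC.
  rewrite (eq_bigr (fun x => (ker x)%:R * (#|F| ^ d2)%:R)); last first.
    by move=> x _; rewrite sum_psi_Pol.
  rewrite -mulr_suml natr_size_filter ler_wpM2r ?ler0n // ler_nat.
  apply: card_kernel_le => //.
    move=> x y /allP kx /allP ky; apply/allP => z zd.
    by rewrite betaDl betaNl (eqP (kx z zd)) (eqP (ky z zd)) subrr.
  move=> w w0 ws; have [y yd yn0] := nondeg w w0 ws.
  by apply/allPn; exists y; rewrite ?mem_Pol.
apply: (le_trans step1); rewrite exprMn -[X in _ <= X]mulrA.
apply: ler_wpM2l; first exact: exprn_ge0.
apply: (@le_trans _ _ ((#|F| ^ d1)%:R * (B2 ^+ 2 * ((#|F| ^ d2)%:R *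
   ((#|F| ^ (d1 - s))%:R * (#|F| ^ d2)%:R))))).
  apply: ler_wpM2l; first exact: ler0n.
  apply: (le_trans step2); apply: ler_wpM2l; first exact: exprn_ge0.
  by apply: ler_wpM2l; first exact: ler0n.
rewrite mulrCA -!natrM -!expnD.
have -> : (d1 + (d2 + (d1 - s + d2)) = 2 * d1 + 2 * d2 - s)%N by lia.
exact: lexx.
Qed.
End Polynomials.

Arguments Pol {F} d.
Arguments Mon {F} d.
Arguments supp_in {F N} I.

(** * Weights counting factorisations *)
Section Factorizations.
Variable F : finFieldType.
Implicit Types (f g h p : {poly F}) (d e : nat) (its : seq (nat * nat)).

(** Irreducibility in terms of monic factorisations only, so that it is transported by maps that are
    multiplicative merely on monic polynomials, such as [reversal]. *)
Definition irr p : bool :=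
  [&& p \is monic, (1 < size p)%N &
   `[< forall g h, g \is monic -> h \is monic -> p = g * h -> g = 1 \/ h = 1 >]].

Lemma irr_monic p : irr p -> p \is monic.
Proof. by case/and3P. Qed.

Lemma irr_size p : irr p -> (1 < size p)%N.
Proof. by case/and3P. Qed.

Lemma monic_size1 p : p \is monic -> size p = 1%N -> p = 1.
Proof.
by move=> pm /eqP/size_poly1P[c c0 pc]; move: pm; rewrite pc monicE lead_coefC => /eqP->.
Qed.

Lemma irrP p : reflect (p \is monic /\ irreducible_poly p) (irr p).
Proof.
apply: (iffP and3P) => [[pm sp /asboolP H]|[pm [sp H]]].
  split=> //; split=> // q sq qp.
  have q0 : q != 0 by apply: contraTneq qp => ->; rewrite dvd0p monic_neq0.
  have lq : lead_coef q != 0 by rewrite lead_coef_eq0.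
  pose q' := (lead_coef q)^-1 *: q.
  have q'm : q' \is monic by rewrite monicE lead_coefZ mulVf.
  have qq' : q' %= q by rewrite eqp_scale // invr_eq0.
  have q'p : q' %| p by rewrite (eqp_dvdl _ qq').
  have Ep : p = p %/ q' * q' by rewrite divpK.
  have hm : p %/ q' \is monic.
    by move: pm; rewrite !monicE {1}Ep lead_coefM (monicP q'm) mulr1.
  case: (H _ _ hm q'm Ep) => E.
    by rewrite Ep E mul1r eqp_sym.
  by case/eqP: sq; rewrite -(eqp_size qq') E size_poly1.
split=> //; apply/asboolP => g h gm hm E.
have [sg|sg] := eqVneq (size g) 1%N; first by left; apply: monic_size1.
right; apply: monic_size1 => //.
have gp : g %| p by rewrite E dvdp_mulr.
have /eqp_size := H g sg gp; rewrite E size_Mmonic ?monic_neq0 //.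
have : (0 < size g)%N by rewrite size_poly_gt0 monic_neq0.
have : (0 < size h)%N by rewrite size_poly_gt0 monic_neq0.
by case: (size h) => // k _; case: (size g) => // l _; rewrite addSn /= => ?; lia.
Qed.

Lemma irr_coprime p g : irr p -> ~~ (p %| g) -> coprimep p g.
Proof.
case/irrP => pm [sp H] png; rewrite coprimep_def.
apply/negPn/negP => sg; case/negP: png.
by rewrite -(eqp_dvdl _ (H _ sg (dvdp_gcdl _ _))) dvdp_gcdr.
Qed.

Lemma irr_dvd_irr p g : irr p -> irr g -> p %| g -> p = g.
Proof.
move=> pi gi pg; have /irrP[gm [_ H]] := gi.
apply/eqP; rewrite -eqp_monic ?irr_monic //; apply: H => //.
by rewrite gtn_eqF // irr_size.
Qed.

Lemma prod_irr_dvd (s : seq {poly F}) f : uniq s ->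
  {in s, forall p, irr p && (p %| f)} -> \prod_(p <- s) p %| f.
Proof.
elim: s => [|p s IH] /=; first by rewrite big_nil dvd1p.
case/andP=> ps us H; have /andP[pi pf] := H p (mem_head _ _).
have sf q : q \in s -> irr q && (q %| f).
  by move=> qs; apply: H; rewrite inE qs orbT.
rewrite big_cons mulrC Gauss_dvdp ?IH //.
rewrite coprimep_sym big_seq; apply: (big_ind (fun g => coprimep p g)).
- exact: coprimep1.
- by move=> g h pg ph; rewrite coprimepMr pg.
- move=> q qs; apply: irr_coprime => //; apply: contra ps => pq.
  by have /andP[qi _] := sf q qs; rewrite (irr_dvd_irr pi qi pq).
Qed.

(** Distinct monic irreducible divisors are pairwise coprime, so their product divides [f], and each
    of them has positive degree. *)
Lemma size_irr_divisors (s : seq {poly F}) f : f != 0 -> uniq s ->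
  {in s, forall p, irr p && (p %| f)} -> (size s < size f)%N.
Proof.
move=> f0 us H; have := dvdp_leq f0 (prod_irr_dvd us H).
apply: leq_trans; have {us} : {in s, forall p, irr p} by move=> p /H/andP[].
clear; elim: s => [|p s IH] H; first by rewrite big_nil size_poly1.
have pi := H p (mem_head _ _).
have Hs : {in s, forall p, irr p} by move=> q qs; apply: H; rewrite inE qs orbT.
rewrite big_cons size_Mmonic; first 1 last.
- exact/monic_neq0/irr_monic.
- by rewrite big_seq; apply: rpred_prod => q /Hs/irr_monic.
have := IH Hs; have := irr_size pi; rewrite /=.
by move: (size _) (size _) (size s) => a b c; lia.
Qed.

(* An item [(d, e)] stands for a factor [P ^+ e] with [P] monic irreducible of degree [d]. *)
Definition total_deg its := sumn [seq x.1 * x.2 | x <- its]%N.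

(** The sum runs over ordered tuples of monic irreducibles, one for each item, with repetitions
    allowed; [weight its f] is the number of tuples whose product of powers is [f]. *)
Fixpoint sum_factored (V : nmodType) its (G : {poly F} -> V) : V :=
  match its with
  | [::] => G 1
  | de :: its' => \sum_(p <- Mon de.1 | irr p) sum_factored its' (fun g => G (p ^+ de.2 * g))
  end.

Definition weight its f : nat := sum_factored its (fun g => nat_of_bool (g == f)).

Lemma sum_factored_ext (V : nmodType) its (G G' : {poly F} -> V) :
  {in Mon (total_deg its), G =1 G'} -> sum_factored its G = sum_factored its G'.
Proof.
elim: its G G' => [|[d e] its IH] G G' H /=.
  by apply: H; rewrite mem_Mon monic1 size_poly1.
rewrite big_seq_cond [RHS]big_seq_cond; apply: eq_bigr => p /andP[pd _].
by apply: IH => g gd; apply: H; apply: MonM => //; apply: MonX.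
Qed.

Lemma sum_factored0 (V : nmodType) its : sum_factored its (fun _ => 0 : V) = 0.
Proof. by elim: its => [|[d e] its IH] //=; rewrite big1. Qed.

Lemma sum_factored_sum (V : nmodType) (T : Type) (s : seq T) its (G : T -> {poly F} -> V) :
  sum_factored its (fun f => \sum_(x <- s) G x f) = \sum_(x <- s) sum_factored its (G x).
Proof.
elim: its G => [|[d e] its IH] G //=.
by rewrite exchange_big; apply: eq_bigr => p _; rewrite IH.
Qed.

Lemma sum_factored_mulrn (V : nmodType) its (a : V) (c : {poly F} -> nat) :
  sum_factored its (fun f => a *+ c f) = a *+ sum_factored its c.
Proof.
elim: its c => [|[d e] its IH] c //=.
by rewrite -sumrMnr; apply: eq_bigr => p _; rewrite IH.
Qed.

Lemma sum_factored_cat (V : nmodType) its its' (G : {poly F} -> V) :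
  sum_factored (its ++ its') G = sum_factored its (fun f => sum_factored its' (fun g => G (f * g))).
Proof.
elim: its G => [|[d e] its IH] G /=.
  by apply: sum_factored_ext => g _; rewrite mul1r.
apply: eq_bigr => p _; rewrite IH; apply: sum_factored_ext => g _.
by apply: sum_factored_ext => h _; rewrite mulrA.
Qed.

Lemma sum_eq_seq (V : nmodType) (T : eqType) (s : seq T) (a : T) (G : T -> V) :
  uniq s -> a \in s -> \sum_(x <- s) G x *+ (a == x) = G a.
Proof.
move=> us a_s; rewrite (bigD1_seq a) //= eqxx big1 ?addr0 // => x xa.
by rewrite eq_sym (negbTE xa).
Qed.

Lemma sum_factoredE (V : nmodType) its (G : {poly F} -> V) :
  sum_factored its G = \sum_(f <- Mon (total_deg its)) G f *+ weight its f.
Proof.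
rewrite (@sum_factored_ext _ _ _ (fun g => \sum_(f <- Mon (total_deg its)) G f *+ (g == f))).
  by rewrite sum_factored_sum; apply: eq_bigr => f _; rewrite sum_factored_mulrn.
by move=> g gd; rewrite sum_eq_seq ?uniq_Mon.
Qed.

Lemma total_deg_cat its its' : total_deg (its ++ its') = (total_deg its + total_deg its')%N.
Proof. by rewrite /total_deg map_cat sumn_cat. Qed.

(** Concatenating lists of items convolves the weights; this is the source of all bilinear
    structure. *)
Lemma sum_weight_cat (V : nmodType) its its' (G : {poly F} -> V) :
  \sum_(f <- Mon (total_deg its + total_deg its')) G f *+ weight (its ++ its') f =
  \sum_(f <- Mon (total_deg its)) \sum_(g <- Mon (total_deg its'))
     G (f * g) *+ (weight its f * weight its' g).
Proof.
rewrite -total_deg_cat -sum_factoredE sum_factored_cat sum_factoredE; apply: eq_bigr => f _.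
by rewrite sum_factoredE -sumrMnl; apply: eq_bigr => g _; rewrite mulrnA mulrnAC.
Qed.

Lemma weight_notin its f : f \notin Mon (total_deg its) -> weight its f = 0%N.
Proof.
move=> fd; rewrite /weight (@sum_factored_ext _ _ _ (fun=> 0%N)) ?sum_factored0 // => g gd.
by case: eqP => // gf; rewrite -gf gd in fd.
Qed.

Lemma weight_cons d e its f :
  weight ((d, e) :: its) f =
  (\sum_(p <- Mon d | irr p && (p ^+ e %| f)%R) weight its (f %/ p ^+ e)%R)%N.
Proof.
rewrite /weight /= [RHS]big_mkcondr /=; apply: eq_bigr => p pi.
have p0 : p ^+ e != 0 by rewrite expf_neq0 // monic_neq0 // irr_monic.
case: ifP => [pf|pf]; apply: etrans.
- apply: sum_factored_ext => g _; rewrite -{1}(divpK pf) mulrC.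
  by rewrite (inj_eq (mulIf p0)).
- by [].
- apply: (@sum_factored_ext _ _ _ (fun=> 0%N)) => g _.
  by case: eqP => // E; rewrite -E dvdp_mulr in pf.
- exact: sum_factored0.
Qed.

Lemma irr_divisors_card d f n : f \in Mon n ->
  (size [seq p <- Mon d | irr p && (p %| f)%R] <= n)%N.
Proof.
rewrite mem_Mon => /andP[fm /eqP sf].
rewrite -ltnS -sf; apply: size_irr_divisors; first exact: monic_neq0.
  exact/filter_uniq/uniq_Mon.
by move=> p; rewrite mem_filter => /andP[].
Qed.

Lemma Mon_div n k g f : f \in Mon n -> g \in Mon k -> g %| f ->
  f %/ g \in Mon (n - k).
Proof.
rewrite !mem_Mon => /andP[fm /eqP sf] /andP[gm /eqP sg] gf.
have g0 := monic_neq0 gm; rewrite size_divp // sf sg /=.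
have kn : (k <= n)%N by have := dvdp_leq (monic_neq0 fm) gf; rewrite sf sg ltnS.
rewrite subSn // eqxx andbT.
by move: fm; rewrite !monicE -{1}(divpK gf) lead_coefM (monicP gm) mulr1.
Qed.

(** Each item must choose one of at most [n] irreducible divisors. The bound does not depend on the
    field. *)
Lemma weight_le its f n k : all (fun x => 0 < x.2)%N its -> f \in Mon k -> (k <= n)%N ->
  (weight its f <= n ^ size its)%N.
Proof.
elim: its f k => [|[d e] its IH] f k /=.
  by move=> _ _ _; rewrite expn0 /weight /=; case: eqP.
case/andP => /= e0 its0 fk kn; rewrite weight_cons expnS.
apply: (@leq_trans (\sum_(p <- Mon d | irr p && (p %| f)%R) n ^ size its)%N).
  apply: (@leq_trans (\sum_(p <- Mon d | irr p && (p ^+ e %| f)%R) n ^ size its)%N).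
    rewrite big_seq_cond [X in (_ <= X)%N]big_seq_cond; apply: leq_sum => p /and3P[pd pi pf].
    apply: (IH _ (k - d * e)%N) => //; first exact: (Mon_div fk (MonX e pd) pf).
    by rewrite (leq_trans (leq_subr _ _)).
  rewrite big_mkcond [X in (_ <= X)%N]big_mkcond; apply: leq_sum => p _.
  case: ifP => // /andP[pi pf]; rewrite pi /= (dvdp_trans _ pf) //.
  by rewrite -{1}(expr1 p) dvdp_exp2l.
rewrite -big_filter big_const_seq count_predT iter_addn_0 mulnC leq_mul2r.
by rewrite (leq_trans (irr_divisors_card _ fk)) ?orbT.
Qed.

(* Translations and, on polynomials not vanishing at 0, reversal permute the monic
   irreducible polynomials of each degree; hence they preserve the weights. *)
Section Symmetry.
Variables (D : pred {poly F}) (sg sg' : {poly F} -> {poly F}).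
Hypothesis DM : forall f g, f \is monic -> g \is monic -> D (f * g) = D f && D g.
Hypothesis D1 : D 1.
Hypothesis sg1 : sg 1 = 1.
Hypothesis sgM : forall f g, f \is monic -> g \is monic -> D f -> D g ->
  sg (f * g) = sg f * sg g.
Hypothesis sg'M : forall f g, f \is monic -> g \is monic -> D f -> D g ->
  sg' (f * g) = sg' f * sg' g.
Hypothesis sgK : forall f, f \is monic -> D f -> sg' (sg f) = f.
Hypothesis sg'K : forall f, f \is monic -> D f -> sg (sg' f) = f.
Hypothesis sg_Mon : forall d f, f \in Mon d -> D f -> sg f \in Mon d /\ D (sg f).
Hypothesis sg'_Mon : forall d f, f \in Mon d -> D f -> sg' f \in Mon d /\ D (sg' f).

Lemma monic_Mon f : f \is monic -> f \in Mon (size f).-1.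
Proof. by move=> fm; rewrite mem_Mon fm prednK ?eqxx // size_poly_gt0 monic_neq0. Qed.

Lemma Mon_monic d f : f \in Mon d -> f \is monic.
Proof. by rewrite mem_Mon => /andP[]. Qed.

Lemma sym_irr p : irr p -> D p -> irr (sg p).
Proof.
case/and3P => pm sp /asboolP H Dp; have [sM Dsp] := sg_Mon (monic_Mon pm) Dp.
apply/and3P; split; first exact: Mon_monic sM.
  by move: sM; rewrite mem_Mon => /andP[_ /eqP->]; rewrite prednK // ltnW.
apply/asboolP => g h gm hm E.
have /andP[Dg Dh] : D g && D h by rewrite -DM // -E.
have [g'M Dg'] := sg'_Mon (monic_Mon gm) Dg.
have [h'M Dh'] := sg'_Mon (monic_Mon hm) Dh.
case: (H (sg' g) (sg' h)).
- exact: Mon_monic g'M.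
- exact: Mon_monic h'M.
- by rewrite -sg'M // -E sgK.
- by move=> g1; left; rewrite -(sg'K gm Dg) g1.
- by move=> h1; right; rewrite -(sg'K hm Dh) h1.
Qed.

Lemma symX p e : p \is monic -> D p -> D (p ^+ e) /\ sg (p ^+ e) = sg p ^+ e.
Proof.
move=> pm Dp; elim: e => [|e [De IH]]; first by rewrite !expr0.
by rewrite exprS DM ?monic_exp // Dp De sgM ?monic_exp // IH exprS.
Qed.

(** Induction on the items, permuting the irreducibles of [D] of each degree. Positive exponents
    matter: [D (p ^+ e * g)] must force [D p], outside of which [sg] is uncontrolled. *)
Lemma sum_factored_sym (V : nmodType) its (G : {poly F} -> V) :
  all (fun x => 0 < x.2)%N its ->
  sum_factored its (fun f => if D f then G f else 0) =
  sum_factored its (fun f => if D f then G (sg f) else 0).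
Proof.
elim: its G => [|[d [//|e]] its IH] G /=; first by rewrite D1 sg1.
move=> its0.
have key G' p : p \in Mon d -> sum_factored its (fun g => if D (p ^+ e.+1 * g) then G' (p ^+ e.+1 * g) else 0)
  = if D p then sum_factored its (fun g => if D g then G' (p ^+ e.+1 * g) else 0) else 0 :> V.
  move=> /Mon_monic pm; case: ifP => Dp; last first.
    rewrite (@sum_factored_ext _ _ _ (fun=> 0)) ?sum_factored0 // => g /Mon_monic gm.
    by rewrite exprS -mulrA !DM ?monicMr ?monic_exp // Dp.
  apply: sum_factored_ext => g /Mon_monic gm.
  by have [De _] := symX e.+1 pm Dp; rewrite DM ?monic_exp // De.
pose H p := sum_factored its (fun g => if D g then G (p ^+ e.+1 * sg g) else 0).
have L p : p \in Mon d ->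
    sum_factored its (fun g => if D (p ^+ e.+1 * g) then G (p ^+ e.+1 * g) else 0) =
    if D p then H p else 0.
  by move=> pd; rewrite key //; case: ifP => // _; rewrite IH.
have R p : p \in Mon d ->
    sum_factored its (fun g => if D (p ^+ e.+1 * g) then G (sg (p ^+ e.+1 * g)) else 0) =
    if D p then H (sg p) else 0.
  move=> pd; rewrite (key (G \o sg)) //; case: ifP => // Dp.
  apply: sum_factored_ext => g /Mon_monic gm; case: ifP => //= Dg.
  have pm := Mon_monic pd; have [De Es] := symX e.+1 pm Dp.
  by rewrite sgM ?monic_exp // Es.
transitivity (\sum_(p <- [seq p <- Mon d | irr p && D p]) H p).
  rewrite big_filter [RHS]big_mkcondr /= big_seq_cond [RHS]big_seq_cond.
  by apply: eq_bigr => p /andP[pd _]; rewrite L.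
transitivity (\sum_(p <- [seq p <- Mon d | irr p && D p]) H (sg p)); last first.
  rewrite big_filter [LHS]big_mkcondr /= big_seq_cond [RHS]big_seq_cond.
  by apply: eq_bigr => p /andP[pd _]; rewrite R.
symmetry; apply: big_reindex_seq; first exact/filter_uniq/uniq_Mon.
  move=> p; rewrite !mem_filter => /andP[/andP[pi Dp] pd].
  by have [-> ->] := sg_Mon pd Dp; rewrite sym_irr.
move=> p p'; rewrite !mem_filter => /andP[/andP[pi Dp] pd] /andP[/andP[pi' Dp'] pd'] E.
by rewrite -(sgK (Mon_monic pd) Dp) E sgK ?(Mon_monic pd').
Qed.
End Symmetry.

Definition translate (b : F) f := f \Po ('X + b%:P).

Lemma translate_Mon b d f : f \in Mon d -> translate b f \in Mon d.
Proof.
rewrite !mem_Mon => /andP[fm sf]; rewrite size_comp_poly2 ?size_XaddC // sf andbT.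
by rewrite monicE lead_coef_comp ?size_XaddC // lead_coefXaddC expr1n mulr1.
Qed.

Lemma translateNK b f : translate (- b) (translate b f) = f.
Proof. by rewrite /translate polyCN comp_polyXaddC_K. Qed.

Lemma translateKN b f : translate b (translate (- b) f) = f.
Proof. by rewrite -{1}[b]opprK translateNK. Qed.

Lemma translateM b f g : translate b (f * g) = translate b f * translate b g.
Proof. exact: comp_polyM. Qed.

Lemma translateD b f g : translate b (f + g) = translate b f + translate b g.
Proof. exact: comp_polyD. Qed.

Lemma translateX b f n : translate b (f ^+ n) = translate b f ^+ n.
Proof.
by elim: n => [|n IH]; rewrite ?exprS ?translateM ?IH // !expr0 /translate comp_polyC.
Qed.

Lemma translate_translate b c f : translate b (translate c f) = translate (c + b) f.
Proof.
by rewrite /translate -comp_polyA comp_polyD comp_polyX comp_polyC polyCD -addrA [b%:P + _]addrC.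
Qed.

Lemma weight_translate b its f : all (fun x => 0 < x.2)%N its -> weight its (translate b f) = weight its f.
Proof.
move=> its0; rewrite /weight.
have := @sum_factored_sym predT (translate b) (translate (- b)) _ _ _ _ _ _ _ _ _ _ its
  (fun g => nat_of_bool (g == translate b f)) its0.
rewrite /= => -> //.
- by apply: sum_factored_ext => g _; rewrite (can_eq (translateNK b)).
- by rewrite /translate comp_polyC.
- by move=> g h *; apply: translateM.
- by move=> g h *; apply: translateM.
- by move=> g *; apply: translateNK.
- by move=> g *; apply: translateKN.
- by move=> d g gd; split=> //; apply: translate_Mon.
- by move=> d g gd; split=> //; apply: translate_Mon.
Qed.

(** This is [X^n f(1/X)], linear in [f] for fixed [n]; [reversal] is its monic normalisation. *)
Definition revp n f := \poly_(i < n.+1) f`_(n - i).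
(* Junk value: [reversal f = 0] when [f] vanishes at 0. *)
Definition reversal f := (f`_0)^-1 *: revp (size f).-1 f.

Lemma revpD n f g : revp n (f + g) = revp n f + revp n g.
Proof.
by apply/polyP => i; rewrite coefD !coef_poly; case: ifP; rewrite ?addr0 // coefD.
Qed.

Lemma revpZ n (t : F) f : revp n (t *: f) = t *: revp n f.
Proof.
by apply/polyP => i; rewrite coefZ !coef_poly; case: ifP; rewrite ?mulr0 // coefZ.
Qed.

Lemma revp_sum n (I : Type) (s : seq I) (G : I -> {poly F}) :
  revp n (\sum_(i <- s) G i) = \sum_(i <- s) revp n (G i).
Proof.
elim: s => [|i s IH]; last by rewrite !big_cons revpD IH.
by rewrite !big_nil -[X in revp n X](scale0r 0) revpZ scale0r.
Qed.

Lemma revpXn n k : (k <= n)%N -> revp n 'X^k = 'X^(n - k).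
Proof.
move=> kn; apply/polyP => i; rewrite coef_poly !coefXn.
by case: (ltnP i n.+1) => // ni; last (case: eqP => // E; lia); congr (_%:R); congr nat_of_bool; apply/eqP/eqP; lia.
Qed.

Lemma revpM a b f g : (size f <= a.+1)%N -> (size g <= b.+1)%N ->
  revp (a + b) (f * g) = revp a f * revp b g.
Proof.
move=> fa gb.
have E k h : (size h <= k.+1)%N -> h = \sum_(i < k.+1) h`_i *: 'X^i.
  by move=> hk; rewrite -poly_def -{1}(take_poly_id hk).
rewrite {1}(E _ _ fa) {1}(E _ _ gb) mulr_suml revp_sum.
rewrite [in RHS](E _ _ fa) [in RHS](E _ _ gb) !revp_sum mulr_suml.
apply: eq_bigr => i _; rewrite !mulr_sumr revp_sum; apply: eq_bigr => j _.
have ia := ltn_ord i; have jb := ltn_ord j.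
rewrite -scalerAl -scalerAr scalerA -exprD !revpZ !revpXn; [|lia..].
rewrite -scalerAl -scalerAr scalerA -exprD; congr (_ *: 'X^_); lia.
Qed.

Lemma coef_reversal n f i : f \in Mon n -> (i <= n)%N -> (reversal f)`_i = f`_(n - i) / f`_0.
Proof.
rewrite mem_Mon => /andP[_ /eqP sf] le_in.
by rewrite coefZ coef_poly sf /= ltnS le_in mulrC.
Qed.

Lemma Mon_coef n f : f \in Mon n -> f`_n = 1.
Proof.
by rewrite mem_Mon => /andP[/monicP fm /eqP sf]; rewrite -fm lead_coefE sf.
Qed.

Lemma coef0_reversal n f : f \in Mon n -> (reversal f)`_0 = (f`_0)^-1.
Proof. by move=> fn; rewrite (coef_reversal fn) // subn0 (Mon_coef fn) mul1r. Qed.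

Lemma reversal_Mon n f : f \in Mon n -> f`_0 != 0 -> reversal f \in Mon n.
Proof.
move=> fn f0; have [fm sf] : f \is monic /\ size f = n.+1.
  by move: fn; rewrite mem_Mon => /andP[? /eqP].
have cn : (reversal f)`_n = 1 by rewrite (coef_reversal fn) // subnn divff.
have sr : size (reversal f) = n.+1.
  apply/eqP; rewrite eqn_leq; apply/andP; split.
    by rewrite (leq_trans (size_scale_leq _ _)) // sf size_poly.
  rewrite ltnNge; apply/negP => /leq_sizeP/(_ n (leqnn n))/eqP.
  by rewrite cn oner_eq0.
by rewrite mem_Mon monicE lead_coefE sr /= cn !eqxx.
Qed.

Lemma reversalK n f : f \in Mon n -> f`_0 != 0 -> reversal (reversal f) = f.
Proof.
move=> fn f0; have rn := reversal_Mon fn f0.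
apply/polyP => i; case: (leqP i n) => ni; last first.
  have := reversal_Mon rn; rewrite (coef0_reversal fn) invr_eq0 => /(_ f0).
  rewrite mem_Mon => /andP[_ /eqP srr].
  move: fn; rewrite mem_Mon => /andP[_ /eqP sf].
  by rewrite !nth_default ?sf ?srr.
rewrite (coef_reversal rn ni) (coef_reversal fn) ?leq_subr // (coef0_reversal fn) invrK subKn //.
by rewrite mulfVK.
Qed.

Lemma reversalM a b f g : f \in Mon a -> g \in Mon b -> reversal (f * g) = reversal f * reversal g.
Proof.
move=> fa gb; have := MonM fa gb; move: fa gb.
rewrite !mem_Mon => /andP[_ /eqP sf] /andP[_ /eqP sg] /andP[_ /eqP sfg].
rewrite /reversal sfg sf sg /= coef0M revpM ?sf ?sg // -scalerAl -scalerAr scalerA.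
by rewrite invfM.
Qed.

Lemma sum_weight_reversal (V : nmodType) its (G : {poly F} -> V) :
  all (fun x => 0 < x.2)%N its ->
  \sum_(f <- Mon (total_deg its) | f`_0 != 0) G f *+ weight its f =
  \sum_(f <- Mon (total_deg its) | f`_0 != 0) G (reversal f) *+ weight its f.
Proof.
move=> its0.
have E (H : {poly F} -> V) : \sum_(f <- Mon (total_deg its) | f`_0 != 0) H f *+ weight its f =
    sum_factored its (fun f => if f`_0 != 0 then H f else 0).
  rewrite sum_factoredE big_mkcond; apply: eq_bigr => f _.
  by case: ifP => //; rewrite mul0rn.
rewrite !E; apply: (@sum_factored_sym (fun f => f`_0 != 0) reversal reversal) => //.
- by move=> f g *; rewrite coef0M mulf_eq0 negb_or.
- by rewrite coef1 eqxx oner_eq0.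
- have m1 : (1 : {poly F}) \in Mon 0 by rewrite mem_Mon monic1 size_poly1.
  have := reversal_Mon m1; rewrite coef1 oner_eq0 => /(_ isT).
  by rewrite mem_Mon => /andP[rm /eqP]; apply: monic_size1.
- by move=> f g fm gm *; apply: (reversalM (monic_Mon fm) (monic_Mon gm)).
- by move=> f g fm gm *; apply: (reversalM (monic_Mon fm) (monic_Mon gm)).
- by move=> f fm f0; apply: (reversalK (monic_Mon fm)).
- by move=> f fm f0; apply: (reversalK (monic_Mon fm)).
- by move=> d f fd f0; split; [apply: reversal_Mon | rewrite (coef0_reversal fd) invr_eq0].
- by move=> d f fd f0; split; [apply: reversal_Mon | rewrite (coef0_reversal fd) invr_eq0].
Qed.
End Factorizations.

(** * Equidistribution of the lowest and highest coefficients *)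
Section EdgeCoefficients.
Variable F : finFieldType.
Implicit Types (f g p r w z : {poly F}).
Variable N : nat.
Implicit Types (c : {ffun 'I_N -> F}) (I : {set 'I_N}) (th : 'I_N -> F -> F).

Lemma pairing_XnM c j g :
  pairing c ('X^j * g) = \sum_(i < N | (j <= i)%N) c i * g`_(i - j).
Proof.
rewrite /pairing [RHS]big_mkcond; apply: eq_bigr => i _.
by rewrite coefXnM; case: (ltnP i j) => _ //; rewrite mulr0.
Qed.

Lemma edge_nondegenerate c k h D L g :
  (0 < k)%N -> (k + h <= L.+1)%N -> g`_0 != 0 -> size g = D.+1 ->
  (forall i, c i != 0 -> (0 < i < k)%N || (D + L.+1 - h <= i < D + L.+1)%N) ->
  c != 0 -> exists2 z : {poly F}, (size z <= L)%N & pairing c ('X * z * g) != 0.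
Proof.
move=> k0 khL g0 sg cs c0.
have [i0 /andP[ik ci]|nolow] := pickP [pred i : 'I_N | (i < k)%N && (c i != 0)].
  have P0 : [pred i : 'I_N | (i < k)%N && (c i != 0)] i0 by apply/andP.
  case: (arg_maxnP (fun i : 'I_N => i : nat) P0) => i /= /andP[{}ik {}ci] imax.
  have i1 : (0 < i)%N by case/orP: (cs i ci) => /andP[] //; lia.
  exists 'X^(i.-1); first by rewrite size_polyXn prednK //; lia.
  rewrite -exprS prednK // pairing_XnM (bigD1 i) //= subnn big1 ?addr0 ?mulf_neq0 //.
  move=> j /andP[ij ji]; have [->|cj] := eqVneq (c j) 0; first by rewrite mul0r.
  have lij : (i < j)%N by rewrite ltn_neqAle eq_sym ji.
  have kj : (k <= j)%N.
    by rewrite leqNgt; apply/negP => jk; have := imax j; rewrite /= jk cj => /(_ isT); lia.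
  rewrite [g`_ _]nth_default ?mulr0 // sg.
  by case/orP: (cs j cj) => /andP[? ?]; lia.
have [i0 ci0] : exists i, c i != 0.
  apply/existsP; rewrite -negb_forall; apply: contra c0 => /forallP H.
  by apply/eqP/ffunP => i; rewrite ffunE; apply/eqP.
have P0 : [pred i : 'I_N | c i != 0] i0 by [].
case: (arg_minnP (fun i : 'I_N => i : nat) P0) => i /= ci imin.
have /andP[li ui] : (D + L.+1 - h <= i < D + L.+1)%N.
  case/orP: (cs i ci) => // /andP[_ ik].
  by have := nolow i; rewrite /= ik ci.
exists 'X^(i - D.+1); first by rewrite size_polyXn; lia.
rewrite -exprS pairing_XnM (bigD1 i) /=; last lia.
have -> : (i - (i - D.+1).+1 = D)%N by lia.
rewrite big1 ?addr0 ?mulf_neq0 //.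
  by rewrite -[D]/(D.+1.-1) -sg -lead_coefE lead_coef_eq0 -size_poly_eq0 sg.
move=> j /andP[ij ji]; have [->|cj] := eqVneq (c j) 0; first by rewrite mul0r.
have lij : (i < j)%N by rewrite ltn_neqAle eq_sym ji; apply: imin.
rewrite [g`_ _]nth_default ?mulr0 // sg; lia.
Qed.

(* The prescribed values may depend on the constant coefficient: reversal divides all
   coefficients by it. *)
Definition fits I th f : bool := [forall (i | i \in I), f`_i == th i f`_0].

Lemma fits_ext I th f g : f`_0 = g`_0 -> (forall i, i \in I -> f`_i = g`_i) ->
  fits I th f = fits I th g.
Proof.
move=> fg0 fg; apply: eq_forallb => i; rewrite fg0.
by case: (boolP (i \in I)) => // /fg ->.
Qed.

(** The factor ['X] fixes the constant coefficient, hence the prescribed values [th], while [z]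
    varies; the conditions then become independent linear forms in [z]. *)
Lemma count_fits_Pol I th k h D L a g :
  (0 < k)%N -> (k + h <= L.+1)%N -> g`_0 != 0 -> size g = D.+1 ->
  (forall i, i \in I -> (0 < i < k)%N || (D + L.+1 - h <= i < D + L.+1)%N) ->
  (#|F| ^ #|I|)%:R * \sum_(z <- Pol L) (fits I th (a + 'X * z * g))%:R =
  (#|F| ^ L)%:R :> int.
Proof.
move=> k0 khL g0 sg Is; rewrite natr_size_filter -natrM; congr (_%:R).
have := @count_independent F N I L (fun i z => ('X * z * g)`_i)
  (fun i => th i a`_0 - a`_i).
rewrite -/(pairing _ _) => <-.
- congr (_ * size _)%N; apply: eq_filter => z; apply: eq_forallb => i.
  rewrite !coefD -[('X * z * g)`_0]/(('X * z * g)`_0%N) -mulrA [X in a`_0 + X]coefXM /= addr0.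
  by rewrite [in RHS]eq_sym subr_eq addrC eq_sym.
- by move=> i x y; rewrite mulrDr mulrDl coefD.
- by move=> i t x; rewrite -scalerAr -scalerAl coefZ.
move=> c /supp_inP cI c0.
apply: (edge_nondegenerate k0 khL g0 sg) => // i ci.
by apply: Is; apply: contraNT ci => /cI ->.
Qed.

Lemma Mon_size d f : f \in Mon d -> size f = d.+1.
Proof. by rewrite mem_Mon => /andP[_ /eqP]. Qed.

Lemma count_fits_Mon I th k h D1 D2 g :
  (0 < k)%N -> (k + h <= D1)%N -> g`_0 != 0 -> g \in Mon D2 ->
  (forall i, i \in I -> (0 < i < k)%N || (D1 + D2 - h <= i < D1 + D2)%N) ->
  (#|F| ^ #|I|)%:R * \sum_(f <- Mon D1 | f`_0 != 0) (fits I th (f * g))%:R <=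
  (#|F| ^ D1)%:R :> int.
Proof.
move=> k0 khD g0 gD Is.
have qL : 0 < (#|F| ^ D1.-1)%:R :> int.
  by rewrite ltr0n expn_gt0 (ltnW (card_finNzRing_gt1 F)).
rewrite -(ler_pM2r qL) -mulrA mulr_natr big_mkcond.
rewrite -(@sum_Mon_avg _ _ _ _ (fun z => 'X * z)); last first.
  move=> z; rewrite mem_Pol => zL; rewrite (leq_trans (size_polyMleq _ _)) // size_polyX; lia.
rewrite mulr_sumr.
apply: (@le_trans _ _ (\sum_(f <- Mon D1 : seq {poly F}) (#|F| ^ D1.-1)%:R)); last first.
  by rewrite sumr_seq_const size_Mon lexx.
apply: ler_sum => f _.
rewrite (eq_bigr (fun z => if f`_0 != 0 then (fits I th (f * g + 'X * z * g))%:R else 0)); last first.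
  by move=> z _; rewrite coefD coefXM eqxx addr0 mulrDl.
case: (boolP (f`_0 != 0)) => f0; last by rewrite big1 ?mulr0 // ltW.
rewrite (@count_fits_Pol I th k h D2) ?lexx ?(Mon_size gD) //; first lia.
by move=> i /Is; have -> : (D2 + D1.-1.+1 = D1 + D2)%N by lia.
Qed.

Section Equidistribution.
Variables (k h D1 D2 : nat) (B : int) (IL IH : {set 'I_N}) (th : 'I_N -> F -> F).
Variables W1 W2 : {poly F} -> int.
Hypothesis k_gt0 : (0 < k)%N.
Hypothesis khD1 : (k + h <= D1)%N.
Hypothesis kkhD2 : (2 * k + h <= D2)%N.
Hypothesis ILlow : forall i, i \in IL -> (0 < i < k)%N.
Hypothesis IHhigh : forall i, i \in IH -> (D1 + D2 - h <= i < D1 + D2)%N.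
Hypothesis B_ge0 : 0 <= B.
Hypothesis W1B : forall f, f \in Mon D1 -> `|W1 f| <= B.
Hypothesis W2B : forall f, f \in Mon D2 -> `|W2 f| <= B.
Hypothesis W2tr : forall b f, f \in Mon D2 -> W2 (translate b f) = W2 f.

Let q : int := #|F|%:R.
(** Only the low conditions are centred; the high ones stay as an indicator. [Q] sums out the first
    factor and vanishes by convention where the second one does at 0. *)
Let T f : int := (fits IH th f)%:R * (q ^+ #|IL| * (fits IL th f)%:R - 1).
Let Q g : int := if g`_0 != 0 then \sum_(f <- Mon D1 | f`_0 != 0) W1 f * T (f * g) else 0.

Let T_ext f g : (forall i, (i < k)%N -> f`_i = g`_i) ->
  (forall i, (D1 + D2 - h <= i)%N -> f`_i = g`_i) -> T f = T g.
Proof.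
move=> lo hi; rewrite /T (@fits_ext IH _ f g) ?(@fits_ext IL _ f g) //; try exact: lo.
  by move=> i /ILlow/andP[_ /lo].
by move=> i /IHhigh/andP[/hi].
Qed.

Let coef_high f r i : f \in Mon D1 -> (size r <= D2 - h)%N ->
  (D1 + D2 - h <= i)%N -> (f * r)`_i = 0.
Proof.
move=> fD sr hi; rewrite nth_default // (leq_trans (size_polyMleq _ _)) //.
by rewrite (Mon_size fD); lia.
Qed.

Let Q_shift f r : (size ('X^k * r)%R <= D2 - h)%N -> Q (f + 'X^k * r) = Q f.
Proof.
move=> sr; rewrite /Q coefD coefXnM k_gt0 addr0.
case: ifP => // _; rewrite big_seq_cond [RHS]big_seq_cond.
apply: eq_bigr => g /andP[gD _]; congr (_ * _); apply: T_ext => i hi.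
  by rewrite mulrDr coefD mulrCA coefXnM hi addr0.
by rewrite mulrDr coefD (coef_high gD sr) // addr0.
Qed.

(** Adding ['X * z * w] with [w] prime to ['X] spreads the low coefficients of the product evenly
    and leaves its constant and top coefficients alone, so the centred factor of [T] averages to
    zero. *)
Let Q_sum f w : w`_0 != 0 -> size w = k.+1 ->
  \sum_(z <- Pol k.-1) Q (f + 'X * z * w) = 0.
Proof.
move=> w0 sw.
have c0 z : (f + 'X * z * w)`_0 = f`_0 by rewrite coefD -mulrA coefXM eqxx addr0.
rewrite /Q; under eq_bigr => z _ do rewrite c0.
case: (boolP (f`_0 != 0)) => f0; last by rewrite big1.
rewrite exchange_big /= big_seq_cond big1 // => g /andP[gD g0].
rewrite -mulr_sumr; apply/eqP; rewrite mulf_eq0; apply/orP; right; apply/eqP.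
have wg0 : (w * g)`_0 != 0 by rewrite coef0M mulf_neq0.
have swg : size (w * g) = (k + D1).+1.
  by rewrite size_mul -?size_poly_eq0 ?sw ?(Mon_size gD) //= addnS.
rewrite big_seq_cond (eq_bigr (fun z => (fits IH th (g * f))%:R *
  (q ^+ #|IL| * (fits IL th (g * f + 'X * z * (w * g)))%:R - 1))); last first.
  move=> z /andP[zk _]; rewrite /T.
  have -> : g * (f + 'X * z * w) = g * f + 'X * z * (w * g) by rewrite mulrDr mulrC (mulrCA g) (mulrC g).
  congr (_%:R * _); apply: congr1; apply: fits_ext.
    by rewrite coefD -!mulrA coefXM eqxx addr0.
  move=> i /IHhigh/andP[hi _]; rewrite coefD.
  rewrite (_ : 'X * z * (w * g) = g * ('X * z * w)); last by rewrite mulrA mulrC.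
  rewrite (@coef_high g ('X * z * w)) ?addr0 //.
  rewrite (leq_trans (size_polyMleq _ _)) // sw addnS /=.
  have := size_polyMleq 'X z; rewrite size_polyX; move: zk; rewrite mem_Pol.
  by move: (size _) (size _) => a b; lia.
rewrite -big_seq_cond -mulr_sumr sumrB -mulr_sumr sumr_seq_const size_Pol mulr1.
rewrite -natrX (@count_fits_Pol IL th k 0 (k + D1)) ?subrr ?mulr0 //; first lia.
by move=> i /ILlow ->.
Qed.

Let Q_orthogonal b : b != 0 -> \sum_(f <- Mon D2) Q f * Q (translate b f) = 0.
Proof.
move=> b0; apply/eqP.
have qL : (#|F| ^ k.-1)%:R != 0 :> int.
  by rewrite pnatr_eq0 -lt0n expn_gt0 (ltnW (card_finNzRing_gt1 F)).
pose w : {poly F} := ('X - b%:P) ^+ k.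
have sw : size w = k.+1 by rewrite size_exp_XsubC.
have w0 : w`_0 != 0.
  by rewrite -horner_coef0 horner_exp hornerXsubC sub0r expf_neq0 // oppr_eq0.
have sY z : z \in Pol k.-1 -> (size ('X * z * w)%R <= 2 * k)%N.
  rewrite mem_Pol => zk; rewrite (leq_trans (size_polyMleq _ _)) // sw addnS /=.
  have := size_polyMleq 'X z; rewrite size_polyX.
  by move: zk; move: (size _) (size _) => x y; lia.
suff : (\sum_(f <- Mon D2) Q f * Q (translate b f)) *+ (#|F| ^ k.-1) = 0.
  by move/eqP; rewrite -mulr_natr mulf_eq0 (negbTE qL) orbF.
rewrite -(@sum_Mon_avg _ _ _ _ (fun z => 'X * z * w)); last first.
  by move=> z /sY; lia.
apply: big1 => f _; rewrite big_seq (eq_bigr (fun z => Q (f + 'X * z * w) * Q (translate b f))).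
  by rewrite -big_seq -mulr_suml Q_sum ?mul0r.
move=> z zk; congr (_ * _); rewrite translateD translateM.
have trw : translate b w = 'X^k.
  by rewrite translateX /translate comp_polyB comp_polyX comp_polyC addrK.
have -> : translate b ('X * z) * translate b w = 'X^k * translate b ('X * z) by rewrite trw mulrC.
rewrite Q_shift // -trw mulrC -translateM.
by rewrite /translate size_comp_poly2 ?size_XaddC // (leq_trans (sY z zk)); lia.
Qed.

(** A trivial bound that still keeps the density [q ^- #|IH|] of the high conditions: the two terms
    of [T] are counted separately, with and without the low conditions. *)
Let Q_bound g : g \in Mon D2 -> q ^+ #|IH| * `|Q g| <= 2 * B * q ^+ D1.
Proof.
move=> gD; rewrite /Q; case: ifP => g0; last first.
  by rewrite normr0 mulr0 mulr_ge0 ?mulr_ge0 ?exprn_ge0 ?ler0n.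
apply: (@le_trans _ _ (q ^+ #|IH| * (B *
   (\sum_(f <- Mon D1 | f`_0 != 0) (q ^+ #|IL| * (fits (IH :|: IL) th (f * g))%:R
     + (fits IH th (f * g))%:R))))).
  apply: ler_wpM2l; first by rewrite exprn_ge0 ?ler0n.
  apply: (le_trans (ler_norm_sum _ _ _)); rewrite mulr_sumr.
  rewrite big_seq_cond [X in _ <= X]big_seq_cond; apply: ler_sum => f /andP[fD f0].
  rewrite normrM; apply: ler_pM => //; first exact: W1B.
  have -> : fits (IH :|: IL) th (f * g) = fits IH th (f * g) && fits IL th (f * g).
    apply/forall_inP/andP => [H|[/forall_inP H /forall_inP H'] i].
      by split; apply/forall_inP => i ii; apply: H; rewrite inE ii ?orbT.
    by rewrite inE => /orP[/H|/H'].
  rewrite /T; case: (fits IH _ _); last by rewrite /= mul0r normr0 mulr0 addr0.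
  rewrite /= mul1r (le_trans (ler_normB _ _)) // normr1.
  by rewrite ger0_norm // mulr_ge0 ?ler0n // exprn_ge0 ?ler0n.
rewrite big_split /= -mulr_sumr.
have q0 : 0 < q ^+ 1 by rewrite expr1 ltr0n (ltnW (card_finNzRing_gt1 F)).
have disj : #|IH :|: IL| = (#|IH| + #|IL|)%N.
  rewrite cardsU (_ : IH :&: IL = finset.set0) ?cards0 ?subn0 //.
  apply/setP => i; rewrite !inE; apply/negbTE/negP => /andP[/IHhigh ? /ILlow ?]; lia.
have E1 : q ^+ #|IH :|: IL| * \sum_(f <- Mon D1 | f`_0 != 0) (fits (IH :|: IL) th (f * g))%:R <= q ^+ D1.
  rewrite -!natrX (@count_fits_Mon _ _ k h D1 D2) // => i.
  by rewrite inE => /orP[/IHhigh->|/ILlow->]; rewrite ?orbT.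
have E2 : q ^+ #|IH| * \sum_(f <- Mon D1 | f`_0 != 0) (fits IH th (f * g))%:R <= q ^+ D1.
  rewrite -!natrX (@count_fits_Mon _ _ k h D1 D2) // => i.
  by move=> /IHhigh->; rewrite ?orbT.
rewrite mulrCA [2 * B]mulrC -mulrA; apply: ler_wpM2l => //.
rewrite mulrDr mulrA -exprD -disj mulr2n mulrDl mul1r.
by apply: lerD.
Qed.

(* Averaging [Q] over the translations, which fix [W2], and applying Cauchy-Schwarz leaves
   the correlations of [Q] with its translates; these vanish for distinct translations,
   because the residues modulo [X ^ k] and modulo [(X - b) ^ k] are independent. *)
Lemma edge_equidistribution :
  (q ^+ #|IH| * \sum_(g <- Mon D2 | g`_0 != 0) \sum_(f <- Mon D1 | f`_0 != 0)
     W1 f * W2 g * T (f * g)) ^+ 2 * q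
  <= (2 * B ^+ 2) ^+ 2 * q ^+ (2 * (D1 + D2)).
Proof.
have q0 : 0 < q by rewrite ltr0n (ltnW (card_finNzRing_gt1 F)).
set S := \sum_(g <- _ | _) _.
have SE : S = \sum_(g <- Mon D2) W2 g * Q g.
  rewrite /S big_mkcond; apply: eq_bigr => g _; rewrite /Q.
  case: ifP => _; last by rewrite mulr0.
  by rewrite mulr_sumr; apply: eq_bigr => f _; rewrite [RHS]mulrA (mulrC (W2 g)).
have sum_tr (G : {poly F} -> int) b :
    \sum_(g <- Mon D2) G (translate b g) = \sum_(g <- Mon D2) G g.
  apply: big_reindex_seq; first exact: uniq_Mon.
    by move=> g; apply: translate_Mon.
  by move=> g g' _ _ /(congr1 (translate (- b))); rewrite !translateNK.
pose V g := \sum_(b : F) Q (translate b g).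
have qS : q * S = \sum_(g <- Mon D2) W2 g * V g.
  under eq_bigr => g _ do rewrite mulr_sumr.
  rewrite exchange_big /= (eq_bigr (fun=> S)); last first.
    move=> b _; rewrite SE -(sum_tr (fun g => W2 g * Q g) b) big_seq [RHS]big_seq.
    by apply: eq_bigr => g gD; rewrite W2tr.
  by rewrite sumr_const -mulr_natl.
(* Of the [q ^ 2] pairs of translations only the [q] diagonal ones contribute; this is the whole
   gain. *)
have VV : \sum_(g <- Mon D2) V g ^+ 2 = q * \sum_(g <- Mon D2) Q g ^+ 2.
  rewrite (eq_bigr (fun g => \sum_b \sum_b' Q (translate b g) * Q (translate b' g))); last first.
    by move=> g _; rewrite expr2 /V mulr_suml; apply: eq_bigr => b _; rewrite mulr_sumr.
  rewrite exchange_big /= (eq_bigr (fun=> \sum_(g <- Mon D2) Q g ^+ 2)).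
    by rewrite sumr_const -mulr_natl.
  move=> b _; rewrite exchange_big /= (bigD1 b) //= [X in _ + X]big1 ?addr0.
    by rewrite -(sum_tr (fun g => Q g ^+ 2) b); apply: eq_bigr => g _; rewrite expr2.
  move=> b' bb'; rewrite -[RHS](@Q_orthogonal (b' - b)) ?subr_eq0 //.
  rewrite -(sum_tr (fun g => Q g * Q (translate (b' - b) g)) b); apply: eq_bigr => g _.
  by rewrite translate_translate addrC subrK.
have step : (q * S) ^+ 2 <= B ^+ 2 * (q ^+ D2 * \sum_(g <- Mon D2) V g ^+ 2).
  have -> : \sum_(g <- Mon D2) V g ^+ 2 = \sum_(g <- Mon D2) `|V g| ^+ 2.
    by apply: eq_bigr => g _; rewrite real_normK ?num_real.
  apply: (@le_trans _ _ (B ^+ 2 * (\sum_(g <- Mon D2) `|V g|) ^+ 2)); last first.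
    by rewrite ler_wpM2l ?exprn_ge0 // -natrX -size_Mon sqr_sum_le.
  rewrite -exprMn -[X in X <= _]real_normK ?num_real //.
  rewrite ler_pXn2r ?nnegrE ?normr_ge0 ?mulr_ge0 ?sumr_ge0 //.
  rewrite qS mulr_sumr (le_trans (ler_norm_sum _ _ _)) //.
  rewrite big_seq [X in _ <= X]big_seq; apply: ler_sum => g gD.
  by rewrite normrM ler_wpM2r ?W2B.
have QQ : (q ^+ #|IH|) ^+ 2 * \sum_(g <- Mon D2) Q g ^+ 2 <= q ^+ D2 * (2 * B * q ^+ D1) ^+ 2.
  rewrite mulr_sumr -[q ^+ D2]natrX -size_Mon -sumr_seq_const.
  rewrite big_seq [X in _ <= X]big_seq; apply: ler_sum => g gD.
  rewrite -exprMn -[X in X <= _]real_normK ?num_real // normrM (ger0_norm (exprn_ge0 _ (ltW q0))).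
  have := Q_bound gD; set a := q ^+ _ * _ => ab.
  have a0 : 0 <= a by rewrite mulr_ge0 // exprn_ge0 // ltW.
  by rewrite ler_pXn2r ?nnegrE // (le_trans a0).
rewrite -(ler_pM2r q0) -mulrA -expr2 -exprMn.
have -> : (q ^+ #|IH| * S * q) ^+ 2 = (q ^+ #|IH|) ^+ 2 * (q * S) ^+ 2.
  by rewrite -exprMn mulrA mulrAC.
apply: (@le_trans _ _ ((q ^+ #|IH|) ^+ 2 * (B ^+ 2 * (q ^+ D2 * \sum_(g <- Mon D2) V g ^+ 2)))).
  by rewrite ler_wpM2l // exprn_ge0 // exprn_ge0 // ltW.
rewrite VV.
have -> : (q ^+ #|IH|) ^+ 2 * (B ^+ 2 * (q ^+ D2 * (q * \sum_(g <- Mon D2) Q g ^+ 2))) =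
   B ^+ 2 * q ^+ D2 * q * ((q ^+ #|IH|) ^+ 2 * \sum_(g <- Mon D2) Q g ^+ 2) by ring.
apply: (@le_trans _ _ (B ^+ 2 * q ^+ D2 * q * (q ^+ D2 * (2 * B * q ^+ D1) ^+ 2))).
  apply: ler_wpM2l => //; apply: mulr_ge0; last exact: ltW.
  by apply: mulr_ge0; apply: exprn_ge0 => //; exact: ltW.
have -> : (2 * B ^+ 2) ^+ 2 * q ^+ (2 * (D1 + D2)) * q =
  B ^+ 2 * q ^+ D2 * q * (q ^+ D2 * (2 * B * q ^+ D1) ^+ 2).
  by rewrite mulnC exprM exprD; ring.
exact: lexx.
Qed.
End Equidistribution.
End EdgeCoefficients.

(** * Linear recurrences *)
Section Recurrences.
Variable F : finFieldType.
Implicit Types (f g p r u w z : {poly F}).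

Lemma recurrence_extend (lo hi b : nat) w (e : nat -> F) :
  w`_0 != 0 ->
  (forall y, (lo <= y)%N -> (y + size w <= hi)%N ->
     \sum_(i < size w) w`_i * e (y + i)%N = 0) ->
  (lo <= b)%N -> (b + (size w).-1 <= hi)%N ->
  (forall y, (b <= y < b + (size w).-1)%N -> e y = 0) ->
  forall y, (lo <= y < hi)%N -> e y = 0.
Proof.
move=> w0 annihilates lob bhi ezero.
have wn0 : w != 0 by apply: contraNneq w0 => ->; rewrite coef0.
have sw : size w = (size w).-1.+1 by rewrite prednK // size_poly_gt0.
set s := (size w).-1 in bhi ezero sw.
have up y : (b <= y < hi)%N -> e y = 0.
  elim/ltn_ind: y => y IH /andP[by_ yhi].
  have [ys|ys] := ltnP y (b + s); first by apply: ezero; rewrite by_.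
  have := annihilates (y - s)%N; rewrite sw big_ord_recr /= => H.
  have : \sum_(i < s) w`_i * e (y - s + i)%N + w`_s * e (y - s + s)%N = 0.
    by apply: H; lia.
  rewrite big1 ?add0r; last first.
    by move=> i _; rewrite IH ?mulr0 //; have := ltn_ord i; lia.
  rewrite subnK; last lia.
  move/eqP; rewrite mulf_eq0 => /orP[|/eqP//].
  by rewrite /s -lead_coefE lead_coef_eq0 (negbTE wn0).
have down t : (t <= b - lo)%N -> e (b - t)%N = 0 \/ (hi <= b - t)%N.
  elim/ltn_ind: t => -[|t] IH tb.
    have [bh|] := ltnP b hi; [left | by right; rewrite subn0].
    by rewrite subn0 up // leqnn.
  have := annihilates (b - t.+1)%N; rewrite sw big_ord_recl /= addn0 => H.
  have {}H : w`_0 * e (b - t.+1)%N + \sum_(i < s) w`_(bump 0 i) * e (b - t.+1 + bump 0 i)%N = 0.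
    by apply: H; lia.
  left; move: H; rewrite big1 ?addr0.
    by move/eqP; rewrite mulf_eq0 (negbTE w0) => /eqP.
  move=> i _; rewrite /bump leq0n add1n; have := ltn_ord i => iS.
  have [le|lt] := leqP i t; last by rewrite up ?mulr0 //; lia.
  have -> : (b - t.+1 + i.+1 = b - (t - i))%N by lia.
  by case: (IH (t - i)%N); [lia|lia|move=> ->; rewrite mulr0|lia].
move=> y /andP[loy yhi]; have [yb|yb] := leqP b y; first by apply: up; lia.
by have := down (b - y)%N; rewrite subKn ?(ltnW yb) // => -[|//|]; lia.
Qed.

Lemma poly_split_X u : u != 0 ->
  exists a u', [/\ u = 'X^a * u', u'`_0 != 0 & size u = (a + size u')%N].
Proof.
move: {2}(size u) (leqnn (size u)) => k; elim: k u => [|k IH] u su u0.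
  by move: su; rewrite leqn0 size_poly_eq0 (negbTE u0).
have [u00|u00] := eqVneq u`_0 0; last by exists 0%N, u; rewrite expr0 mul1r.
have E : u = 'X * drop_poly 1 u.
  by apply/polyP => -[|i]; rewrite coefXM //= coef_drop_poly addn1.
have d0 : drop_poly 1 u != 0 by apply: contraNneq u0 => d0; rewrite E d0 mulr0.
have sd : size u = (size (drop_poly 1 u)).+1 by rewrite {1}E mulrC size_mulX.
have [|a [u' [E' u'0 s']]] := IH (drop_poly 1 u) _ d0; first by rewrite -ltnS -sd.
by exists a.+1, u'; split=> //; [rewrite {1}E E' mulrA -exprS | rewrite sd s'].
Qed.

Variable N : nat.
Implicit Types (c : {ffun 'I_N -> F}) (I : {set 'I_N}).

Lemma pairing_Xn c (i : 'I_N) : pairing c 'X^i = c i.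
Proof.
rewrite /pairing (bigD1 i) //= coefXn eqxx mulr1 big1 ?addr0 // => j ji.
by rewrite coefXn (inj_eq val_inj) (negbTE ji) mulr0.
Qed.

Lemma pairing_expand c y w u :
  pairing c ('X^y * (w * u)) = \sum_(i < size w) w`_i * pairing c ('X^(y + i) * u).
Proof.
have {1}-> : w = \sum_(i < size w) w`_i *: 'X^i by rewrite -poly_def coefK.
rewrite mulr_suml mulr_sumr pairing_sum; apply: eq_bigr => i _.
by rewrite -scalerAl -scalerAr pairingZ mulrA -exprD.
Qed.

Variables K R : nat.

(* The linear recurrence with characteristic polynomial [w] holds for the entries of [c]
   with indices in [[K, R)]. *)
Definition annihilates w c : Prop :=
  forall y, (K <= y)%N -> (y + size w <= R)%N -> pairing c ('X^y * w) = 0.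

(** Order exactly [s], with nonzero constant coefficient so that the recurrence runs in both
    directions. *)
Definition recurrent s c : Prop := exists w, [/\ w`_0 != 0, size w = s.+1 & annihilates w c].

Lemma annihilates_congr w c c' : (forall i : 'I_N, (K <= i < R)%N -> c i = c' i) ->
  annihilates w c -> annihilates w c'.
Proof.
move=> cc' H y Ky yR; rewrite -[RHS](H y Ky yR); apply: eq_bigr => i _.
rewrite coefXnM; case: ltnP => yi; first by rewrite !mulr0.
have [iR|iR] := ltnP i R; first by rewrite cc' // iR (leq_trans Ky).
by rewrite nth_default ?mulr0 // leq_subRL // (leq_trans yR).
Qed.

Lemma annihilatesM w w' c : annihilates w c -> w' != 0 -> w != 0 -> annihilates (w' * w) c.
Proof.
move=> H w'0 w0 y Ky; have -> : size (w' * w) = (size w' + size w).-1 by rewrite size_mul.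
move=> yR.
rewrite pairing_expand big1 // => i _; rewrite H ?mulr0 //; have := ltn_ord i.
  lia.
have : (0 < size w)%N by rewrite size_poly_gt0.
lia.
Qed.

(** The sequence [y => pairing c ('X^y * u)] inherits the recurrence [w], so its vanishing at
    [deg w] consecutive places propagates. *)
Lemma annihilates_extend w u c b : w`_0 != 0 -> u != 0 -> annihilates w c ->
  (K <= b)%N -> (b + (size w).-1 + size u <= R.+1)%N ->
  (forall y, (b <= y < b + (size w).-1)%N -> pairing c ('X^y * u) = 0) -> annihilates u c.
Proof.
move=> w0 u0 H Kb bR zero y Ky yR.
have su : (0 < size u)%N by rewrite size_poly_gt0.
apply: (@recurrence_extend K (R.+1 - size u) b w (fun y => pairing c ('X^y * u))) => //;
  [|lia|lia].
move=> y' Ky' y'R; rewrite -pairing_expand (mulrC w) pairing_expand big1 // => i _.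
by rewrite H ?mulr0 //; have := ltn_ord i; lia.
Qed.

(** A degenerate [u], stripped of its power of ['X], would satisfy enough consecutive relations to
    give a recurrence of order below the minimal [s]. The factor ['X^(2 * K)] is the product of the
    shifts ['X^K] of the two variables. *)
Lemma recurrent_nondegenerate s d2 c :
  (2 * K + 2 * s <= R.+1)%N -> (s <= d2)%N -> recurrent s c ->
  (forall s', (s' < s)%N -> ~ recurrent s' c) ->
  forall u, u != 0 -> (size u <= s)%N ->
  exists2 y : {poly F}, (size y <= d2)%N & pairing c ('X^(2 * K) * (u * y)) != 0.
Proof.
move=> KsR sd [w [w0 sw relw]] smin u u0 us; apply: contrapT => H.
have zero (y : {poly F}) : (size y <= d2)%N -> pairing c ('X^(2 * K) * (u * y)) = 0.
  by move=> yd; apply/eqP; apply: contraT => ?; case: H; exists y.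
have [a [u' [E u'0 su]]] := poly_split_X u0.
have u'n0 : u' != 0 by apply: contraNneq u'0 => ->; rewrite coef0.
have su' : (0 < size u')%N by rewrite size_poly_gt0.
apply: (smin (size u').-1); first lia.
exists u'; split=> //; first by rewrite prednK.
have su's : (a + size u' <= s)%N by rewrite -su.
apply: (@annihilates_extend w u' c (2 * K + a)) => //; rewrite ?sw -?pred_Sn.
- by rewrite mul2n -addnn -addnA leq_addr.
- by move: su's KsR; clear; lia.
move=> y /andP[ay ya].
have -> : 'X^y * u' = 'X^(2 * K) * (u * 'X^(y - (2 * K + a))).
  rewrite E mulrAC mulrA -!exprD; congr ('X^_ * _); lia.
by apply: zero; rewrite size_polyXn; lia.
Qed.

(** A degenerate [u = 'X^a * u'] makes [u'] a recurrence of order below [K]. Starting recurrences at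
    index [K] leaves room for the shift by [a], which is less than [K]. *)
Lemma nonrecurrent_nondegenerate d2 c : (R <= d2)%N ->
  (forall s, (s < K)%N -> ~ recurrent s c) ->
  forall u, u != 0 -> (size u <= K)%N ->
  exists2 y : {poly F}, (size y <= d2)%N & pairing c (u * y) != 0.
Proof.
move=> Rd norec u u0 us; apply: contrapT => H.
have zero (y : {poly F}) : (size y <= d2)%N -> pairing c (u * y) = 0.
  by move=> yd; apply/eqP; apply: contraT => ?; case: H; exists y.
have [a [u' [E u'0 su]]] := poly_split_X u0.
have u'n0 : u' != 0 by apply: contraNneq u'0 => ->; rewrite coef0.
have su' : (0 < size u')%N by rewrite size_poly_gt0.
apply: (norec (size u').-1); first lia.
exists u'; split=> //; first by rewrite prednK.
move=> y Ky yR.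
have -> : 'X^y * u' = u * 'X^(y - a) by rewrite E mulrAC -exprD; congr ('X^_ * _); lia.
by apply: zero; rewrite size_polyXn; lia.
Qed.

Definition window b l : {set 'I_N} := [set i : 'I_N | (b <= i < b + l)%N].

(** The characteristic polynomials may differ, so the difference obeys their product, of order
    [2 * s]; hence the window length. Being annihilated by [1] means being zero on the range. *)
Lemma recurrent_unique s b c c' : recurrent s c -> recurrent s c' ->
  (K <= b)%N -> (b + 2 * s <= R)%N ->
  (forall i, i \in window b (2 * s) -> c i = c' i) ->
  forall i : 'I_N, (K <= i < R)%N -> c i = c' i.
Proof.
move=> [w [w0 sw relw]] [w' [w'0 sw' relw']] Kb bR cc' i /andP[Ki iR].
have wn0 : w != 0 by rewrite -size_poly_eq0 sw.
have w'n0 : w' != 0 by rewrite -size_poly_eq0 sw'.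
pose d := c - c'.
have rd : annihilates (w' * w) d.
  move=> y Ky yR; rewrite /d pairingDl pairingNl (annihilatesM relw) // (mulrC w').
  by rewrite (annihilatesM relw') ?subrr // mulrC.
have sww : size (w' * w) = (2 * s).+1 by rewrite size_mul // sw sw' /=; lia.
have : annihilates 1 d.
  apply: (@annihilates_extend (w' * w) 1 d b) => //; rewrite ?coef0M ?mulf_neq0 ?oner_eq0 //.
    by rewrite sww size_poly1 /=; lia.
  move=> y; rewrite sww /= mulr1 => yb.
  have [yN|yN] := ltnP y N; last first.
    by rewrite /pairing big1 // => j _; rewrite coefXn ltn_eqF ?mulr0 // (leq_trans _ yN).
  rewrite -[y]/(val (Ordinal yN)) pairing_Xn !ffunE (cc' (Ordinal yN)) ?subrr //.
  by rewrite inE.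
move=> /(_ i Ki); rewrite size_poly1 addn1 mulr1 => /(_ iR).
by rewrite pairing_Xn !ffunE => /eqP; rewrite subr_eq0 => /eqP.
Qed.

Lemma card_recurrent s b I : (K <= b)%N -> (b + 2 * s <= R)%N ->
  (forall i, i \in I -> (K <= i < R)%N) ->
  (#|[pred c : {ffun 'I_N -> F} | supp_in I c && `[< recurrent s c >]]| <= #|F| ^ #|I :&: window b (2 * s)|)%N.
Proof.
move=> Kb bR IKR.
pose rho c : {ffun 'I_N -> F} := [ffun i => if i \in window b (2 * s) then c i else 0].
rewrite -card_supp_in -(@card_in_imset _ _ rho).
  apply/subset_leq_card/fintype.subsetP => _ /imsetP[c /andP[/supp_inP cI _] ->].
  apply/supp_inP => i; rewrite inE ffunE; case: ifP => _; rewrite ?andbT ?andbF //.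
  exact: cI.
move=> c c' /andP[/supp_inP cI /asboolP rc] /andP[/supp_inP cI' /asboolP rc'] E.
apply/ffunP => i; have [iI|iI] := boolP (i \in I); last by rewrite cI ?cI'.
apply: (recurrent_unique rc rc' Kb bR) (IKR i iI) => j jw.
by have := congr1 (fun g : {ffun 'I_N -> F} => g j) E; rewrite !ffunE jw.
Qed.

Lemma card_window_split I a l l' :
  (#|I :&: window a (l + l')| = #|I :&: window a l| + #|I :&: window (a + l) l'|)%N.
Proof.
rewrite -cardsUI [X in (_ = _ + X)%N](_ : _ = 0%N) ?addn0.
  apply: eq_card => i; rewrite !inE -andb_orr; congr (_ && _); lia.
apply/eqP; rewrite cards_eq0; apply/eqP/setP => i; rewrite !inE.
apply/negbTE/negP => /andP[/andP[_ ?] /andP[_ ?]]; lia.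
Qed.

(** Pigeonhole over consecutive disjoint windows of length [2 * s]: if each held at least [s / 2]
    elements, [I] would be too large. *)
Lemma sparse_window I s : (0 < s)%N -> (2 * #|I| < (R - K) %/ (2 * s) * s)%N ->
  exists b, [/\ (K <= b)%N, (b + 2 * s <= R)%N & (2 * #|I :&: window b (2 * s)| < s)%N].
Proof.
move=> s0 Is; apply: contrapT => H.
have dense b : (K <= b)%N -> (b + 2 * s <= R)%N -> (s <= 2 * #|I :&: window b (2 * s)|)%N.
  by move=> Kb bR; rewrite leqNgt; apply/negP => ?; case: H; exists b.
have many j : (K + 2 * s * j <= R)%N -> (s * j <= 2 * #|I :&: window K (2 * s * j)|)%N.
  elim: j => [|j IH] jR; first by rewrite muln0.
  rewrite mulnS (mulnS (2 * s)) [(2 * s + _)%N]addnC card_window_split mulnDr addnC leq_add //.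
    by apply: IH; lia.
  by apply: dense; lia.
have KR : (K <= R)%N by lia.
have := many ((R - K) %/ (2 * s))%N; rewrite [(2 * s * _)%N]mulnC.
have := leq_trunc_div (R - K) (2 * s).
have : (#|I :&: window K ((R - K) %/ (2 * s) * (2 * s))| <= #|I|)%N.
  exact/subset_leq_card/subsetIl.
by move: (_ %/ _)%N Is => j; nia.
Qed.

End Recurrences.

(** * Character sums over factored polynomials *)
Section CharacterSums.
Variable F : finFieldType.
Implicit Types (f g p r u w z : {poly F}) (its : seq (nat * nat)).

Lemma sum_weight_split (V : pzSemiRingType) its its' (G : {poly F} -> V) :
  \sum_(f <- Mon (total_deg its + total_deg its') | f`_0 != 0) (weight (its ++ its') f)%:R * G f =
  \sum_(f <- Mon (total_deg its) | f`_0 != 0) \sum_(g <- Mon (total_deg its') | g`_0 != 0)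
    (weight its f)%:R * (weight its' g)%:R * G (f * g).
Proof.
transitivity (\sum_(f <- Mon (total_deg its + total_deg its'))
    (if f`_0 != 0 then G f else 0) *+ weight (its ++ its') f).
  rewrite big_mkcond; apply: eq_bigr => f _.
  by case: ifP => _; rewrite ?mul0rn // mulr_natl.
rewrite (sum_weight_cat its its' (fun f => if f`_0 != 0 then G f else 0)).
rewrite [RHS]big_mkcond; apply: eq_bigr => f _.
case: ifP => f0; last first.
  by rewrite big1 // => g _; rewrite coef0M mulf_eq0 negb_or f0 mul0rn.
rewrite [RHS]big_mkcond; apply: eq_bigr => g _.
rewrite coef0M mulf_eq0 negb_or f0 /=; case: ifP => _; last by rewrite mul0rn.
by rewrite -natrM mulr_natl.
Qed.

(** The shortest prefix reaching [T] overshoots by at most one item. *)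
Lemma split_items its T M : all (fun x => x.1 * x.2 <= M)%N its -> (T <= total_deg its)%N ->
  exists i1 i2, [/\ its = i1 ++ i2, (T <= total_deg i1)%N & (total_deg i1 <= T + M)%N].
Proof.
elim: its T => [|x its IH] T /=.
  by rewrite leqn0 => _ /eqP->; exists [::], [::].
case/andP=> xM itsM Td; have [T0|T0] := posnP T.
  by exists [::], (x :: its); rewrite T0.
have [le|lt] := leqP (x.1 * x.2) T; last first.
  by exists [:: x], its; split=> //; rewrite /total_deg /=; lia.
have Td' : (T - x.1 * x.2 <= total_deg its)%N by move: Td; rewrite /total_deg /=; lia.
have [i1 [i2 [E Ti iT]]] := IH (T - x.1 * x.2)%N itsM Td'.
exists (x :: i1), i2; split; first by rewrite E.
  by move: Ti; rewrite /total_deg /=; lia.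
by move: iT; rewrite /total_deg /=; lia.
Qed.

(** The cross terms depend on [x] alone or on [y] alone, so their characters are absorbed into the
    coefficients without changing absolute values. *)
Lemma bilinear_shift_bound N (c : {ffun 'I_N -> F}) g1 g2 (k d1 d2 s : nat)
    (u v : {poly F} -> algC) (B1 B2 : algC) :
  (s <= d1)%N -> 0 <= B1 -> 0 <= B2 ->
  (forall x, x \in Pol d1 -> `|u x| <= B1) -> (forall y, y \in Pol d2 -> `|v y| <= B2) ->
  (forall w, w != 0 -> (size w <= s)%N ->
     exists2 y : {poly F}, (size y <= d2)%N & pairing c ('X^(2 * k) * (w * y)) != 0) ->
  `|\sum_(x <- Pol d1) \sum_(y <- Pol d2) u x * v y *
      psi (pairing c ((g1 + 'X^k * x) * (g2 + 'X^k * y)))| ^+ 2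
   <= (B1 * B2) ^+ 2 * (#|F| ^ (2 * d1 + 2 * d2 - s))%:R.
Proof.
move=> sd B10 B20 uB vB nondeg.
pose u' x := if x \in Pol d1 then u x * psi (pairing c ('X^k * x * g2)) else 0.
pose v' y := if y \in Pol d2 then v y * psi (pairing c (g1 * ('X^k * y))) else 0.
have E : \sum_(x <- Pol d1) \sum_(y <- Pol d2) u x * v y *
      psi (pairing c ((g1 + 'X^k * x) * (g2 + 'X^k * y))) =
   psi (pairing c (g1 * g2)) * \sum_(x <- Pol d1) \sum_(y <- Pol d2) u' x * v' y *
     psi (pairing c ('X^(2 * k) * (x * y))).
  rewrite mulr_sumr big_seq [RHS]big_seq; apply: eq_bigr => x xd.
  rewrite mulr_sumr big_seq [RHS]big_seq; apply: eq_bigr => y yd.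
  rewrite /u' /v' xd yd.
  have -> : (g1 + 'X^k * x) * (g2 + 'X^k * y) =
     g1 * g2 + 'X^k * x * g2 + g1 * ('X^k * y) + 'X^(2 * k) * (x * y).
    by rewrite mul2n -addnn exprD; ring.
  by rewrite !pairingD !psiD; ring.
rewrite E normrM norm_psi mul1r.
apply: bilinear_bound => //.
- move=> x; rewrite /u'; case: ifP => xd; last by rewrite normr0.
  by rewrite normrM norm_psi mulr1 uB.
- move=> y; rewrite /v'; case: ifP => yd; last by rewrite normr0.
  by rewrite normrM norm_psi mulr1 vB.
- by move=> x x' y; rewrite mulrDl mulrDr pairingD.
- by move=> x y y'; rewrite !mulrDr pairingD.
- by move=> t x y; rewrite -scalerAl -scalerAr pairingZ.
- by move=> t x y; rewrite -!scalerAr pairingZ.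
Qed.

Lemma sum_Mon_Pol (V : nmodType) d (G : {poly F} -> V) :
  \sum_(f <- Mon d) G f = \sum_(x <- Pol d) G ('X^d + x).
Proof. by rewrite big_map. Qed.

Section Fixed.
Variables (n B : nat).
Let N := n.+1.
Implicit Types (c : {ffun 'I_N -> F}) (I : {set 'I_N}).

(* Monic [f1] and [f2] are written [X ^ d + x], so the bilinear form only involves the
   non-leading coefficients. *)
Lemma nonrecurrent_bound i1 i2 c (K R : nat) :
  (total_deg i1 + total_deg i2 = n)%N -> (K <= total_deg i1)%N -> (R <= total_deg i2)%N ->
  (forall f, f \in Mon (total_deg i1) -> (weight i1 f <= B)%N) ->
  (forall f, f \in Mon (total_deg i2) -> (weight i2 f <= B)%N) ->
  (forall s, (s < K)%N -> ~ recurrent K R s c) ->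
  `|\sum_(f <- Mon n | f`_0 != 0) (weight (i1 ++ i2) f)%:R * psi (pairing c f)| ^+ 2
     * (#|F| ^ K)%:R <= (B * B)%:R ^+ 2 * (#|F| ^ (2 * n))%:R :> algC.
Proof.
move=> Dn KD RD W1 W2 norec.
rewrite -Dn sum_weight_split big_mkcond sum_Mon_Pol.
pose u i (x : {poly F}) : algC := if ('X^(total_deg i) + x)`_0 != 0 then (weight i ('X^(total_deg i) + x))%:R else 0.
rewrite (eq_bigr (fun x => \sum_(y <- Pol (total_deg i2)) u i1 x * u i2 y *
   psi (pairing c (('X^(total_deg i1) + 'X^0 * x) * ('X^(total_deg i2) + 'X^0 * y))))); last first.
  move=> x _; rewrite /u; case: ifP => x0; last by rewrite big1 // => y _; rewrite !mul0r.
  rewrite big_mkcond sum_Mon_Pol; apply: eq_bigr => y _.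
  by case: ifP => y0; rewrite !expr0 !mul1r // mulr0 mul0r.
have uB i (x : {poly F}) : (forall f, f \in Mon (total_deg i) -> (weight i f <= B)%N) -> x \in Pol (total_deg i) ->
    `|u i x| <= B%:R.
  move=> W xd; rewrite /u; case: ifP => _; last by rewrite normr0 ler0n.
  by rewrite normr_nat ler_nat W // map_f.
apply: (@le_trans _ _ ((B%:R * B%:R) ^+ 2 *
   (#|F| ^ (2 * total_deg i1 + 2 * total_deg i2 - K))%:R * (#|F| ^ K)%:R)).
  rewrite ler_wpM2r ?ler0n // bilinear_shift_bound ?ler0n //.
  - by move=> x xd; apply: uB.
  - by move=> y yd; apply: uB.
  - by move=> w w0 ws; rewrite muln0; have [y yd] := nonrecurrent_nondegenerate RD norec w0 ws;
    exists y; rewrite ?expr0 ?mul1r.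
rewrite -[X in X <= _]mulrA -[X in _ * X <= _]natrM -expnD [(B * B)%:R]natrM.
by have -> : (2 * total_deg i1 + 2 * total_deg i2 - K + K = 2 * (total_deg i1 + total_deg i2))%N by lia.
Qed.

Lemma sum_Mon_avg2 (V : pzSemiRingType) D1 D2 d1 d2 k (G : {poly F} -> {poly F} -> V) :
  (k + d1 <= D1)%N -> (k + d2 <= D2)%N ->
  (#|F| ^ (d1 + d2))%:R * \sum_(f <- Mon D1) \sum_(g <- Mon D2) G f g =
  \sum_(f <- Mon D1) \sum_(g <- Mon D2) \sum_(x <- Pol d1) \sum_(y <- Pol d2)
     G (f + 'X^k * x) (g + 'X^k * y).
Proof.
have sz d (x : {poly F}) : x \in Pol d -> (size ('X^k * x)%R <= k + d)%N.
  rewrite mem_Pol => xd; rewrite (leq_trans (size_polyMleq _ _)) // size_polyXn.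
  by rewrite addSn /= leq_add2l.
move=> kD1 kD2; rewrite expnD natrM -mulrA.
have -> : (#|F| ^ d2)%:R * (\sum_(f <- Mon D1) \sum_(g <- Mon D2) G f g) =
    \sum_(f <- Mon D1) \sum_(g <- Mon D2) \sum_(y <- Pol d2) G f (g + 'X^k * y).
  rewrite mulr_sumr; apply: eq_bigr => f _; rewrite mulr_natl sum_Mon_avg //.
  by move=> z zd; rewrite (leq_trans (sz _ _ zd)).
rewrite mulr_natl -(@sum_Mon_avg _ _ _ _ (fun x => 'X^k * x)); last first.
  by move=> z zd; rewrite (leq_trans (sz _ _ zd)).
by apply: eq_bigr => f _; rewrite exchange_big.
Qed.

(* Adding [X ^ K * x] and [X ^ K * y] with [x], [y] of small degree to the two factors does
   not change the bottom [K] and top [H] coefficients of their product, so one may average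
   over [x] and [y] before applying the bilinear bound. *)
Lemma recurrent_bound i1 i2 c I (th : 'I_N -> F -> F) (K H s : nat) :
  (0 < K)%N -> (0 < s < K)%N -> (K + H + K <= total_deg i1)%N -> (K + H + K <= total_deg i2)%N ->
  (total_deg i1 + total_deg i2 = n)%N ->
  (forall f, f \in Mon (total_deg i1) -> (weight i1 f <= B)%N) ->
  (forall f, f \in Mon (total_deg i2) -> (weight i2 f <= B)%N) ->
  recurrent K (n - H) s c -> (forall s', (s' < s)%N -> ~ recurrent K (n - H) s' c) ->
  (forall i, i \in I -> (0 < i < K)%N || (n - H <= i < n)%N) ->
  ((#|F| ^ #|I|)%:R * `|\sum_(f <- Mon n | f`_0 != 0) (weight (i1 ++ i2) f)%:R *
     ((fits I th f)%:R * psi (pairing c f))|) ^+ 2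
     * (#|F| ^ s)%:R <= (B * B)%:R ^+ 2 * (#|F| ^ (2 * n))%:R :> algC.
Proof.
move=> K0 /andP[s0 sK] D1 D2 Dn W1 W2 recs smin Ie.
set S := \sum_(f <- _ | _) _.
(* The freedom left in each factor once its bottom [K] and top [H] coefficients are frozen. *)
pose d1 := (total_deg i1 - K - H)%N; pose d2 := (total_deg i2 - K - H)%N.
have qpos k : 0 < (#|F| ^ k)%:R :> algC.
  by rewrite ltr0n expn_gt0 (ltnW (card_finNzRing_gt1 F)).
pose ok f : algC := (f`_0 != 0)%:R.
have S_E : S = \sum_(f <- Mon (total_deg i1)) \sum_(g <- Mon (total_deg i2))
   ok f * ok g * (fits I th (f * g))%:R *
     ((weight i1 f)%:R * (weight i2 g)%:R * psi (pairing c (f * g))).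
  rewrite /S -Dn sum_weight_split big_mkcond; apply: eq_bigr => f _.
  rewrite /ok; case: (f`_0 != 0); last by rewrite big1 // => g _; rewrite !mul0r.
  rewrite big_mkcond; apply: eq_bigr => g _.
  case: (g`_0 != 0); last by rewrite mulr0 !mul0r.
  by rewrite !mul1r mulrCA mulrA.
(* The edge conditions do not see [x] and [y], so [E] bounds the inner sum for each pair [(f, g)]
   and [A] counts the pairs that meet the conditions. This retains the density [q ^- #|I|]. *)
pose A := \sum_(f <- Mon (total_deg i1)) \sum_(g <- Mon (total_deg i2))
   ok f * ok g * (fits I th (f * g))%:R.
pose E : algC := sqrtC ((B%:R * B%:R) ^+ 2 * (#|F| ^ (2 * d1 + 2 * d2 - s))%:R).
have E0 : 0 <= E by rewrite sqrtC_ge0 mulr_ge0 ?exprn_ge0 ?mulr_ge0 ?ler0n.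
have szX d D (x : {poly F}) : x \in Pol d -> (K + d + H <= D)%N -> (size ('X^K * x)%R <= D - H)%N.
  rewrite mem_Pol => xd KD; rewrite (leq_trans (size_polyMleq _ _)) // size_polyXn.
  by rewrite addSn /= (@leq_trans (K + d)) ?leq_add2l //; lia.
have cnd_shift f g (x y : {poly F}) : f \in Mon (total_deg i1) -> g \in Mon (total_deg i2) ->
    x \in Pol d1 -> y \in Pol d2 ->
    fits I th ((f + 'X^K * x) * (g + 'X^K * y)) = fits I th (f * g).
  move=> fD gD xd yd.
  have x0 : (f + 'X^K * x)`_0 = f`_0 by rewrite coefD coefXnM K0 addr0.
  have y0 : (g + 'X^K * y)`_0 = g`_0 by rewrite coefD coefXnM K0 addr0.
  have Edec : (f + 'X^K * x) * (g + 'X^K * y) = f * g + 'X^K * (x * g + (f + 'X^K * x) * y).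
    by ring.
  apply: fits_ext; first by rewrite !coef0M x0 y0.
  move=> i /Ie/orP[/andP[_ iK]|/andP[iH _]].
    by rewrite Edec coefD coefXnM iK addr0.
  have -> : (f + 'X^K * x) * (g + 'X^K * y) = f * g + ('X^K * x * g + (f + 'X^K * x) * ('X^K * y)).
    by ring.
  have xs : (size ('X^K * x)%R <= total_deg i1 - H)%N by apply: (szX d1) => //; rewrite /d1; lia.
  have ys : (size ('X^K * y)%R <= total_deg i2 - H)%N by apply: (szX d2) => //; rewrite /d2; lia.
  have fx : f + 'X^K * x \in Mon (total_deg i1) by apply: MonD => //; apply: (leq_trans xs); lia.
  rewrite coefD [X in _ + X]nth_default ?addr0 //.
  rewrite (leq_trans (size_polyD _ _)) // geq_max; apply/andP; split.
    rewrite (leq_trans (size_polyMleq _ _)) // (Mon_size gD) addnS /=.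
    by apply: leq_trans (leq_add xs (leqnn _)) _; lia.
  rewrite (leq_trans (size_polyMleq _ _)) // (Mon_size fx) addSn /=.
  by apply: leq_trans (leq_add (leqnn _) ys) _; lia.
have ok_shift f (x : {poly F}) : ok (f + 'X^K * x) = ok f by rewrite /ok coefD coefXnM K0 addr0.
have step : (#|F| ^ (d1 + d2))%:R * `|S| <= E * A.
  rewrite -[X in X * _]ger0_norm ?ler0n // -normrM S_E.
  rewrite (@sum_Mon_avg2 _ _ _ _ _ K); [|rewrite /d1; lia|rewrite /d2; lia].
  rewrite /A mulr_sumr big_seq [X in _ <= X]big_seq.
  apply: (le_trans (ler_norm_sum _ _ _)); apply: ler_sum => f fD.
  rewrite mulr_sumr big_seq [X in _ <= X]big_seq.
  apply: (le_trans (ler_norm_sum _ _ _)); apply: ler_sum => g gD.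
  have -> : \sum_(x <- Pol d1) \sum_(y <- Pol d2)
      ok (f + 'X^K * x) * ok (g + 'X^K * y) * (fits I th ((f + 'X^K * x) * (g + 'X^K * y)))%:R *
      ((weight i1 (f + 'X^K * x))%:R * (weight i2 (g + 'X^K * y))%:R *
      psi (pairing c ((f + 'X^K * x) * (g + 'X^K * y)))) =
    ok f * ok g * (fits I th (f * g))%:R * \sum_(x <- Pol d1) \sum_(y <- Pol d2)
      ((weight i1 (f + 'X^K * x))%:R * (weight i2 (g + 'X^K * y))%:R *
      psi (pairing c ((f + 'X^K * x) * (g + 'X^K * y)))).
    rewrite mulr_sumr big_seq [RHS]big_seq; apply: eq_bigr => x xd.
    rewrite mulr_sumr big_seq [RHS]big_seq; apply: eq_bigr => y yd.
    by rewrite cnd_shift // !ok_shift.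
  have okcn0 : 0 <= ok f * ok g * (fits I th (f * g))%:R by rewrite !mulr_ge0 ?ler0n.
  rewrite normrM (ger0_norm okcn0) mulrC ler_wpM2r //.
  rewrite -(@ler_pXn2r _ 2) ?nnegrE ?normr_ge0 // sqrtCK.
  apply: bilinear_shift_bound; rewrite ?ler0n //; first by rewrite /d1; lia.
  - move=> x xd; rewrite normr_nat ler_nat; apply: W1; apply: MonD => //.
    by apply: (leq_trans (szX d1 (total_deg i1) x xd _)); rewrite /d1; lia.
  - move=> y yd; rewrite normr_nat ler_nat; apply: W2; apply: MonD => //.
    by apply: (leq_trans (szX d2 (total_deg i2) y yd _)); rewrite /d2; lia.
  - by apply: (recurrent_nondegenerate _ _ recs smin); rewrite /d2; lia.
have Acount : (#|F| ^ #|I|)%:R * A <= (#|F| ^ n)%:R.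
  rewrite /A exchange_big /= mulr_sumr.
  have -> : (#|F| ^ n)%:R = \sum_(g <- Mon (total_deg i2) : seq {poly F}) (#|F| ^ total_deg i1)%:R :> algC.
    by rewrite sumr_seq_const size_Mon -natrM -expnD addnC Dn.
  rewrite big_seq [X in _ <= X]big_seq; apply: ler_sum => g gD.
  rewrite /ok; case: (boolP (g`_0 != 0)) => g0; last first.
    by rewrite big1 ?mulr0 ?ler0n // => f _; rewrite mulr0 mul0r.
  have := @count_fits_Mon F N I th K H (total_deg i1) (total_deg i2) g K0 _ g0 gD.
  rewrite Dn => /(_ (ltac:(lia)) Ie).
  rewrite -natr_sum -natrM ler_nat -(ler_nat algC) natrM natr_sum; apply: le_trans.
  rewrite ler_wpM2l ?ler0n // [X in _ <= X]big_mkcond; apply: ler_sum => f _.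
  by case: (f`_0 != 0); rewrite ?mul1r ?mul0r.
have q2 : ((#|F| ^ #|I|)%:R * `|S|) * (#|F| ^ (d1 + d2))%:R <= E * (#|F| ^ n)%:R.
  rewrite -mulrA [_ * (#|F| ^ (d1 + d2))%:R]mulrC.
  apply: (@le_trans _ _ ((#|F| ^ #|I|)%:R * (E * A))); first by rewrite ler_wpM2l ?ler0n.
  by rewrite mulrCA ler_wpM2l.
have : (((#|F| ^ #|I|)%:R * `|S|) * (#|F| ^ (d1 + d2))%:R) ^+ 2 <= (E * (#|F| ^ n)%:R) ^+ 2.
  by rewrite ler_pXn2r ?nnegrE ?mulr_ge0 ?ler0n.
rewrite exprMn [X in _ <= X]exprMn sqrtCK -!natrX -!expnM => le2.
rewrite -(ler_pM2r (qpos (2 * d1 + 2 * d2 - s)%N)).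
rewrite -[X in X <= _]mulrA -[X in _ * X <= _]natrM -expnD.
have -> : (s + (2 * d1 + 2 * d2 - s) = (d1 + d2) * 2)%N by rewrite /d1 /d2; lia.
by apply: (le_trans le2); rewrite [X in X <= _]mulrAC (natrX _ (B * B) 2) (natrM _ B B) (mulnC 2%N n) lexx.
Qed.

End Fixed.
End CharacterSums.

(** * Removing the conditions at both ends for one list of items *)

Section Edges.
Variable F : finFieldType.
Implicit Types (f g p r u w z : {poly F}) (its : seq (nat * nat)).
Variables (n B : nat).
Implicit Types (I : {set 'I_n.+1}) (th : 'I_n.+1 -> F -> F) (alpha : 'I_n.+1 -> F).

Lemma weighted_edge_equidistribution i1 i2 (k h : nat) (IL IH : {set 'I_n.+1}) th :
  (0 < k)%N -> (k + h <= total_deg i1)%N -> (2 * k + h <= total_deg i2)%N ->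
  (total_deg i1 + total_deg i2 = n)%N -> all (fun x => 0 < x.2)%N i2 ->
  (forall i, i \in IL -> (0 < i < k)%N) ->
  (forall i, i \in IH -> (n - h <= i < n)%N) ->
  (forall f, f \in Mon (total_deg i1) -> (weight i1 f <= B)%N) ->
  (forall f, f \in Mon (total_deg i2) -> (weight i2 f <= B)%N) ->
  (#|F|%:R ^+ #|IH| * \sum_(f <- Mon n | f`_0 != 0) (weight (i1 ++ i2) f)%:R *
    ((fits IH th f)%:R * (#|F|%:R ^+ #|IL| * (fits IL th f)%:R - 1))) ^+ 2 * #|F|%:R
  <= (2 * B%:R ^+ 2) ^+ 2 * #|F|%:R ^+ (2 * n) :> int.
Proof.
move=> k0 D1 D2 Dn e0 ILk IHh W1 W2.
have := @edge_equidistribution F n.+1 k h (total_deg i1) (total_deg i2) B%:R IL IH th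
  (fun f => (weight i1 f)%:R) (fun g => (weight i2 g)%:R) k0 D1 D2 ILk.
rewrite !Dn => /(_ IHh (ler0n _ _)).
have nB i f : (weight i f <= B)%N -> `|(weight i f)%:R| <= B%:R :> int.
  by rewrite normr_nat ler_nat.
move=> /(_ (fun f fD => nB _ _ (W1 f fD)) (fun f fD => nB _ _ (W2 f fD))).
have Wtr (b : F) f : f \in Mon (total_deg i2) -> (weight i2 (translate b f))%:R = (weight i2 f)%:R :> int.
  by move=> _; rewrite weight_translate.
move=> /(_ Wtr); congr (( _ * _) ^+ 2 * _ <= _).
have := sum_weight_split i1 i2 (fun f => (fits IH th f)%:R *
  (#|F|%:R ^+ #|IL| * (fits IL th f)%:R - 1) : int).
by rewrite Dn exchange_big.
Qed.

(** Carries the squared integer estimate over to [algC], where a square root is available. *)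
Lemma int_sqr_bound (Z : int) :
  Z ^+ 2 * #|F|%:R <= (2 * B%:R ^+ 2) ^+ 2 * #|F|%:R ^+ (2 * n) ->
  `|Z%:~R| * sqrtC #|F|%:R <= (2 * B ^ 2)%:R * (#|F| ^ n)%:R :> algC.
Proof.
rewrite -(ler_int algC) => H.
rewrite -(@ler_pXn2r _ 2) ?nnegrE ?mulr_ge0 ?sqrtC_ge0 ?ler0n //.
rewrite exprMn sqrtCK real_normK; last exact: realz.
move: H; rewrite !(rmorphM, rmorphXn) /= !rmorph_nat; congr (_ <= _).
by rewrite [RHS]exprMn natrM !natrX -!exprM (mulnC n).
Qed.

(** On ['I_n.+1], [rev_ord] is [i => n - i], the action of reversal on coefficients of degree [n]
    polynomials; this is why indices include [n]. *)
Definition revset I : {set 'I_n.+1} := [set rev_ord i | i in I].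

Lemma card_revset I : #|revset I| = #|I|.
Proof. by rewrite card_imset //; apply: rev_ord_inj. Qed.

Definition fixed alpha : 'I_n.+1 -> F -> F := fun i _ => alpha i.

(** Reversal divides by [f]_0[, and the reversed polynomial has constant coefficient](f[_0)^-1]; a
    constant prescribed value thus becomes a multiple of the constant coefficient. *)
Lemma fits_reversal I alpha f : f \in Mon n -> f`_0 != 0 ->
  fits (revset I) (fun i a => alpha (rev_ord i) * a) (reversal f) = fits I (fixed alpha) f.
Proof.
move=> fn f0.
have E (i : 'I_n.+1) : ((reversal f)`_(rev_ord i) == alpha (rev_ord (rev_ord i)) * (reversal f)`_0) =
   (f`_i == alpha i).
  rewrite rev_ordK (coef0_reversal fn) (coef_reversal fn) /=; last by rewrite subSS leq_subr.
  rewrite subSS subKn -1?ltnS // (inj_eq (mulIf _)) // invr_eq0 //.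
apply/forall_inP/forall_inP => [H i iI|H i /imsetP[j jI ->]].
  by have := H (rev_ord i) (imset_f _ iI); rewrite E.
by rewrite E H.
Qed.

(** Telescoping through [Nl]: the high conditions are removed in the presence of the low ones, after
    reversal, and then the low ones alone. Each difference centres the conditions at one end
    only. *)
Lemma edges_bound i1 i2 I alpha (K H : nat) :
  (0 < K)%N -> (K + H.+1 <= total_deg i1)%N -> (2 * H.+1 + K <= total_deg i2)%N ->
  (2 * K <= total_deg i2)%N -> (total_deg i1 + total_deg i2 = n)%N ->
  all (fun x => 0 < x.2)%N (i1 ++ i2) ->
  (forall i, i \in I -> (0 < i < K)%N || (n - H <= i < n)%N) ->
  (forall f, f \in Mon (total_deg i1) -> (weight i1 f <= B)%N) ->
  (forall f, f \in Mon (total_deg i2) -> (weight i2 f <= B)%N) ->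
  `|(#|F| ^ #|I|)%:R * (\sum_(f <- Mon n | f`_0 != 0) (weight (i1 ++ i2) f)%:R *
        (fits I (fixed alpha) f)%:R) - \sum_(f <- (Mon n : seq {poly F}) | f`_0 != 0) (weight (i1 ++ i2) f)%:R|
    * sqrtC #|F|%:R <= (4 * B ^ 2)%:R * (#|F| ^ n)%:R :> algC.
Proof.
move=> K0 D1 D2 D2' Dn e0 IKH W1 W2.
pose Il := [set i in I | (i < K)%N]; pose Ih := [set i in I | (K <= i)%N].
have e02 : all (fun x => 0 < x.2)%N i2 by move: e0; rewrite all_cat => /andP[].
have cardI : #|I| = (#|Il| + #|Ih|)%N.
  rewrite -(cardsID [set i : 'I_n.+1 | (i < K)%N] I); congr (_ + _)%N;
  by apply: eq_card => i; rewrite !inE ?ltnNge ?negbK // andbC.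
have cndI f : fits I (fixed alpha) f = fits Il (fixed alpha) f && fits Ih (fixed alpha) f.
  apply/forall_inP/andP => [h|[/forall_inP h /forall_inP h'] i iI].
    by split; apply/forall_inP => i; rewrite inE => /andP[/h].
  by have [iK|iK] := ltnP i K; [apply: h|apply: h']; rewrite inE iI.
pose w f : int := (weight (i1 ++ i2) f)%:R.
pose q : int := #|F|%:R.
pose M := \sum_(f <- Mon n | f`_0 != 0) w f.
pose Nl := \sum_(f <- Mon n | f`_0 != 0) w f * (fits Il (fixed alpha) f)%:R.
pose Na := \sum_(f <- Mon n | f`_0 != 0) w f * (fits I (fixed alpha) f)%:R.
have bound1 : `|(q ^+ #|Il| * Nl - M)%:~R| * sqrtC #|F|%:R <= (2 * B ^ 2)%:R * (#|F| ^ n)%:R :> algC.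
  apply: int_sqr_bound.
  have := @weighted_edge_equidistribution i1 i2 K 0 Il finset.set0 (fixed alpha) K0.
  rewrite addn0 => /(_ (leq_trans _ D1)) H1.
  have {}H1 := H1 (leq_addr _ _).
  rewrite addn0 in H1; have {H1} := H1 D2' Dn e02.
  move=> /(_ (fun i => _)) H1.
  have ILk i : i \in Il -> (0 < i < K)%N.
    by rewrite inE => /andP[/IKH/orP[|/andP[h1 h2] h3]//]; lia.
  have := H1 ILk; rewrite cards0 expr0 mul1r => H2; have {H1 H2} := H2 _ W1 W2.
  have h0 (i : 'I_n.+1) : i \in finset.set0 -> (n - 0 <= i < n)%N by rewrite inE.
  move=> /(_ h0); congr (_ ^+ 2 * _ <= _).
  rewrite /Nl /M mulr_sumr -sumrB; apply: eq_bigr => f _.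
  have -> : fits finset.set0 (fixed alpha) f by apply/forall_inP => i; rewrite inE.
  by rewrite mul1r mulrBr mulr1 mulrCA.
have bound2 : `|(q ^+ #|Il| * (q ^+ #|Ih| * Na - Nl))%:~R| * sqrtC #|F|%:R <= (2 * B ^ 2)%:R * (#|F| ^ n)%:R :> algC.
  apply: int_sqr_bound.
  (* Reversal sends [n - H <= i < n] to [0 < j < H.+1], hence the successor, and exchanges the low
     and high sets. *)
  have := @weighted_edge_equidistribution i1 i2 H.+1 K (revset Ih) (revset Il)
    (fun i a => alpha (rev_ord i) * a).
  rewrite addnC => H1; have {H1} := H1 isT D1 D2 Dn e02.
  rewrite !card_revset => H1.
  have c1 i : i \in revset Ih -> (0 < i < H.+1)%N.
    case/imsetP => j; rewrite inE => /andP[/IKH/orP[/andP[? ?]|/andP[? ?]] ?] -> /=; lia.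
  have c2 i : i \in revset Il -> (n - K <= i < n)%N.
    case/imsetP => j; rewrite inE => /andP[/IKH/orP[/andP[? ?]|/andP[? ?]] ?] -> /=; lia.
  have := H1 c1 c2 W1 W2; congr ((_ * _) ^+ 2 * _ <= _).
  rewrite /Nl /Na mulr_sumr -sumrB.
  have := sum_weight_reversal (fun f => (fits (revset Il) (fun i a => alpha (rev_ord i) * a) f)%:R *
    (q ^+ #|Ih| * (fits (revset Ih) (fun i a => alpha (rev_ord i) * a) f)%:R - 1)) e0.
  rewrite total_deg_cat Dn => E.
  under eq_bigr => f _ do rewrite mulr_natl.
  rewrite E big_seq_cond [RHS]big_seq_cond; apply: eq_bigr => f /andP[fn f0].
  rewrite !fits_reversal // cndI -[X in X = _]mulr_natl -/(w f).
  by case: (fits Il _ f); case: (fits Ih _ f) => /=; ring.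
have -> : (#|F| ^ #|I|)%:R * (\sum_(f <- Mon n | f`_0 != 0) (weight (i1 ++ i2) f)%:R *
        (fits I (fixed alpha) f)%:R) - \sum_(f <- (Mon n : seq {poly F}) | f`_0 != 0) (weight (i1 ++ i2) f)%:R =
   (q ^+ #|Il| * (q ^+ #|Ih| * Na - Nl))%:~R + (q ^+ #|Il| * Nl - M)%:~R :> algC.
  rewrite -rmorphD /= mulrBr addrA subrK mulrA -exprD -cardI rmorphB rmorphM rmorphXn /=.
  rewrite rmorph_nat natrX /Na /M !rmorph_sum /=; congr (_ * _ - _).
    by apply: eq_bigr => f _; rewrite rmorphM /= !rmorph_nat.
  by apply: eq_bigr => f _; rewrite rmorph_nat.
apply: (@le_trans _ _ ((2 * B ^ 2)%:R * (#|F| ^ n)%:R + (2 * B ^ 2)%:R * (#|F| ^ n)%:R)).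
  apply: le_trans (lerD bound2 bound1); rewrite -mulrDl ler_wpM2r ?sqrtC_ge0 ?ler0n //.
  exact: ler_normD.
by rewrite -mulrDl -natrD -mulnDl lexx.
Qed.
End Edges.

(** * Equidistribution for one list of items *)

Section Items.
Variable F : finFieldType.
Implicit Types (f g p r u w z : {poly F}) (its : seq (nat * nat)).
Variables (n M K : nat).
(** A splitting aimed at degree [K] may overshoot by [M], leaving a second factor of degree at least
    [n - (K + M)]; recurrences are tested only up to this [R], and the indices above it count as
    edge. *)
Let H := (K + M)%N.
Let R := (n - H)%N.
Let B := (n ^ n)%N.
Let q : algC := #|F|%:R.
Let rt : algC := sqrtC q.
Implicit Types (I : {set 'I_n.+1}) (alpha : 'I_n.+1 -> F) (c : {ffun 'I_n.+1 -> F}).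

Definition small_items its :=
  all (fun x : nat * nat => [&& 0 < x.1, 0 < x.2 & x.1 * x.2 <= M])%N its.

Lemma small_items_le_size its : small_items its -> (size its <= total_deg its)%N.
Proof.
elim: its => [|x its IH] //= /andP[/and3P[x1 x2 _] /IH]; rewrite /total_deg /=.
have : (0 < x.1 * x.2)%N by rewrite muln_gt0 x1.
lia.
Qed.

Lemma small_items_exp its : small_items its -> all (fun x => 0 < x.2)%N its.
Proof. by apply: sub_all => x /and3P[]. Qed.

Lemma small_weight_le its f : (0 < n)%N -> small_items its -> (total_deg its <= n)%N ->
  f \in Mon (total_deg its) -> (weight its f <= B)%N.
Proof.
move=> n0 si dn fd.
apply: (leq_trans (weight_le (small_items_exp si) fd dn)).
by rewrite leq_pexp2l // (leq_trans (small_items_le_size si)).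
Qed.

Let q_gt1 : 1 < q.
Proof. by rewrite ltr1n card_finNzRing_gt1. Qed.

Let rt_ge1 : 1 <= rt.
Proof. by rewrite -(@sqrtC1) ler_sqrtC ?qualifE /= ?ler01 ?ltW // (lt_trans ltr01). Qed.

Let rt_gt0 : 0 < rt.
Proof. exact: lt_le_trans ltr01 rt_ge1. Qed.

Let sqr_bound (x : algC) s : 0 <= x ->
  x ^+ 2 * (#|F| ^ s)%:R <= (B * B)%:R ^+ 2 * (#|F| ^ (2 * n))%:R ->
  x <= (B * B)%:R * q ^+ n / rt ^+ s.
Proof.
move=> x0 le2; rewrite ler_pdivlMr ?exprn_gt0 //.
rewrite -(@ler_pXn2r _ 2) ?nnegrE ?mulr_ge0 ?exprn_ge0 ?ler0n ?(ltW rt_gt0) //.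
rewrite exprMn -exprM mulnC exprM sqrtCK exprMn -exprM (mulnC n).
by move: le2; rewrite !(natrX _ #|F|).
Qed.

Lemma fits_fixedE I alpha f : fits I (fixed alpha) f = [forall (i | i \in I), f`_i - alpha i == 0].
Proof. by apply: eq_forallb => i; rewrite subr_eq0. Qed.

Lemma sum_psi_fits I alpha f :
  \sum_(c | supp_in I c) psi (- \sum_i c i * alpha i) * psi (pairing c f) =
  (fits I (fixed alpha) f)%:R * q ^+ #|I|.
Proof.
rewrite fits_fixedE /q -natrX -(sum_psi_supp_in I (fun i => f`_i - alpha i)).
apply: eq_bigr => c _; rewrite -psiD; congr psi.
by rewrite addrC -sumrB; apply: eq_bigr => i _; rewrite mulrBr.
Qed.

(** Only the middle conditions are expanded in characters, so [c = 0] is exactly the edge problem,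
    which contributes the 4. The [K] collects the orders [0 < s < K] and the nonrecurrent case. *)
Lemma items_equidistribution its I alpha :
  (0 < K)%N -> (6 * K + 4 * M + 3 <= n)%N -> (2 * #|I| < K)%N ->
  (forall i, i \in I -> (0 < i < n)%N) -> small_items its -> total_deg its = n ->
  `|q ^+ #|I| * (\sum_(f <- Mon n | f`_0 != 0) (weight its f)%:R *
        (fits I (fixed alpha) f)%:R) - \sum_(f <- (Mon n : seq {poly F}) | f`_0 != 0) (weight its f)%:R|
    * rt <= ((K + 4) * (B * B))%:R * q ^+ n.
Proof.
move=> K0 hn cardI I0n si dn.
have n0 : (0 < n)%N by lia.
have itsM : all (fun x => x.1 * x.2 <= M)%N its by apply: sub_all si => x /and3P[].
pose Im := [set i in I | (K <= i < R)%N].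
pose Ie := [set i in I | ~~ (K <= i < R)%N].
have cardIme : #|I| = (#|Im| + #|Ie|)%N.
  rewrite -(cardsID [set i : 'I_n.+1 | (K <= i < R)%N] I); congr (_ + _)%N;
  by apply: eq_card => i; rewrite !inE // andbC.
have cndI f : fits I (fixed alpha) f = fits Im (fixed alpha) f && fits Ie (fixed alpha) f.
  apply/forall_inP/andP => [h|[/forall_inP h /forall_inP h'] i iI].
    by split; apply/forall_inP => i; rewrite inE => /andP[/h].
  by have [iK|iK] := boolP (K <= i < R)%N; [apply: h|apply: h']; rewrite inE iI.
have IeE i : i \in Ie -> (0 < i < K)%N || (n - H <= i < n)%N.
  by rewrite inE -/R => /andP[/I0n]; lia.
have Ie_mid c (i : 'I_n.+1) : supp_in Ie c -> (K <= i < R)%N -> c i = 0.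
  by move=> /supp_inP cI iKR; apply: cI; rewrite inE iKR andbF.
pose W f : algC := (weight its f)%:R.
pose X c := q ^+ #|Ie| * \sum_(f <- Mon n | f`_0 != 0)
   W f * ((fits Ie (fixed alpha) f)%:R * psi (pairing c f)).
have expand : q ^+ #|I| * (\sum_(f <- Mon n | f`_0 != 0) W f * (fits I (fixed alpha) f)%:R) =
   \sum_(c | supp_in Im c) psi (- \sum_i c i * alpha i) * X c.
  rewrite /X; under [RHS]eq_bigr => c _ do rewrite mulr_sumr mulr_sumr.
  rewrite exchange_big mulr_sumr; apply: eq_bigr => f _ /=.
  rewrite cndI cardIme exprD.
  have -> : \sum_(c | supp_in Im c) psi (- (\sum_i c i * alpha i)) *
     (q ^+ #|Ie| * (W f * ((fits Ie (fixed alpha) f)%:R * psi (pairing c f)))) =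
    (\sum_(c | supp_in Im c) psi (- (\sum_i c i * alpha i)) * psi (pairing c f)) *
     (q ^+ #|Ie| * W f * (fits Ie (fixed alpha) f)%:R).
    by rewrite mulr_suml; apply: eq_bigr => c _; ring.
  rewrite sum_psi_fits -mulnb natrM; ring.
have bsq s : 0 <= (B * B)%:R * q ^+ n / rt ^+ s.
  by rewrite divr_ge0 ?mulr_ge0 ?exprn_ge0 ?ler0n ?(ltW rt_gt0).
have [a1 [a2 [aE aK aKM]]] := split_items itsM (leq_trans (ltac:(lia) : K <= n)%N (eq_leq (esym dn))).
have aD : (total_deg a1 + total_deg a2 = n)%N by rewrite -total_deg_cat -aE.
(* Here [b2] has degree at least [n - (3 * K + 2 * M + 1)], while the edge estimate asks for
   [2 * H.+1 + K = 3 * K + 2 * M + 2]; this is where [6 * K + 4 * M + 3 <= n] comes from. *)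
have [b1 [b2 [bE bT bTM]]] := split_items itsM
  (leq_trans (ltac:(lia) : 2 * K + H + 1 <= n)%N (eq_leq (esym dn))).
have bD : (total_deg b1 + total_deg b2 = n)%N by rewrite -total_deg_cat -bE.
have wtB i1 i2 : its = i1 ++ i2 -> (forall f, f \in Mon (total_deg i1) -> (weight i1 f <= B)%N) /\
   (forall f, f \in Mon (total_deg i2) -> (weight i2 f <= B)%N).
  move=> E; have : (total_deg i1 + total_deg i2 = n)%N by rewrite -total_deg_cat -E.
  move: si; rewrite E /small_items all_cat => /andP[s1 s2] dE.
  by split=> f fd; apply: small_weight_le => //; lia.
have [aW1 aW2] := wtB _ _ aE; have [bW1 bW2] := wtB _ _ bE.
have mid_zero c : supp_in Im c -> recurrent K R 0 c -> c = 0.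
  move=> /supp_inP cI [w [w0 sw relw]]; apply/ffunP => i; rewrite ffunE.
  have [iI|iI] := boolP (i \in Im); last exact: cI.
  have /andP[Ki iR] : (K <= i < R)%N by move: iI; rewrite inE => /andP[].
  have := relw i Ki; rewrite sw addn1 => /(_ iR).
  have /eqP := sw; rewrite -[1%N]/(1%N) => /size_poly1P[t t0 ->].
  by rewrite mulrC mul_polyC pairingZ pairing_Xn => /eqP; rewrite mulf_eq0 (negbTE t0) => /eqP.
have X_rec s c : supp_in Im c -> (0 < s < K)%N -> recurrent K R s c ->
    (forall s', (s' < s)%N -> ~ recurrent K R s' c) ->
    `|X c| <= (B * B)%:R * q ^+ n / rt ^+ s.
  move=> cI s0K recs smin; apply: sqr_bound => //.
  rewrite /X normrM ger0_norm ?exprn_ge0 ?ler0n // /q -natrX /W bE.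
  by apply: (@recurrent_bound F n B b1 b2 c Ie (fixed alpha) K H s) => //; rewrite /H; lia.
(* The saving [rt ^+ K] pays for all characters, so the edge conditions are expanded too. An edge
   part [e] does not disturb nonrecurrence, which only sees the indices in [[K, R)]. *)
have X_norec c : supp_in Im c -> (forall s, (s < K)%N -> ~ recurrent K R s c) ->
    `|X c| <= q ^+ #|Ie| * ((B * B)%:R * q ^+ n / rt ^+ K).
  move=> cI norec.
  have -> : X c = \sum_(e | supp_in Ie e) psi (- \sum_i e i * alpha i) *
      \sum_(f <- Mon n | f`_0 != 0) W f * psi (pairing (c + e) f).
    rewrite /X; under [RHS]eq_bigr => e _ do rewrite mulr_sumr.
    rewrite exchange_big mulr_sumr; apply: eq_bigr => f _ /=.
    have -> : \sum_(e | supp_in Ie e) psi (- (\sum_i e i * alpha i)) * (W f * psi (pairing (c + e) f)) =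
       (\sum_(e | supp_in Ie e) psi (- (\sum_i e i * alpha i)) * psi (pairing e f)) *
        (W f * psi (pairing c f)).
      by rewrite mulr_suml; apply: eq_bigr => e _; rewrite pairingDl psiD; ring.
    by rewrite sum_psi_fits; ring.
  apply: (le_trans (ler_norm_sum _ _ _)).
  apply: (@le_trans _ _ (\sum_(e : {ffun 'I_n.+1 -> F} | supp_in Ie e) ((B * B)%:R * q ^+ n / rt ^+ K))); last first.
    by rewrite sumr_const card_supp_in -[X in X <= _]mulr_natl natrX lexx.
  apply: ler_sum => e eI; rewrite normrM norm_psi mul1r; apply: sqr_bound => //.
  rewrite /W aE; apply: (@nonrecurrent_bound F n B a1 a2 (c + e) K R) => //.
    by rewrite /R /H; lia.
  move=> s sK [w [w0 sw relw]]; apply: (norec s sK); exists w; split=> //.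
  apply: annihilates_congr relw => i iKR; rewrite ffunE (Ie_mid _ _ eI iKR) addr0 //.
(* All orders at which [c] is recurrent are included, not just the minimal one, so that the sums
   over [c] and [s] can be exchanged. *)
pose bnd c := \sum_(s < K | (0 < s)%N) (`[< recurrent K R s c >])%:R * ((B * B)%:R * q ^+ n / rt ^+ s)
   + q ^+ #|Ie| * ((B * B)%:R * q ^+ n / rt ^+ K).
have X_bnd c : supp_in Im c -> c != 0 -> `|X c| <= bnd c.
  move=> cI c0; rewrite /bnd.
  have [ex|nex] := boolP [exists s : 'I_K, `[< recurrent K R s c >]].
    have Pex : exists s : nat, (s < K)%N && `[< recurrent K R s c >].
      by case/existsP: ex => s rs; exists s; rewrite ltn_ord.
    case: (ex_minnP Pex) => s /andP[sK /asboolP rs] smin.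
    have s0 : (0 < s)%N.
      by rewrite lt0n; apply: contra c0 => /eqP s0; rewrite (mid_zero c) // -s0.
    have := @X_rec s c cI; rewrite s0 sK => /(_ isT rs) le.
    apply: (@le_trans _ _ ((B * B)%:R * q ^+ n / rt ^+ s)).
      apply: le => s' s's rs'; have := smin s'; rewrite (ltn_trans s's) //=.
      by move=> /(_ (asboolT rs')); rewrite leqNgt s's.
    rewrite (bigD1 (Ordinal sK)) //= asboolT // mul1r -addrA lerDl addr_ge0 //.
      by apply: sumr_ge0 => i _; rewrite mulr_ge0 ?ler0n.
    by rewrite mulr_ge0 ?exprn_ge0 ?ler0n.
  apply: (le_trans (X_norec c cI _)); last first.
    by rewrite lerDr sumr_ge0 // => i _; rewrite mulr_ge0 ?ler0n.
  move=> s sK rs; case/negP: nex; apply/existsP; exists (Ordinal sK).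
  exact: asboolT.
have rtq m : q ^+ m = rt ^+ (2 * m) by rewrite exprM sqrtCK.
(* Here [rt ^+ a] is the number of characters and [rt ^+ b] the saving; strict inequality of
   exponents leaves a full factor [rt]. *)
have pow_le a b : (a < b)%N -> rt ^+ a * ((B * B)%:R * q ^+ n / rt ^+ b) <= (B * B)%:R * q ^+ n / rt.
  case: b => // b ab; rewrite mulrCA ler_wpM2l ?mulr_ge0 ?exprn_ge0 ?ler0n //.
  by rewrite ler_pdivrMr ?exprn_gt0 // exprS mulKf ?gt_eqF // ler_weXn2l.
have sum_bnd : \sum_(c | supp_in Im c) bnd c <= (K * (B * B))%:R * q ^+ n / rt.
  rewrite big_split /= sumr_const card_supp_in -[X in _ + X <= _]mulr_natl natrX.
  rewrite [X in _ + X <= _]mulrA -exprD -cardIme.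
  rewrite exchange_big /=.
  apply: (@le_trans _ _ (\sum_(s < K | (0 < s)%N) ((B * B)%:R * q ^+ n / rt) + (B * B)%:R * q ^+ n / rt)).
    apply: lerD; last by rewrite (rtq #|I|); apply: pow_le.
    apply: ler_sum => s s0; rewrite -mulr_suml.
    have [b [Kb bR bs]] : exists b, [/\ (K <= b)%N, (b + 2 * s <= R)%N &
        (2 * #|Im :&: window _ b (2 * s)| < s)%N].
      apply: sparse_window => //.
      have ImI : (#|Im| <= #|I|)%N by rewrite cardIme leq_addr.
      (* Hence [(R - K) %/ (2 * s) * s > 2 * K - s > K > 2 * #|I|], as the pigeonhole requires. *)
      have RK : (4 * K <= R - K)%N by rewrite /R /H; lia.
      have := ltn_ord s; have := ltn_ceil (R - K) (ltac:(lia) : 0 < 2 * s)%N.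
      by move: (_ %/ _)%N => t; nia.
    apply: le_trans (pow_le _ _ bs); rewrite ler_wpM2r // -rtq -natrX.
    have := @card_recurrent F n.+1 K R s b Im Kb bR.
    rewrite -(ler_nat algC) => le; apply: le_trans (le _); last first.
      by move=> i; rewrite inE => /andP[].
    rewrite -sum1_card natr_sum [X in X <= _]big_mkcond [X in _ <= X]big_mkcond.
    apply: ler_sum => c _; rewrite unfold_in /=.
    by case: [forall _, _]; case: `[< _ >].
  have -> : (K * (B * B))%:R * q ^+ n / rt = \sum_(s < K) ((B * B)%:R * q ^+ n / rt).
    by rewrite sumr_const card_ord -[RHS]mulr_natl (natrM _ K) !mulrA.
  rewrite [X in _ <= X](bigD1 (Ordinal K0)) //= addrC; apply: lerD => //.
  rewrite [X in _ <= X](eq_bigl (fun s : 'I_K => (0 < s)%N)) // => s.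
  by rewrite -val_eqE /= lt0n.
have X0 : `|X 0 - \sum_(f <- (Mon n : seq {poly F}) | f`_0 != 0) W f| * rt <= (4 * (B * B))%:R * q ^+ n.
  have := @edges_bound F n B b1 b2 Ie alpha K H K0.
  rewrite -bE => H1; have {H1} := H1 (ltac:(lia)) (ltac:(lia)) (ltac:(lia)) bD
    (small_items_exp si) IeE bW1 bW2.
  rewrite mulnn !natrX; congr (`| _ * _ - _| * _ <= _).
  apply: eq_bigr => f _; rewrite /pairing big1 ?psi0 ?mulr1 // => i _.
  by rewrite ffunE mul0r.
rewrite expand (bigD1 (0 : {ffun 'I_n.+1 -> F})) /=; last first.
  by apply/supp_inP => i _; rewrite ffunE.
rewrite [in psi _]big1 ?oppr0 ?psi0 ?mul1r; last by move=> i _; rewrite ffunE mul0r.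
rewrite addrAC; apply: (@le_trans _ _ ((4 * (B * B))%:R * q ^+ n + (K * (B * B))%:R * q ^+ n)); last first.
  by rewrite -mulrDl -natrD -mulnDl addnC lexx.
apply: (le_trans (ler_wpM2r (ltW rt_gt0) (ler_normD _ _))).
rewrite mulrDl; apply: lerD => //; rewrite -ler_pdivlMr //.
apply: le_trans sum_bnd; apply: (le_trans (ler_norm_sum _ _ _)).
rewrite [X in _ <= X](bigD1 (0 : {ffun 'I_n.+1 -> F})) /=; last first.
  by apply/supp_inP => i _; rewrite ffunE.
rewrite -[X in X <= _]add0r; apply: lerD.
  by rewrite addr_ge0 ?sumr_ge0 // => [s _|]; rewrite mulr_ge0 ?exprn_ge0 ?ler0n.
by apply: ler_sum => c /andP[cI c0]; rewrite normrM norm_psi mul1r X_bnd.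
Qed.

End Items.

(** * Smooth polynomials as combinations of weights *)
Section SmoothDecomposition.
Variable F : finFieldType.
Implicit Types (f g h p u w z : {poly F}) (its : seq (nat * nat)).
Variable m : nat.

Lemma irr_divisor_exists f : f \is monic -> f != 1 -> exists2 p, irr p & p %| f.
Proof.
move=> fm f1.
pose P k := `[< exists g, [/\ g \is monic, g %| f, g != 1 & size g = k] >].
have exP : exists k, P k by exists (size f); apply/asboolP; exists f.
case: (ex_minnP exP) => k /asboolP[g [gm gf g1 sg]] kmin.
exists g => //; apply/and3P; split=> //.
  rewrite ltnNge; apply/negP => sg1; case/negP: g1; apply/eqP/monic_size1 => //.
  by apply/eqP; rewrite eqn_leq sg1 size_poly_gt0 monic_neq0.
apply/asboolP => a b am bm E; have [->|a1] := eqVneq a 1; first by left.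
right; apply: monic_size1 => //.
have := kmin (size a); rewrite -sg => /(_ _)/wrap[].
  by apply/asboolP; exists a; split=> //; apply: dvdp_trans gf; rewrite E dvdp_mulr.
rewrite E size_Mmonic ?monic_neq0 //.
have : (0 < size a)%N by rewrite size_poly_gt0 monic_neq0.
have : (0 < size b)%N by rewrite size_poly_gt0 monic_neq0.
by move: (size a) (size b) => x y; lia.
Qed.

Lemma smooth_irrP f : f \is monic ->
  smooth m f <-> (forall p, irr p -> p %| f -> (size p <= m.+1)%N).
Proof.
move=> fm; split=> [H p /irrP[_ ip]|H p ip pf]; first exact: H.
have p0 : p != 0 by apply: contraTneq pf => ->; rewrite dvd0p monic_neq0.
have lp : lead_coef p != 0 by rewrite lead_coef_eq0.
have pp' : (lead_coef p)^-1 *: p %= p by rewrite eqp_scale // invr_eq0.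
rewrite -(eqp_size pp'); apply: H; last by rewrite (eqp_dvdl _ pp').
apply/irrP; split; first by rewrite monicE lead_coefZ mulVf.
split=> [|q sq qp]; first by rewrite (eqp_size pp'); case: ip.
rewrite (eqp_dvdr _ pp') in qp.
by case: ip => _ /(_ q sq qp) qp'; rewrite (eqp_trans qp') // eqp_sym.
Qed.

Lemma smooth1 : smooth m (1 : {poly F}).
Proof.
by move=> p [sp _]; rewrite dvdp1 => /eqP->.
Qed.

Lemma monic_divK p f : p \is monic -> f \is monic -> p %| f -> f %/ p \is monic.
Proof.
move=> pm fm pf; apply: Mon_monic (Mon_div (monic_Mon fm) (monic_Mon pm) pf).
Qed.

Lemma smooth_div p f : p %| f -> smooth m f -> smooth m (f %/ p).
Proof.
move=> pf sf g ig gf; apply: sf => //; apply: dvdp_trans gf _.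
by rewrite -{2}(divpK pf) dvdp_mulr.
Qed.

Lemma smooth_irr_mul p f : irr p -> f \is monic -> (size p <= m.+1)%N -> p %| f ->
  smooth m (f %/ p) -> smooth m f.
Proof.
move=> ip fm sp pf /smooth_irrP H; apply/(smooth_irrP fm) => g ig gf.
have [gp|ngp] := boolP (g %| p); first by rewrite (irr_dvd_irr ig ip gp).
apply: H => //; first by rewrite monic_divK // irr_monic.
by rewrite -(Gauss_dvdpl _ (irr_coprime ig ngp)) divpK.
Qed.

Fixpoint degree_lists r : seq (seq (nat * nat)) :=
  if r is r'.+1 then [seq (d.+1, 1%N) :: l | d <- iota 0 m, l <- degree_lists r'] else [:: [::]].

(** The number of ordered [r]-tuples of monic irreducibles of degree at most [m] with product
    [f]. *)
Definition factorizations r f : nat := (\sum_(l <- degree_lists r) weight l f)%N.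

Definition irr_count f := size [seq p <- Pol m.+1 | irr p && (p %| f)%R].

Lemma sum_irr_degree (C : pred {poly F}) (G : {poly F} -> nat) :
  (\sum_(d <- iota 0 m) \sum_(p <- Mon d.+1 | irr p && C p) G p =
   \sum_(p <- Pol m.+1 | irr p && C p) G p)%N.
Proof.
transitivity (\sum_(d <- iota 0 m) \sum_(p <- Pol m.+1 | irr p && C p) G p * (size p == d.+2))%N.
  rewrite big_seq [RHS]big_seq; apply: eq_bigr => d; rewrite mem_iota add0n => /andP[_ dm].
  rewrite -big_filter [RHS](eq_bigr (fun p => if size p == d.+2 then G p else 0)%N); last first.
    by move=> p _; case: (_ == _); rewrite ?muln1 ?muln0.
  rewrite -big_mkcondr -[RHS]big_filter; apply: perm_big; apply: uniq_perm.
  - exact/filter_uniq/uniq_Mon.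
  - exact/filter_uniq/uniq_Pol.
  move=> p; rewrite !mem_filter mem_Mon mem_Pol.
  case: (boolP (irr p)) => //= /irr_monic ->; case: (C p) => //=.
  by case: eqP => [->|] //=; rewrite ltnS ltnS dm.
rewrite exchange_big big_seq_cond [RHS]big_seq_cond; apply: eq_bigr => p /and3P[pm ip _] /=.
have sp := irr_size ip.
rewrite (bigD1_seq (size p).-2) ?iota_uniq //=; last first.
  by rewrite mem_iota; move: pm; rewrite mem_Pol; move: sp; move: (size p) => k; lia.
have -> : size p == (size p).-2.+2 by move: sp; case: (size p) => // [[]].
rewrite big1 ?addn0 ?muln1 // => d dp; have -> : (size p == d.+2) = false; last by rewrite muln0.
by apply: contraNF dp => /eqP->.
Qed.

Lemma factorizationsS r f :
  factorizations r.+1 f =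
  (\sum_(p <- Pol m.+1 | irr p && (p %| f)%R) factorizations r (f %/ p)%R)%N.
Proof.
rewrite /factorizations [degree_lists _]/= big_allpairs_dep -sum_irr_degree.
apply: eq_bigr => d _; rewrite [RHS]exchange_big.
by apply: eq_bigr => l _; rewrite weight_cons; apply: eq_big => p; rewrite expr1.
Qed.

Lemma factorizations_smooth r f : f \is monic -> (0 < factorizations r f)%N -> smooth m f.
Proof.
elim: r f => [|r IH] f fm.
  rewrite /factorizations /= big_seq1 /weight /=; case: eqP => // <- _; exact: smooth1.
rewrite factorizationsS lt0n sum_nat_seq_neq0 => /hasP[p]; rewrite mem_Pol => sp.
case/andP=> /andP[ip pf] H; apply: (smooth_irr_mul ip) => //.
by apply: IH; [rewrite monic_divK // irr_monic | rewrite lt0n].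
Qed.

Lemma irr_count0 f : f \is monic -> smooth m f -> (irr_count f == 0%N) = (1 == f).
Proof.
move=> fm sf; apply/idP/eqP => [c0|<-].
  apply/eqP; apply: contraTT c0; rewrite eq_sym => f1.
  have [p ip pf] := irr_divisor_exists fm f1.
  rewrite size_eq0 -has_filter; apply/hasP; exists p; last by rewrite ip.
  by rewrite mem_Pol; apply: sf pf; case/irrP: ip.
rewrite size_eq0 -[_ == _]negbK -has_filter; apply/hasP => -[p _ /andP[ip]].
by rewrite dvdp1 gtn_eqF // irr_size.
Qed.

Lemma irr_count_div p f : irr p -> (p %| f) -> (size p <= m.+1)%N ->
  (forall g, irr g -> ~~ (g ^+ 2 %| f)) -> irr_count f = (irr_count (f %/ p)).+1.
Proof.
move=> ip pf sp sqf.
have cnt (h : {poly F}) : irr_count h = (\sum_(g <- Pol m.+1) (irr g && (g %| h)%R))%N.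
  by rewrite /irr_count -sum1_size big_filter big_mkcond; apply: eq_bigr => g _; case: (_ && _).
rewrite !cnt -[RHS]addn1.
have E1 : (\sum_(g <- Pol m.+1) (p == g))%N = 1%N.
  have := @sum_eq_seq _ _ (Pol m.+1) p (fun=> 1%N) (uniq_Pol _ _).
  rewrite mem_Pol sp => /(_ isT) E; rewrite -[RHS]E; apply: eq_bigr => g _.
  by case: (_ == _).
rewrite -[X in (_ + X)%N]E1 -big_split /=; apply: eq_bigr => g _.
have [<-|pg] := eqVneq p g.
  rewrite ip pf /=; have -> : (p %| f %/ p) = false => //.
  apply: contraNF (sqf p ip) => h.
  by rewrite -(divpK pf) expr2 dvdp_mul.
rewrite addn0; case: (boolP (irr g)) => //= ig; congr (nat_of_bool _).
rewrite -{1}(divpK pf) Gauss_dvdpl //; apply: irr_coprime => //.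
by apply: contra pg => gp; rewrite (irr_dvd_irr ig ip gp).
Qed.

(** The ordered factorisations of a squarefree smooth polynomial are the orderings of its
    irreducible divisors. *)
Lemma factorizations_squarefree r f : f \is monic -> smooth m f ->
  (forall g, irr g -> ~~ (g ^+ 2 %| f)) ->
  factorizations r f = (r`! * (r == irr_count f))%N.
Proof.
elim: r f => [|r IH] f fm sf sqf.
  by rewrite eq_sym irr_count0 // /factorizations /= big_seq1 /weight /= fact0 mul1n.
rewrite factorizationsS.
transitivity (\sum_(p <- Pol m.+1 | irr p && (p %| f)%R) r`! * (r.+1 == irr_count f))%N.
  rewrite big_seq_cond [RHS]big_seq_cond; apply: eq_bigr => p /and3P[].
  rewrite mem_Pol => sp ip pf; rewrite (irr_count_div ip pf sp sqf) eqSS IH //.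
  - by rewrite monic_divK // irr_monic.
  - exact: smooth_div.
  - move=> g ig; apply: contra (sqf g ig) => h; apply: dvdp_trans h _.
    by rewrite -{2}(divpK pf) dvdp_mulr.
rewrite -big_filter big_const_seq count_predT iter_addn_0 -/(irr_count f) factS.
by case: eqP => [<-|]; rewrite ?muln0 // !muln1 mulnC.
Qed.

Lemma factorizations_exists k f : f \in Mon k -> smooth m f ->
  exists2 r, (r <= k)%N & (0 < factorizations r f)%N.
Proof.
elim/ltn_ind: k f => k IH f fk sf; have fm := Mon_monic fk.
have [f1|f1] := eqVneq f 1.
  by exists 0%N => //; rewrite /factorizations /= big_seq1 /weight /= f1 eqxx.
have [p ip pf] := irr_divisor_exists fm f1.
have pm := irr_monic ip; have sp := irr_size ip.
have sk : (size p <= k.+1)%N.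
  by rewrite -(Mon_size fk) dvdp_leq // monic_neq0.
have [|r rk r0] := IH (k - (size p).-1)%N _ (f %/ p) (Mon_div fk (monic_Mon pm) pf) (smooth_div pf sf).
  lia.
exists r.+1; first by lia.
rewrite factorizationsS lt0n sum_nat_seq_neq0; apply/hasP; exists p.
  by rewrite mem_Pol; apply: sf pf; case/irrP: ip.
by rewrite ip pf -lt0n.
Qed.

Lemma mem_degree_lists r l : l \in degree_lists r ->
  [/\ small_items (2 * m) l, size l = r & total_deg l = sumn [seq x.1 | x <- l]].
Proof.
elim: r l => [|r IH] l; first by rewrite inE => /eqP->.
case/allpairsPdep => d [l' [dm /IH[sl' szl' dl'] ->]].
move: dm; rewrite mem_iota => dm; split=> /=; last 2 first.
- by rewrite szl'.
- by rewrite /total_deg /= muln1 -dl'.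
by rewrite -/(small_items _ _) sl' andbT /= muln1; lia.
Qed.

(** Exponents do not enter the bound: a squared irreducible of degree [d] uses degree [2 * d] but
    offers only [q ^ d] choices, which makes [square_weight] small on average. *)
Lemma sum_factored_mass its :
  (sum_factored its (fun _ : {poly F} => 1%N) <= #|F| ^ sumn [seq x.1 | x <- its])%N.
Proof.
elim: its => [|[d e] its IH] //=; rewrite expnD.
apply: (@leq_trans (\sum_(p <- Mon d : seq {poly F}) #|F| ^ sumn [seq x.1 | x <- its])%N).
  rewrite [X in (X <= _)%N]big_mkcond; apply: leq_sum => p _; by case: ifP.
by rewrite big_const_seq count_predT iter_addn_0 size_Mon mulnC.
Qed.

Section ErrorTerm.
Variable n : nat.
Hypothesis n_gt0 : (0 < n)%N.

(** It equals [n]![on squarefree smooth polynomials and 0 on nonsmooth ones. The factor]n[!] keeps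
    the coefficients [1 / r!] integral, the divisions being exact for [r <= n]. *)
Definition main_weight f : nat := (\sum_(r < n.+1) n`! %/ r`! * factorizations r f)%N.

(* Dominates the smooth polynomials that are not squarefree, for which [main_weight] is off. *)
Definition square_weight f : nat :=
  (\sum_(d <- iota 0 m) \sum_(r < n.+1) \sum_(l <- degree_lists r) weight ((d.+1, 2) :: l) f)%N.

Definition list_count : nat := (\sum_(r < n.+1) size (degree_lists r))%N.

Definition error_const : nat := (n`! + n`! * (n ^ n * list_count))%N.

Lemma main_weight_le f : f \in Mon n -> (main_weight f <= error_const)%N.
Proof.
move=> fn; apply: (leq_trans _ (leq_addl _ _)).
rewrite /main_weight /list_count mulnA big_distrr /=; apply: leq_sum => r _.
rewrite -mulnA leq_mul ?leq_div //.
rewrite mulnC -[size _]muln1 -sum1_size big_distrl /= /factorizations -big_distrl /=.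
rewrite sum1_size muln1 mulnC.
apply: (@leq_trans (\sum_(l <- degree_lists r) n ^ n)%N); last first.
  by rewrite big_const_seq count_predT iter_addn_0.
rewrite big_seq [X in (_ <= X)%N]big_seq; apply: leq_sum => l /mem_degree_lists[sl szl _].
apply: (leq_trans (weight_le (small_items_exp sl) fn (leqnn n))).
by rewrite leq_pexp2l // szl -ltnS.
Qed.

Lemma square_weight_ge1 f g : f \in Mon n -> smooth m f -> irr g -> g ^+ 2 %| f ->
  (0 < square_weight f)%N.
Proof.
move=> fn sf ig g2f; have fm := Mon_monic fn; have gm := irr_monic ig.
have gf : g %| f by apply: dvdp_trans g2f; rewrite expr2 dvdp_mulr.
have sg : (size g <= m.+1)%N by apply: sf gf; case/irrP: ig.
have sg1 := irr_size ig.
have gM : g \in Mon (size g).-2.+1.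
  by rewrite mem_Mon gm; apply/eqP; move: sg1; move: (size g) => k; lia.
have hM := Mon_div fn (MonX 2 gM) g2f.
have [r rn] := factorizations_exists hM (smooth_div g2f sf).
rewrite lt0n sum_nat_seq_neq0 => /hasP[l lr /= w0].
have rn' : (r < n.+1)%N by rewrite ltnS (leq_trans rn) // leq_subr.
rewrite lt0n sum_nat_seq_neq0; apply/hasP; exists (size g).-2.
  by rewrite mem_iota; move: sg sg1; move: (size g) => k; lia.
rewrite /= -lt0n (bigD1 (Ordinal rn')) //= ltn_addr // lt0n sum_nat_seq_neq0.
apply/hasP; exists l => //=; rewrite -lt0n (weight_cons (size g).-2.+1 2 l f).
rewrite big_mkcond (bigD1_seq g) ?uniq_Mon //= ig g2f ltn_addr // lt0n.
by [].
Qed.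

Lemma smooth_weight_error f : f \in Mon n ->
  (n`! * `[< smooth m f >] <= main_weight f + error_const * square_weight f)%N /\
  (main_weight f <= n`! * `[< smooth m f >] + error_const * square_weight f)%N.
Proof.
move=> fn; have fm := Mon_monic fn.
case: (boolP `[< smooth m f >]) => [/asboolP sf|/asboolP nsf]; last first.
  rewrite muln0; split=> //; rewrite add0n.
  rewrite (_ : main_weight f = 0%N) //; apply: big1 => r _.
  apply/eqP; rewrite muln_eq0; apply/orP; right; rewrite -leqn0 leqNgt.
  by apply/negP => /(factorizations_smooth fm).
case: (pselect (exists2 g, irr g & g ^+ 2 %| f)) => [[g ig g2f]|nsq].
  have := square_weight_ge1 fn sf ig g2f; have := main_weight_le fn.
  have : (n`! <= error_const)%N by rewrite /error_const leq_addr.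
  by rewrite muln1; move: (main_weight f) (square_weight f) error_const n`! => a b c d; nia.
have sqf g : irr g -> ~~ (g ^+ 2 %| f).
  by move=> ig; apply/negP => g2f; apply: nsq; exists g.
have cn : (irr_count f < n.+1)%N.
  rewrite -(Mon_size fn); apply: size_irr_divisors; first exact: monic_neq0.
    exact/filter_uniq/uniq_Pol.
  by move=> p; rewrite mem_filter => /andP[].
have -> : main_weight f = n`!.
  rewrite /main_weight (bigD1 (Ordinal cn)) //= factorizations_squarefree // eqxx muln1.
  rewrite divnK; last first.
    by rewrite -(bin_fact (cn : irr_count f <= n)%N) dvdn_mull // dvdn_mulr.
  rewrite big1 ?addn0 // => r rc; rewrite factorizations_squarefree //.
  have -> : (val r == irr_count f) = false by apply: contraNF rc => /eqP E; apply/eqP/val_inj.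
  by rewrite !muln0.
by rewrite muln1 leq_addr.
Qed.

End ErrorTerm.
End SmoothDecomposition.

(** * Equidistribution of smooth polynomials not vanishing at 0 *)

Lemma leq_sum_const (T : eqType) (s : seq T) (G : T -> nat) b :
  {in s, forall x, G x <= b}%N -> (\sum_(x <- s) G x <= size s * b)%N.
Proof.
move=> Gb; rewrite mulnC -iter_addn_0 -(count_predT s) -big_const_seq.
by rewrite big_seq [X in (_ <= X)%N]big_seq; apply: leq_sum.
Qed.

Section SmoothEquidistribution.
Variable F : finFieldType.
Implicit Types (f g p : {poly F}) (l : seq (nat * nat)).
Variables m n : nat.
Hypothesis m_gt0 : (0 < m)%N.
Hypothesis mn : (100 * m <= n)%N.
Variables (I : {set 'I_n.+1}) (alpha : 'I_n.+1 -> F).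
Hypothesis I_small : (24 * #|I| < n)%N.
Hypothesis I_mid : forall i, i \in I -> (0 < i < n)%N.

Let q : algC := #|F|%:R.
Let rt : algC := sqrtC q.
Let J f := fits I (fixed alpha) f.

(** Linear in [w], so it passes through the decomposition into weights. *)
Definition discrepancy (w : {poly F} -> nat) : algC :=
  q ^+ #|I| * (\sum_(f <- Mon n | (f`_0 != 0)%R) w f * J f)%N%:R -
  (\sum_(f <- (Mon n : seq {poly F}) | (f`_0 != 0)%R) w f)%N%:R.

(* The values [n %/ 12 + 1] and [2 * m] instantiate [K] and [M] of [items_equidistribution];
   item degrees reach [2 * m] because of the squared factor in [square_weight]. *)
Definition item_const : nat := ((n %/ 12 + 1 + 4) * (n ^ n * n ^ n))%N.

Let rt_ge0 : 0 <= rt. Proof. by rewrite sqrtC_ge0 ler0n. Qed.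

Lemma discrepancy_sum (T : Type) (s : seq T) (w : T -> {poly F} -> nat) :
  discrepancy (fun f => \sum_(x <- s) w x f)%N = \sum_(x <- s) discrepancy (w x).
Proof.
rewrite /discrepancy sumrB -mulr_sumr; congr (_ * _ - _).
  rewrite -natr_sum; congr (_%:R); rewrite exchange_big /=.
  by apply: eq_bigr => f _; rewrite big_distrl.
by rewrite -natr_sum; congr (_%:R); rewrite exchange_big.
Qed.

Lemma discrepancy_mul a (w : {poly F} -> nat) :
  discrepancy (fun f => a * w f)%N = a%:R * discrepancy w.
Proof.
rewrite /discrepancy mulrBr mulrCA -!natrM !big_distrr /=; congr (_ * _%:R - _).
by apply: eq_bigr => f _; rewrite mulnA.
Qed.

Lemma discrepancy_list l : small_items (2 * m) l ->
  `|discrepancy (weight l)| * rt <= item_const%:R * q ^+ n.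
Proof.
move=> sl; have [dl|dl] := eqVneq (total_deg l) n; last first.
  rewrite /discrepancy !big1_seq ?mulr0 ?subr0 ?normr0 ?mul0r ?mulr_ge0 ?exprn_ge0 ?ler0n //.
    move=> f /andP[_ fn]; apply: weight_notin; apply: contra dl; rewrite !mem_Mon.
    by move: (Mon_size fn) => -> /andP[_]; rewrite eqSS eq_sym.
  move=> f /andP[_ fn]; rewrite weight_notin //; apply: contra dl; rewrite !mem_Mon.
  by move: (Mon_size fn) => -> /andP[_]; rewrite eqSS eq_sym.
have := @items_equidistribution F n (2 * m) (n %/ 12 + 1) l I alpha.
move=> /(_ (ltac:(lia)) (ltac:(lia)) (ltac:(lia)) I_mid sl dl).
rewrite /discrepancy !natr_sum; congr (`|_ * _ - _| * _ <= _).
by apply: eq_bigr => f _; rewrite natrM.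
Qed.

Let n_gt0 : (0 < n)%N. Proof. by lia. Qed.

Lemma discrepancy_main :
  `|discrepancy (main_weight m n)| * rt <= (n`! * (list_count m n * item_const))%:R * q ^+ n.
Proof.
rewrite /main_weight discrepancy_sum.
under eq_bigr => r _ do rewrite discrepancy_mul /factorizations discrepancy_sum.
apply: (le_trans (ler_wpM2r rt_ge0 (ler_norm_sum _ _ _))).
rewrite mulr_suml /list_count big_distrl big_distrr /= natr_sum mulr_suml.
apply: ler_sum => r _.
rewrite normrM normr_nat -mulrA natrM -mulrA.
apply: ler_pM; rewrite ?ler0n ?mulr_ge0 ?ler_nat ?leq_div //.
apply: (le_trans (ler_wpM2r rt_ge0 (ler_norm_sum _ _ _))).
rewrite mulr_suml natrM -mulrA -sumr_seq_const.
rewrite big_seq [X in _ <= X]big_seq; apply: ler_sum => l /mem_degree_lists[sl _ _].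
exact: discrepancy_list.
Qed.

Lemma square_items r d l : l \in degree_lists m r -> d \in iota 0 m ->
  small_items (2 * m) ((d.+1, 2) :: l).
Proof.
move=> /mem_degree_lists[sl _ _]; rewrite mem_iota => dm.
by rewrite /small_items /= -/(small_items _ _) sl andbT; lia.
Qed.

Lemma discrepancy_square :
  `|discrepancy (square_weight m n)| * rt <= (m * (list_count m n * item_const))%:R * q ^+ n.
Proof.
rewrite /square_weight discrepancy_sum.
under eq_bigr => d _ do rewrite discrepancy_sum.
under eq_bigr => d _ do under eq_bigr => r _ do rewrite discrepancy_sum.
apply: (le_trans (ler_wpM2r rt_ge0 (ler_norm_sum _ _ _))).
have -> : (m * (list_count m n * item_const))%:R * q ^+ n =
    \sum_(d <- iota 0 m) ((list_count m n * item_const)%:R * q ^+ n).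
  by rewrite sumr_seq_const size_iota natrM mulrA.
rewrite mulr_suml big_seq [X in _ <= X]big_seq; apply: ler_sum => d dm.
apply: (le_trans (ler_wpM2r rt_ge0 (ler_norm_sum _ _ _))).
rewrite mulr_suml /list_count big_distrl /= natr_sum mulr_suml; apply: ler_sum => r _.
apply: (le_trans (ler_wpM2r rt_ge0 (ler_norm_sum _ _ _))).
rewrite mulr_suml natrM -mulrA -sumr_seq_const.
rewrite big_seq [X in _ <= X]big_seq; apply: ler_sum => l lr.
by apply: discrepancy_list; apply: square_items lr dm.
Qed.

(** In total degree [n] the squared item leaves at most [n - 1] for the sum of the degrees of the
    irreducibles. *)
Lemma sum_square_weight :
  (\sum_(f <- (Mon n : seq {poly F}) | (f`_0 != 0)%R) square_weight m n f
    <= m * (list_count m n * #|F| ^ n.-1))%N.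
Proof.
apply: (@leq_trans (\sum_(f <- (Mon n : seq {poly F})) square_weight m n f)%N).
  by rewrite big_mkcond; apply: leq_sum => f _; case: ifP.
rewrite /square_weight exchange_big /=.
rewrite -[X in (_ <= X * _)%N](size_iota 0 m); apply: leq_sum_const => d dm.
rewrite exchange_big /= /list_count big_distrl; apply: leq_sum => r _ /=.
rewrite exchange_big; apply: leq_sum_const => l lr.
have [dl|dl] := eqVneq (total_deg ((d.+1, 2) :: l)) n; last first.
  rewrite big1_seq // => f /andP[_ fn]; apply: weight_notin; apply: contra dl; rewrite !mem_Mon.
  by move: (Mon_size fn) => -> /andP[_]; rewrite eqSS eq_sym.
apply: (@leq_trans (#|F| ^ sumn [seq x.1 | x <- (d.+1, 2) :: l])).
  have := sum_factored_mass F ((d.+1, 2) :: l); rewrite sum_factoredE dl; apply: leq_trans.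
  rewrite leq_eqVlt; apply/orP; left; apply/eqP; apply: eq_bigr => f _.
  by elim: (weight _ f) => // k IH; rewrite mulrS -IH.
have [_ _ E] := mem_degree_lists lr; rewrite leq_exp2l ?card_finNzRing_gt1 //=.
have : (d.+1 * 2 + total_deg l = n)%N := dl.
rewrite (_ : sumn _ = total_deg l); last exact: esym.
by move: (total_deg l) => k; lia.
Qed.

Definition smooth_const : nat :=
  (n`! * (list_count m n * item_const) +
   error_const m n * (m * (list_count m n * item_const) + 2 * (m * list_count m n)))%N.

Lemma natr_dist_le (a b c : nat) : (a <= b + c)%N -> (b <= a + c)%N ->
  `|a%:R - b%:R| <= c%:R :> algC.
Proof.
move=> ab ba; have [le|/ltnW le] := leqP a b.
  by rewrite distrC -natrB // normr_nat ler_nat leq_subLR.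
by rewrite -natrB // normr_nat ler_nat leq_subLR.
Qed.

(** The pointwise error is at most a multiple of [square_weight], but its sum over [J] comes with
    the factor [q ^+ #|I|]. Writing that sum as the discrepancy of [square_weight] plus its total
    mass bounds it: the former by equidistribution, the latter by [q ^ n.-1]. *)
Lemma discrepancy_smooth :
  `|discrepancy (fun f => `[< smooth m f >])| * rt <= smooth_const%:R * q ^+ n.
Proof.
set sm := fun f : {poly F} => nat_of_bool _.
set e := error_const m n.
have q1 : 1 < q by rewrite ltr1n card_finNzRing_gt1.
have rtq : rt * rt = q by rewrite -expr2 sqrtCK.
have rt1 : 1 <= rt.
  by rewrite -(@sqrtC1) ler_sqrtC ?qualifE /= ?ler01 ?ltW // (lt_trans ltr01).
have diff : `|discrepancy (fun f => n`! * sm f)%N - discrepancy (main_weight m n)| <=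
    e%:R * (discrepancy (square_weight m n) +
     2 * (\sum_(f <- (Mon n : seq {poly F}) | (f`_0 != 0)%R) square_weight m n f)%N%:R).
  rewrite /discrepancy.
  set N1 := (\sum_(_ <- _ | _) _ * _)%N; set M1 := (\sum_(_ <- _ | _) _)%N.
  set N2 := (\sum_(_ <- _ | _) _ * _)%N; set M2 := (\sum_(_ <- _ | _) _)%N.
  set N3 := (\sum_(_ <- _ | _) _ * _)%N; set M3 := (\sum_(_ <- _ | _) _)%N.
  have NN : `|N1%:R - N2%:R| <= (e * N3)%:R :> algC.
    apply: natr_dist_le; rewrite /N1 /N2 /N3 big_distrr -big_split /= big_seq_cond
      [X in (_ <= X)%N]big_seq_cond; apply: leq_sum => f /andP[fn _];
    have [h1 h2] := smooth_weight_error m n_gt0 fn; rewrite mulnA -mulnDl leq_mul //.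
  have MM : `|M1%:R - M2%:R| <= (e * M3)%:R :> algC.
    apply: natr_dist_le; rewrite /M1 /M2 /M3 big_distrr -big_split /= big_seq_cond
      [X in (_ <= X)%N]big_seq_cond; apply: leq_sum => f /andP[fn _];
    by have [h1 h2] := smooth_weight_error m n_gt0 fn.
  have -> : q ^+ #|I| * N1%:R - M1%:R - (q ^+ #|I| * N2%:R - M2%:R) =
     q ^+ #|I| * (N1%:R - N2%:R) - (M1%:R - M2%:R) by ring.
  apply: (le_trans (ler_normB _ _)); rewrite normrM ger0_norm ?exprn_ge0 ?ler0n //.
  apply: (@le_trans _ _ (q ^+ #|I| * (e * N3)%:R + (e * M3)%:R)).
    by apply: lerD => //; rewrite ler_wpM2l // exprn_ge0 ?ler0n.
  by rewrite !natrM le_eqVlt; apply/orP; left; apply/eqP; ring.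
have mass : (\sum_(f <- (Mon n : seq {poly F}) | (f`_0 != 0)%R) square_weight m n f)%N%:R * rt <=
   (m * list_count m n)%:R * q ^+ n :> algC.
  apply: (@le_trans _ _ ((m * (list_count m n * #|F| ^ n.-1))%:R * q)).
    apply: ler_pM; rewrite ?ler0n ?ler_nat ?sum_square_weight //.
    by rewrite -rtq ler_peMr.
  by rewrite -(prednK n_gt0) [q ^+ _]exprSr mulnA natrM natrX mulrA lexx.
have main : `|discrepancy (fun f => n`! * sm f)%N| * rt <= smooth_const%:R * q ^+ n.
  have := lerD diff (le_refl `|discrepancy (main_weight m n)|).
  move=> /(le_trans (ler_normD _ _)); rewrite subrK => le1.
  apply: (le_trans (ler_wpM2r rt_ge0 le1)).
  rewrite mulrDl /smooth_const natrD [X in _ <= X]mulrDl [X in _ <= X]addrC; apply: lerD; last exact: discrepancy_main.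
  rewrite -[X in X <= _]mulrA natrM -[X in _ <= X]mulrA ler_wpM2l ?ler0n //.
  rewrite [X in X <= _]mulrDl natrD [X in _ <= X]mulrDl; apply: lerD.
    apply: le_trans discrepancy_square; apply: ler_wpM2r => //; apply: real_ler_norm.
    by rewrite /discrepancy rpredB ?rpredM ?rpredX ?realn.
  by rewrite natrM -!mulrA ler_wpM2l ?ler0n.
apply: le_trans main; rewrite discrepancy_mul normrM normr_nat -mulrA.
by rewrite ler_peMl ?mulr_ge0 // ler1n fact_gt0.
Qed.

End SmoothEquidistribution.

(** * Conclusion *)
Section Counting.
Variable F : finFieldType.
Implicit Types (f g p : {poly F}).

Lemma card_fset_set_seq (A : set {poly F}) (s : seq {poly F}) :
  finite_set A -> uniq s -> (forall f, f \in s <-> A f) -> #|` fset_set A| = size s.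
Proof.
move=> fA us As; apply: perm_size; apply: uniq_perm => //.
move=> f; rewrite in_fset_set //; apply/idP/idP; first by rewrite inE => /As.
by move=> fs; rewrite inE; apply/As.
Qed.

Lemma monicsP n f : monics F n f <-> f \in Mon n.
Proof.
rewrite mem_Mon; split=> [[-> ->]|/andP[fm /eqP sf]]; first by rewrite eqxx.
by split.
Qed.

Lemma Psi_size n m : Psi F n m = size [seq f : {poly F} <- Mon n | `[< smooth m f >]].
Proof.
rewrite /Psi; apply: card_fset_set_seq.
- exact: finite_smooths.
- exact/filter_uniq/uniq_Mon.
move=> f; rewrite mem_filter; split=> [/andP[/asboolP sf fn]|[fn sf]].
  by split=> //; apply/monicsP.
by rewrite asboolT //; apply/monicsP.
Qed.

Definition linear_product (A : {set F}) : {poly F} := \prod_(a in A) ('X - a%:P).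

Lemma linear_product_Mon A : linear_product A \in Mon #|A|.
Proof.
rewrite mem_Mon /linear_product monic_prod_XsubC /=.
by rewrite -big_enum size_prod_XsubC cardE.
Qed.

Lemma linear_product_smooth A m : (0 < m)%N -> smooth m (linear_product A).
Proof.
move=> m0; apply/smooth_irrP; first exact: Mon_monic (linear_product_Mon A).
move=> p ip pA; rewrite leqNgt; apply/negP => sp.
have : coprimep p (linear_product A).
  rewrite /linear_product; apply: (big_ind (fun g => coprimep p g)).
  - exact: coprimep1.
  - by move=> g h pg ph; rewrite coprimepMr pg.
  move=> a _; apply: irr_coprime => //; apply/negP => /dvdp_leq.
  rewrite polyXsubC_eq0 size_XsubC => /(_ isT) sp2.
  by have := leq_trans sp sp2; rewrite ltnS ltnS leqNgt m0.
move=> cp; have := coprimep_dvdl pA cp; rewrite coprimepp => /eqP s1.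
by have := irr_size ip; rewrite s1.
Qed.

Lemma linear_product_inj : injective linear_product.
Proof.
move=> A A' E; apply/setP => a.
have root_in (D : {set F}) : root (linear_product D) a = (a \in D).
  rewrite /linear_product -big_enum root_prod_XsubC mem_enum //.
by rewrite -!root_in E.
Qed.

(** The sets of [n] elements of [F] give distinct smooth polynomials as products of linear factors.
    This lower bound turns absolute errors into relative ones. *)
Lemma bin_le_Psi n m : (0 < m)%N -> ('C(#|F|, n) <= Psi F n m)%N.
Proof.
move=> m0; rewrite Psi_size -card_draws cardE -(size_map linear_product).
apply: uniq_leq_size; first by rewrite map_inj_uniq ?enum_uniq //; exact: linear_product_inj.
move=> f /mapP[A]; rewrite mem_enum inE => /eqP sA ->.
rewrite mem_filter asboolT /=; last exact: linear_product_smooth.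
by have := linear_product_Mon A; rewrite sA.
Qed.

Lemma expn_le_Psi n m : (0 < m)%N -> (2 * n <= #|F|)%N ->
  (#|F| ^ n <= 2 ^ n * n`! * Psi F n m)%N.
Proof.
move=> m0 nF; apply: (@leq_trans (2 ^ n * n`! * 'C(#|F|, n))); last first.
  by rewrite leq_mul // bin_le_Psi.
rewrite -mulnA [(n`! * _)%N]mulnC bin_ffact ffact_prod.
rewrite -[X in (X ^ n)%N](card_ord #|F|) card_ord.
have -> : (#|F| ^ n = \prod_(i < n) #|F|)%N by rewrite prod_nat_const card_ord.
have -> : (2 ^ n = \prod_(i < n) 2)%N by rewrite prod_nat_const card_ord.
rewrite -big_split /=; apply: leq_prod => i _; have := ltn_ord i.
by move: nF; move: #|F| => k; lia.
Qed.

(** Disposes of the polynomials vanishing at 0, which the weighted sums omit: here all conditions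
    are low ones with cofactor [g = 1], so they are met with their full density. *)
Lemma count_zero_constant n (I : {set 'I_n.+1}) (th : 'I_n.+1 -> F -> F) : (0 < n)%N ->
  (forall i, i \in I -> (0 < i < n)%N) ->
  (#|F| ^ #|I| * size [seq f : {poly F} <- Mon n | (f`_0 == 0)%R && fits I th f] <= #|F| ^ n.-1)%N.
Proof.
move=> n0 In.
have := @count_fits_Pol F n.+1 I th n 0 0 n.-1 'X^n 1 n0.
rewrite addn0 prednK // leqnn coef1 oner_eq0 size_poly1 => /(_ isT isT (erefl _)).
move=> /(_ (fun i iI => introT orP (or_introl (In i iI)))).
rewrite natr_size_filter -natrM => /eqP; rewrite eqr_nat => /eqP <-.
rewrite leq_mul2l; apply/orP; right.
rewrite -[X in (_ <= X)%N](size_map (fun z => 'X^n + 'X * z * 1)).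
apply: uniq_leq_size; first exact/filter_uniq/uniq_Mon.
move=> f; rewrite mem_filter => /andP[/andP[/eqP f0 cf] fn].
have E : f = 'X^n + 'X * drop_poly 1 (f - 'X^n) * 1.
  rewrite mulr1; apply/polyP => -[|i]; rewrite coefD coefXM /=.
    by rewrite coefXn f0 eq_sym gtn_eqF // addr0.
  by rewrite coef_drop_poly coefB addn1 addrC subrK.
apply/mapP; exists (drop_poly 1 (f - 'X^n)); last exact: E.
rewrite mem_filter -E cf mem_Pol size_drop_poly.
have : (size (f - 'X^n)%R <= n)%N.
  apply/leq_sizeP => j; rewrite leq_eqVlt => /predU1P[<-|nj]; rewrite coefB coefXn.
    by rewrite eqxx (Mon_coef fn) subrr.
  by rewrite nth_default ?(Mon_size fn) // gtn_eqF // subrr.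
by move: (size _) => k; lia.
Qed.

Lemma natr_dist (V : numDomainType) (a b : nat) :
  `|a%:R - b%:R| = ((a - b) + (b - a))%N%:R :> V.
Proof.
have [le|/ltnW le] := leqP a b.
  by rewrite distrC -natrB // normr_nat (eqP le).
by rewrite -natrB // normr_nat (eqP le) addn0.
Qed.

(** Squared and stated in [nat], so that an estimate obtained in [algC] can be used over the reals.
    One of the truncated differences in [d] is 0, so [d] is the absolute difference. *)
Lemma smooth_count_bound n m (I : {set 'I_n.+1}) (alpha : 'I_n.+1 -> F) (d : nat) :
  (0 < m)%N -> (100 * m <= n)%N -> (24 * #|I| < n)%N ->
  (forall i, i \in I -> (0 < i < n)%N) ->
  let A := size [seq f : {poly F} <- Mon n | `[< smooth m f >] && fits I (fixed alpha) f] in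
  d = (#|F| ^ #|I| * A - Psi F n m + (Psi F n m - #|F| ^ #|I| * A))%N ->
  (d ^ 2 * #|F| <= ((smooth_const m n + 2) * #|F| ^ n) ^ 2)%N.
Proof.
move=> m0 mn I24 In A dE; have n0 : (0 < n)%N by lia.
pose sm f := nat_of_bool `[< smooth m f >].
pose q : algC := #|F|%:R; pose rt : algC := sqrtC q.
have q1 : 1 < q by rewrite ltr1n card_finNzRing_gt1.
have rtq : rt * rt = q by rewrite -expr2 sqrtCK.
have rt1 : 1 <= rt.
  by rewrite -(@sqrtC1) ler_sqrtC ?qualifE /= ?ler01 ?ltW // (lt_trans ltr01).
have rt0 : 0 <= rt by apply: le_trans rt1.
pose A0 := size [seq f : {poly F} <- Mon n | (f`_0 == 0)%R && fits I (fixed alpha) f].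
pose Psi0 := size [seq f : {poly F} <- Mon n | (f`_0 == 0)%R && fits finset.set0 (fixed alpha) f].
pose N := (\sum_(f <- Mon n | (f`_0 != 0)%R) sm f * fits I (fixed alpha) f)%N.
pose M := (\sum_(f <- Mon n | (f`_0 != 0)%R) sm f)%N.
have splitN (G : {poly F} -> bool) :
    (\sum_(f <- Mon n | (f`_0 != 0)%R) (G f) <= size (seq.filter G (Mon n)))%N /\
    (size (seq.filter G (Mon n)) <= \sum_(f <- Mon n | (f`_0 != 0)%R) (G f) +
      size [seq f : {poly F} <- Mon n | (f`_0 == 0)%R && G f])%N.
  rewrite -!sum1_size !big_filter.
  rewrite [X in (X <= _)%N /\ _]big_mkcond [X in (_ <= X)%N /\ _]big_mkcond.
  rewrite [X in _ /\ (X <= _)%N]big_mkcond [X in _ /\ (_ <= X + _)%N]big_mkcond.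
  rewrite [X in _ /\ (_ <= _ + X)%N]big_mkcond -big_split /=.
  by split; apply: leq_sum => f _; case: (f`_0 == 0); case: (G f).
have NE : N = (\sum_(f <- Mon n | (f`_0 != 0)%R) (`[< smooth m f >] && fits I (fixed alpha) f))%N.
  by apply: eq_bigr => f _; rewrite -mulnb.
have [N1 N2] := splitN (fun f => `[< smooth m f >] && fits I (fixed alpha) f).
have [M1 M2] := splitN (fun f => `[< smooth m f >]).
have A0le : (#|F| ^ #|I| * A0 <= #|F| ^ n.-1)%N by apply: count_zero_constant.
have P0le : (Psi0 <= #|F| ^ n.-1)%N.
  have := @count_zero_constant n finset.set0 (fixed alpha) n0; rewrite cards0 mul1n; apply.
  by move=> i; rewrite inE.
have NA : (N <= A)%N by rewrite NE.
have AN : (A <= N + A0)%N.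
  rewrite NE; apply: (leq_trans N2); rewrite leq_add2l /A0 -!sum1_size !big_filter.
  rewrite big_mkcond [X in (_ <= X)%N]big_mkcond; apply: leq_sum => f _.
  by case: (_ == _); case: `[< _ >]; case: (fits _ _ _).
have MP : (M <= Psi F n m)%N by rewrite Psi_size.
have PM : (Psi F n m <= M + Psi0)%N.
  rewrite Psi_size; apply: (leq_trans M2); rewrite leq_add2l /Psi0 -!sum1_size !big_filter.
  rewrite big_mkcond [X in (_ <= X)%N]big_mkcond; apply: leq_sum => f _.
  have -> : fits finset.set0 (fixed alpha) f by apply/forall_inP => i; rewrite inE.
  by case: (_ == _); case: `[< _ >].
have disc := @discrepancy_smooth F m n m0 mn I alpha I24 In.
have q0 : 0 <= q by rewrite ler0n.
have dq : d%:R * rt <= (smooth_const m n + 2)%:R * q ^+ n.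
  have dle : d%:R <= `|(#|F| ^ #|I| * N)%:R - M%:R| + (#|F| ^ n.-1 + #|F| ^ n.-1)%:R :> algC.
    rewrite natr_dist -natrD ler_nat dE.
    have : (#|F| ^ #|I| * N <= #|F| ^ #|I| * A)%N by rewrite leq_mul2l NA orbT.
    have : (#|F| ^ #|I| * A <= #|F| ^ #|I| * N + #|F| ^ #|I| * A0)%N.
      by rewrite -mulnDr leq_mul2l AN orbT.
    move: A0le P0le MP PM; move: (#|F| ^ #|I| * N)%N (#|F| ^ #|I| * A)%N (#|F| ^ #|I| * A0)%N.
    by move: (#|F| ^ n.-1)%N (Psi F n m) => a b c e g; lia.
  apply: (le_trans (ler_wpM2r rt0 dle)); rewrite mulrDl (natrD _ _ 2) [X in _ <= X]mulrDl.
  apply: lerD; first by move: disc; rewrite /discrepancy natrM natrX.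
  have le1 : (#|F| ^ n.-1)%:R * rt <= q ^+ n.
    rewrite natrX -[X in q ^+ X](prednK n0) exprSr ler_wpM2l ?exprn_ge0 //.
    by rewrite -rtq ler_peMr.
  by rewrite natrD mulrDl mulr_natl mulr2n lerD.
rewrite -(ler_nat algC) natrM !natrX.
have -> : d%:R ^+ 2 * #|F|%:R = (d%:R * rt) ^+ 2 :> algC by rewrite exprMn sqrtCK.
by rewrite ler_pXn2r ?nnegrE ?mulr_ge0 ?ler0n // natrM natrX.
Qed.

End Counting.

(* Asymptotic equivalence A ~ B, A/B -> 1 as q -> oo, with n, m, eps, K fixed
   and the field, the index set and the prescribed coefficients varying with q:
   for every delta > 0 the quotient is within delta of 1 for all admissible data
   over any finite field with q >= Q elements. *)
Theorem corollary6 (R : realType) (eps K : R) (n m : nat)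
    (eps_gt0 : 0 < eps) (eps_lt : eps < 1 / 4) (K_gt0 : 0 < K)
    (n_gt0 : (0 < n)%N) (m_gt0 : (0 < m)%N) :
  forall delta : R, 0 < delta ->
  exists Q : nat,
  forall (F : finFieldType) (I : {set 'I_n}) (alpha : 'I_n -> F),
    (Q <= #|F|)%N ->
    I != finset.set0 ->
    m%:R <= n%:R / 100 :> R ->
    #|I|%:R < n%:R / 24 :> R ->
    (2 + eps) * logb #|F|%:R n%:R <= m%:R ->
    (m <= n)%N ->
    Num.sqrt (n%:R * ln n%:R) <= K * m%:R ->
    (forall i : 'I_n, i \in I -> (i : nat) <> 0%N) ->
    `| #|` fset_set (smooths F n m `&` prescribed I alpha)|%:R
         / (#|F|%:R ^- #|I| * (Psi F n m)%:R) - 1 | < delta.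
Proof.
move=> delta delta0.
pose C := (smooth_const m n + 2)%N; pose c := (2 ^ n * n`!)%N.
have D0 : 0 <= (C * c)%:R ^+ 2 / delta ^+ 2 :> R.
  by rewrite divr_ge0 ?exprn_ge0 ?ler0n ?ltW.
(* The relative error is at most [C * c / sqrt q], where [c] comes from [q ^ n <= c * Psi]; the
   latter needs [2 * n <= q], so that each [q - i] in the binomial is at least [q / 2]. *)
exists (maxn (2 * n) (Num.bound ((C * c)%:R ^+ 2 / delta ^+ 2))).
move=> F I alpha; rewrite geq_max => /andP[nF QF] _ mn I24 _ _ _ I0.
have {}mn : (100 * m <= n)%N.
  by move: mn; rewrite ler_pdivlMr // -natrM ler_nat mulnC.
have {}I24 : (24 * #|I| < n)%N.
  by move: I24; rewrite ltr_pdivlMr // -natrM ltr_nat mulnC.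
(* Passage to indices up to [n]; the value of [alpha'] at [n] is a dummy 0, and [n] is not in
   [I']. *)
pose I' : {set 'I_n.+1} := [set widen_ord (leqnSn n) i | i in I]%SET.
pose alpha' (i : 'I_n.+1) : F := if insub (i : nat) is Some j then alpha j else 0.
have cardI' : #|I'| = #|I|.
  by rewrite card_imset // => i j /(congr1 val) /= /val_inj.
have cndE f : fits I' (fixed alpha') f = [forall (i | i \in I), f`_i == alpha i].
  have E (i : 'I_n) : alpha' (widen_ord (leqnSn n) i) = alpha i.
    by rewrite /alpha' /= insubT //= => ltin; congr alpha; apply: val_inj.
  apply/forall_inP/forall_inP => [H i iI|H _ /imsetP[i iI ->]].
    by have := H _ (imset_f _ iI); rewrite /fixed E.
  by rewrite /fixed E; apply: H.
have I'mid i : i \in I' -> (0 < i < n)%N.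
  by case/imsetP => j jI -> /=; rewrite ltn_ord andbT lt0n; apply/eqP/I0.
set A := #|` _|.
have AE : A = size [seq f : {poly F} <- Mon n | `[< smooth m f >] && fits I' (fixed alpha') f].
  apply: card_fset_set_seq; first exact: finite_smooths_prescribed.
    exact/filter_uniq/uniq_Mon.
  move=> f; rewrite mem_filter cndE; split.
    case/andP=> /andP[/asboolP sf /forall_inP cf] fn.
    split; first by split=> //; apply/monicsP.
    by split=> [|i iI]; [apply/monicsP | apply/eqP/cf].
  case=> -[fn sf] [_ cf]; rewrite asboolT //=; apply/andP; split; last exact/monicsP.
  by apply/forall_inP => i iI; apply/eqP/cf.
pose d := (#|F| ^ #|I| * A - Psi F n m + (Psi F n m - #|F| ^ #|I| * A))%N.
have dle : (d ^ 2 * #|F| <= (C * #|F| ^ n) ^ 2)%N.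
  apply: (@smooth_count_bound F n m I' alpha') => //; first by rewrite cardI'.
  by rewrite -AE cardI'.
have Psile : (#|F| ^ n <= c * Psi F n m)%N by apply: expn_le_Psi.
have F0 : (0 < #|F|)%N by apply: ltnW; apply: card_finNzRing_gt1.
have Psi0 : (0 < Psi F n m)%N.
  rewrite lt0n; apply: contraTneq Psile => ->.
  by rewrite muln0 -ltnNge expn_gt0 F0.
have PsiR : 0 < (Psi F n m)%:R :> R by rewrite ltr0n.
have qI : (#|F|%:R ^+ #|I| : R) != 0 by rewrite expf_neq0 // pnatr_eq0 -lt0n.
have -> : A%:R / (#|F|%:R ^- #|I| * (Psi F n m)%:R) - 1 =
    ((#|F| ^ #|I| * A)%:R - (Psi F n m)%:R) / (Psi F n m)%:R :> R.
  by rewrite mulrBl divff ?gt_eqF // natrM natrX invfM invrK mulrA (mulrC A%:R).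
rewrite normrM natr_dist -/d normfV normr_nat ltr_pdivrMr // ltNge; apply/negP => le.
have : (delta * (Psi F n m)%:R) ^+ 2 * #|F|%:R <= ((C * c)%:R * (Psi F n m)%:R) ^+ 2.
  apply: (@le_trans _ _ (d%:R ^+ 2 * #|F|%:R)).
    by rewrite ler_wpM2r ?ler0n // ler_pXn2r ?nnegrE ?ler0n ?mulr_ge0 ?(ltW delta0) ?(ltW PsiR).
  rewrite -natrX -natrM -natrM -natrX ler_nat; apply: (leq_trans dle).
  by rewrite leq_exp2r // -mulnA leq_mul2l Psile orbT.
rewrite !exprMn mulrAC ler_pM2r ?exprn_gt0 // mulrC -ler_pdivlMr ?exprn_gt0 //.
rewrite leNgt => /negP; apply.
by apply: (lt_le_trans (archi_boundP D0)); rewrite ler_nat.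
Qed.
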